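(* Let $d\ge 1$, let $R\subset\mathbb{R}^d$ be a bounded convex region with non-empty interior, and let $\omega_1,\ldots,\omega_d\in\mathbb{R}$ be such that $1,\omega_1,\ldots,\omega_d$ form a $\mathbb{Q}$-basis for an algebraic number field $\Phi\subset\mathbb{R}$. Let $r\ge 1$ denote the rank of the unit group $\mathbb{Z}_\Phi^\times$. For $t\ge1$ let $M(t)$, $\ell(t)=|M(t)|$, the points $y_i(t)$ and the spacings $\delta_i(t)$ be as defined in the context. Then there exist a finite set $\mathcal{S}=\{s_1,\ldots,s_J\}\subset\Phi$ (with $s_1,\ldots,s_J$ distinct) and units $u(t)\in\mathbb{Z}_\Phi^\times$, $t>1$, such that $u(t)\delta_i(t)\in\mathcal{S}$ for all $t>1$ and all $1\le i\le\ell(t)-1$, and such that for every integer $l\ge 0$ the following holds. For each choice of $1\le j_0,\ldots,j_l\le J$ let $p_{j_0,\ldots,j_l}(t)$ denote the proportion of the points from $\{y_i(t):1\le i\le\ell(t)-l-1\}$ such that $$\delta_{i+n}(t)=y_{i+n+1}(t)-y_{i+n}(t)=s_{j_n}\,u(t)^{-1}\qquad\text{for all } 0\le n\le l,$$ that is, such that the sequence of $l+1$ consecutive rescaled spacings starting at $y_i(t)$ forms the word $s_{j_0}s_{j_1}\ldots s_{j_l}$. Then there are an integer $0\le k\le d+1$, a Lipschitz continuous function $$h:\mathbb{T}^k\times[0,1]^r\to P:=\Bigl\{(p_{j_0,\ldots,j_l})_{1\le j_0,\ldots,j_l\le J}:\ \textstyle\sum p_{j_0,\ldots,j_l}=1,\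 p_{j_0,\ldots,j_l}\ge0\Bigr\},$$ angles $\boldsymbol{\theta}=(\theta_1,\ldots,\theta_k)\in\mathbb{R}^k$, rates $\boldsymbol{\beta}=(\beta_1,\ldots,\beta_r)\in\mathbb{R}^r$, and $0<\alpha<1$ such that, as $t\to\infty$, $$\bigl(p_{j_0,\ldots,j_l}(t)\bigr)_{1\le j_0,\ldots,j_l\le J}=h\bigl(\boldsymbol{\theta}\log t,\ \{\boldsymbol{\beta}\log t\}\bigr)+\mathcal{O}(\alpha^{\log t}).$$
   Context: For $t\ge1$, $R(t)=\{t\boldsymbol{v}:\boldsymbol{v}\in R\}$ is the homothetic dilation of $R$ about the origin by a factor of $t$, $M(t)=R(t)\cap\mathbb{Z}^d$ and $\ell(t)=|M(t)|$. Write $\boldsymbol{\omega}=(\omega_1,\ldots,\omega_d)$ and $\{x\}$ for the fractional part of a real number $x$. The elements of $Y(t)=\{\{\boldsymbol{m}\cdot\boldsymbol{\omega}\}:\boldsymbol{m}\in M(t)\}$ are written in increasing order as $0\le y_1(t)\le\cdots\le y_{\ell(t)}(t)<1$, and the spacings are $\delta_i(t)=y_{i+1}(t)-y_i(t)$ for $1\le i\le\ell(t)-1$. The rescaled spacings are $u(t)\delta_i(t)$. $\mathbb{Z}_\Phi$ is the ring of integers of $\Phi$ and $\mathbb{Z}_\Phi^\times$ its group of units. $\mathbb{T}=\mathbb{R}/\mathbb{Z}$; the vector $\boldsymbol{\theta}\log t\in\mathbb{R}^k$ is reduced modulo $\mathbb{Z}^k$ to give a point of $\mathbb{T}^k$,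 and $\{\boldsymbol{\beta}\log t\}:=(\{\beta_1\log t\},\ldots,\{\beta_r\log t\})\in[0,1]^r$. The error term $\mathcal{O}(\cdot)$ for vectors is understood componentwise. *)

(* Defs.v *)
From HB Require Import structures.
From mathcomp Require Import all_boot all_order all_algebra all_field.
From mathcomp Require Import finmap.
From mathcomp Require Import all_classical all_reals all_analysis.

Set Implicit Arguments.
Unset Strict Implicit.
Unset Printing Implicit Defensive.

Import Order.TTheory GRing.Theory Num.Theory.
Import numFieldNormedType.Exports.

Local Open Scope classical_set_scope.
Local Open Scope ring_scope.
Local Open Scope quotient_scope.

(* A number field is a [fieldExtType rat]; a real number field is one that
   comes with a (necessarily injective) ring morphism into the reals. *)

Definition ring_of_integers (L : fieldExtType rat) : set L :=
  [set x | integralOver (intr : int -> L) x].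

Definition unit_group (L : fieldExtType rat) : set L :=
  [set u | ring_of_integers u /\ exists2 v, ring_of_integers v & u * v = 1].

(* In [e i ^ a i] the exponent is an integer, possibly negative. *)
Definition mult_independent (L : fieldExtType rat) (n : nat) (e : 'I_n -> L) :=
  forall a : 'I_n -> int, \prod_(i < n) e i ^ a i = 1 -> forall i, a i = 0.

(* The rank of an abelian group is the largest number of Z-linearly independent
   elements (here in multiplicative notation). *)
Definition unit_group_rank (L : fieldExtType rat) (r : nat) : Prop :=
  (exists e : 'I_r -> L, (forall i, unit_group (e i)) /\ mult_independent e) /\
  (forall (n : nat) (e : 'I_n -> L),
     (forall i, unit_group (e i)) -> mult_independent e -> (n <= r)%N).

Definition fract (R : realType) (x : R) : R := x - (Num.floor x)%:~R.

Definition dilation (R : realType) (d : nat) (A : set 'rV[R]_d) (t : R) :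
  set 'rV[R]_d := [set t *: v | v in A].

Definition lattice_points (R : realType) (d : nat) (A : set 'rV[R]_d) (t : R) :
  set 'rV[int]_d := [set m | dilation A t (map_mx intr m)].

(* [fset_set] is meaningful here because the set is finite for bounded A. *)
Definition ell (R : realType) (d : nat) (A : set 'rV[R]_d) (t : R) : nat :=
  #|` fset_set (lattice_points A t)|%fset.

Definition dotz (R : realType) (d : nat) (m : 'rV[int]_d) (omega : 'I_d -> R) : R :=
  \sum_(i < d) (m 0 i)%:~R * omega i.

(* The points {m . omega} in increasing order, listed once for each m; they are
   pairwise distinct when 1, omega_1, ..., omega_d are Q-linearly independent. *)
Definition sorted_points (R : realType) (d : nat) (A : set 'rV[R]_d)
    (omega : 'I_d -> R) (t : R) : seq R :=
  sort <=%R [seq fract (dotz m omega) | m <- fset_set (lattice_points A t)].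

(* Indices start at 1: the points are y 1 <= ... <= y (ell t). *)
Definition y (R : realType) (d : nat) (A : set 'rV[R]_d) (omega : 'I_d -> R)
    (t : R) (i : nat) : R := nth 0 (sorted_points A omega t) i.-1.

Definition delta (R : realType) (d : nat) (A : set 'rV[R]_d) (omega : 'I_d -> R)
    (t : R) (i : nat) : R := y A omega t i.+1 - y A omega t i.

(* The points are distinct, so counting indices counts points. The value is the
   junk 0 / 0 = 0 when ell t <= l + 1. *)
Definition word_proportion (R : realType) (d : nat) (A : set 'rV[R]_d)
    (omega : 'I_d -> R) (J l : nat) (s : 'I_J -> R) (u : R) (t : R)
    (w : l.+1.-tuple 'I_J) : R :=
  (count (fun i => [forall n : 'I_l.+1,
            delta A omega t (i + n) == s (tnth w n) * u^-1])
         (iota 1 (ell A t - l - 1)))%:R / (ell A t - l - 1)%:R.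

Definition congr1 (R : realType) : rel R := [rel x y | (x - y) \is a Num.int].

Lemma congr1_equiv (R : realType) : equiv_class_of (@congr1 R).
Proof.
split=> [x|x y|y x z]; rewrite /congr1 /=; first by rewrite subrr.
- by rewrite -opprB rpredN.
- by move=> xy yz; rewrite -(subrKA y) rpredD.
Qed.

Definition congr1_equivRel (R : realType) : equiv_rel R :=
  EquivRelPack (congr1_equiv R).

Definition circle (R : realType) : Type := {eq_quot congr1_equivRel R}.


(* The quotient distance on R / Z: distance from [repr a - repr b] to the nearest
   integer, whatever the representatives. *)
Definition circle_dist (R : realType) (a b : circle R) : R :=
  let x := fract (repr a - repr b) in Num.min x (1 - x).

Definition torus_dist (R : realType) (k : nat) (x x' : 'rV[circle R]_k) : R :=
  \big[Num.max/0]_(i < k) circle_dist (x 0 i) (x' 0 i).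

Definition torus_pi (R : realType) (k : nat) (v : 'rV[R]_k) : 'rV[circle R]_k :=
  map_mx \pi_(circle R) v.

Definition unit_cube (R : realType) (r : nat) : set 'rV[R]_r :=
  [set z | forall i, 0 <= z 0 i <= 1].

Definition simplex (R : realType) (W : finType) : set (W -> R) :=
  [set p | \sum_(w : W) p w = 1 /\ forall w, 0 <= p w].

(* h is only looked at on T^k x [0, 1]^r. *)
Definition maps_to_simplex (R : realType) (k r : nat) (W : finType)
    (h : 'rV[circle R]_k -> 'rV[R]_r -> W -> R) : Prop :=
  forall x z, unit_cube z -> simplex (h x z).

(* `|z - z'| is the sup norm on row vectors. *)
Definition torus_cube_lipschitz (R : realType) (k r : nat) (W : finType)
    (h : 'rV[circle R]_k -> 'rV[R]_r -> W -> R) : Prop :=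
  exists C : R, forall x x' z z', unit_cube z -> unit_cube z' ->
    forall w, `|h x z w - h x' z' w| <= C * Num.max (torus_dist x x') `|z - z'|.

(* Main.v *)
Require Import Defs.
From HB Require Import structures.
From mathcomp Require Import all_boot all_order all_algebra all_field.
From mathcomp Require Import finmap complex.
From mathcomp Require Import all_classical all_reals all_analysis.
From mathcomp Require Import ring lra zify.

(** Why the theorem holds. Write [lattice_lift m = m . b + n], with [n] chosen so that its real value lies in
[[0, 1)]: this identifies the points at time [t] with the elements of the lattice spanned by
[1, b_1, ..., b_d] whose real value is in [[0, 1)] and whose integer coordinates lie in [t A].
Choose a unit [w t] that preserves the lattice, whose real value is of order [t ^- d] and all of
whose other conjugates are of order [t]. Multiplication by its inverse brings the problem to bounded
size: a gap between consecutive points is [iota (w t * s)] with [s] in the lattice, with bounded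
conjugates, hence in a finite set ([rescaled_gap_bounded], [finite_step_set]). Moreover the successor
of a point [m] is [m] plus the integer coordinates of [w t * s] for the shortest [s] in that set that
keeps it in [t A] ([next_point]). So whether a word starts at [m] is a Boolean function of the
statements that [m / t + v] belongs to [A], where [v] ranges over finitely many shifts of bounded
size ([return_word_gaps]). The proportion of a word is therefore a ratio of two numbers of integer
points in dilated sets built from finitely many translates of a convex set.

The number of integer points of such a set is its volume times [t ^ d] up to [O (t ^ (d - 1))], and
moving the translates by [delta] changes the proportion by [O (delta + 1 / t)]. All of this follows
from one count, [convex_boundary_count]: two displaced copies of a grid are separated by a convex
set at few points, because a line meets the set in an interval. The limiting frequencies are
obtained directly as limits of proportions, without measure theory: refining the grid, or dilating
it slightly, changes the proportion by [O (1 / t)] ([ratio_limit]). The error [1 / t] is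
[alpha ^ log t] for [alpha = exp (- 1)].

It remains to describe how the shifts depend on [t]. The box principle gives units with the required
sizes for a sequence of [t] ([order_units]). Their logarithmic vectors stay close to a ray, so this
ray lies in the real span of the logarithmic unit lattice ([unit_ray]): there are [r] units
[eps_i], some of them possibly trivial, and real [beta_i] such that the product of the
[|eps_i| ^ beta_i] is [e] at every place but the given real one. With [w t] the product of the
powers of [eps_i] of exponent
[floor (beta_i log t)], the conjugates of [w t / t] depend smoothly on the fractional parts
[{beta_i log t}] and on one angle for each embedding, which is linear in [log t]
([embed_unit_scale]); the shifts are linear in these conjugates, up to the contribution of the real
place, which is [O (1 / t)] ([displacement_close]). Thus [h] is the limiting frequency as a function
of the angles and of the fractional parts. In its definition a point without an admissible step
receives a default step, so that the words define a partition for all values of the parameters and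
[h] takes its values in the simplex. *)
Set Implicit Arguments.
Unset Strict Implicit.
Unset Printing Implicit Defensive.
Import Order.TTheory GRing.Theory Num.Theory.
Import numFieldNormedType.Exports.
Local Open Scope classical_set_scope.
Local Open Scope ring_scope.
Import ComplexField.Normc.

(** * Embeddings of a number field *)

Lemma morph_ratZ (L : fieldExtType rat) (K : numFieldType) (f : {rmorphism L -> K})
  (a : rat) (x : L) : f (a *: x) = ratr a * f x.
Proof.
rewrite -mulr_algl rmorphM; congr (_ * _).
exact: (fmorph_eq_rat (f \o in_alg L)).
Qed.

(** The conjugates of a primitive element are distinct because the characteristic is zero;
evaluating polynomials at them gives as many embeddings as the degree, and a Vandermonde
determinant shows that they separate the vectors of any basis. *)
Lemma number_field_embeddings (L : fieldExtType rat) (C : numClosedFieldType)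
    (n : nat) (e : n.-tuple L) :
    basis_of {:L} e ->
  exists sg : 'I_n -> {rmorphism L -> C},
    (\matrix_(k, j) sg j e`_k \in unitmx) /\
    forall f : {rmorphism L -> C}, exists j, f =1 sg j.
Proof.
move=> he.
have dimL : \dim {:L} = n by rewrite (size_basis he).
have ch0 : has_pchar0 L by move=> p; rewrite (fmorph_pchar (in_alg L)) pchar_num.
pose a := separable_generator 1%AS {:L}%AS.
have La : {:L}%VS = <<1; a>>%VS.
  apply: (eq_adjoin_separable_generator _ (sub1v _)).
  by apply/separableP => y _; apply: pcharf0_separable.
have [p0 hp0] := polyOver1P (minPolyOver 1%AS a).
have sz_p0 : size p0 = n.+1.
  rewrite -(size_map_poly (in_alg L)) -hp0 size_minPoly.
  by rewrite -dimL [in RHS]La dim_Fadjoin dimv1 muln1.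
have sep_p0 : separable_poly p0.
  by rewrite -(separable_map (in_alg L)) -hp0; apply: pcharf0_separable.
have mon_p0 : p0 \is monic.
  by rewrite -(map_monic (in_alg L)) -hp0 monic_minPoly.
have p0a q : (map_poly (in_alg L) q).[a] = 0 -> p0 %| q.
  move=> qa; rewrite -(dvdp_map (in_alg L)) -hp0.
  by apply: minPoly_dvdp; [apply/polyOver1P; exists q | apply/rootP].
have [rs hrs] := closed_field_poly_normal (map_poly ratr p0 : {poly C}).
have lc1 : lead_coef (map_poly ratr p0 : {poly C}) = 1.
  by rewrite lead_coef_map (monicP mon_p0) rmorph1.
rewrite lc1 scale1r in hrs.
have uniq_rs : uniq rs by rewrite -separable_prod_XsubC -hrs separable_map.
have size_rs : size rs = n.
  by have := congr1 (fun p : {poly C} => size p) hrs; rewrite size_map_poly sz_p0 size_prod_XsubC => -[].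
have hq x : exists q : {poly rat}, (map_poly (in_alg L) q).[a] == x.
  have xa : x \in <<1; a>>%VS by rewrite -La memvf.
  have [q hq] := polyOver1P (Fadjoin_polyOver 1%AS a x).
  by exists q; rewrite -hq Fadjoin_poly_eq.
pose q x := xchoose (hq x).
have qK x : (map_poly (in_alg L) (q x)).[a] = x := eqP (xchooseP (hq x)).
pose ev z x := (map_poly ratr (q x) : {poly C}).[z].
have evE z p : z \in rs -> ev z ((map_poly (in_alg L) p).[a]) = (map_poly ratr p).[z].
  move=> zrs; rewrite /ev; set x := (map_poly _ _).[a].
  have /dvdpP[s hs] : p0 %| q x - p.
    by apply: p0a; rewrite rmorphB hornerD hornerN qK subrr.
  have rz : (map_poly ratr p0 : {poly C}).[z] = 0.
    by apply/rootP; rewrite hrs root_prod_XsubC.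
  by apply/eqP; rewrite -subr_eq0 -hornerN -hornerD -rmorphB hs rmorphM hornerM rz mulr0.
have evM z : z \in rs -> zmod_morphism (ev z) /\ monoid_morphism (ev z).
  move=> zrs; split=> [x y|]; last split=> [|x y].
  - rewrite -{1}(qK x) -{1}(qK y) -hornerN -hornerD -rmorphB evE //.
    by rewrite rmorphB hornerD hornerN.
  - have -> : 1 = (map_poly (in_alg L) 1).[a] by rewrite rmorph1 hornerC.
    by rewrite evE // rmorph1 hornerC.
  - by rewrite -{1}(qK x) -{1}(qK y) -hornerM -rmorphM evE // rmorphM hornerM.
have evR z : z \in rs -> {f : {rmorphism L -> C} | f =1 ev z}.
  case/evM=> fA fM.
  pose A := GRing.isZmodMorphism.Build L C (ev z) fA.
  pose M := GRing.isMonoidMorphism.Build L C (ev z) fM.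
  pose F : {rmorphism L -> C} := HB.pack (ev z) A M.
  by exists F.
have zin (j : 'I_n) : rs`_j \in rs by rewrite mem_nth ?size_rs.
pose sg j := sval (evR _ (zin j)).
have sgE j x : sg j x = ev rs`_j x by rewrite /sg; case: (evR _ _) => f /= ->.
have ea z : z \in rs -> ev z a = z.
  have -> : a = (map_poly (in_alg L) 'X).[a] by rewrite map_polyX hornerX.
  by move=> zrs; rewrite evE // map_polyX hornerX.
exists sg; split.
  pose Z : 'rV[C]_n := \row_j rs`_j.
  have detV : \det (Vandermonde n Z) != 0.
    rewrite det_Vandermonde; apply/prodf_neq0 => i _; apply/prodf_neq0 => j ij.
    by rewrite !mxE subr_eq0 nth_uniq ?size_rs // neq_ltn ij orbT.
  have VE : Vandermonde n Z =
      (\matrix_(i < n, k < n) ratr (coord e k (a ^+ i))) *m \matrix_(k, j) sg j e`_k.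
    apply/matrixP => i j; rewrite !mxE -{1}(ea _ (zin j)) -sgE -rmorphXn.
    rewrite {1}(coord_basis he (memvf (a ^+ i))) rmorph_sum.
    by apply: eq_bigr => k _; rewrite !mxE morph_ratZ.
  by move: detV; rewrite VE det_mulmx mulf_eq0 negb_or unitmxE unitfE => /andP[].
move=> f.
have fE p : f ((map_poly (in_alg L) p).[a]) = (map_poly ratr p).[f a].
  rewrite -horner_map -map_poly_comp; congr (_.[_]).
  by apply: eq_map_poly => c; apply: (fmorph_eq_rat (f \o in_alg L)).
have /rootP : (map_poly ratr p0 : {poly C}).[f a] = 0.
  by rewrite -fE -hp0 (rootP (root_minPoly _ _)) rmorph0.
rewrite hrs root_prod_XsubC => fa.
have ltj : (index (f a) rs < n)%N by rewrite -size_rs index_mem.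
exists (Ordinal ltj) => x.
by rewrite sgE /= nth_index // -{1}(qK x) fE.
Qed.

(** * The multiplier ring of a lattice *)

Lemma det_int (n : nat) (M : 'M[rat]_n) :
  (forall i j, M i j \is a Num.int) -> \det M \is a Num.int.
Proof.
move=> hM; rewrite /determinant rpred_sum // => s _.
by rewrite rpredM ?rpredX ?rpredN ?rpred1 // rpred_prod.
Qed.

Section Order.
Variables (L : fieldExtType rat) (n : nat) (e : n.-tuple L).
Hypothesis he : basis_of {:L} e.

Definition in_lattice (x : L) := forall k, coord e k x \is a Num.int.

(** The multiplier ring of the lattice: an order of the field whose units, unlike those of the full
ring of integers, map the lattice onto itself. *)
Definition in_order (x : L) := forall y, in_lattice y -> in_lattice (x * y).

Definition order_unit (x : L) := [/\ x != 0, in_order x & in_order x^-1].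

Definition mul_mx (x : L) : 'M[rat]_n := \matrix_(k, l) coord e l (x * e`_k).

Lemma coordE x : x = \sum_k coord e k x *: e`_k.
Proof. exact: (coord_basis he (memvf x)). Qed.

Lemma coord_e (k l : 'I_n) : coord e l e`_k = (k == l)%:R.
Proof. exact: coord_free (basis_free he). Qed.

Lemma in_latticeB x y : in_lattice x -> in_lattice y -> in_lattice (x - y).
Proof. by move=> hx hy k; rewrite linearB rpredB ?hx ?hy. Qed.

Lemma in_lattice_sum (I : Type) (s : seq I) (P : pred I) (f : I -> rat) (y : I -> L) :
  (forall i, f i \is a Num.int) -> (forall i, in_lattice (y i)) ->
  in_lattice (\sum_(i <- s | P i) f i *: y i).
Proof.
by move=> hf hy k; rewrite linear_sum rpred_sum // => i _; rewrite linearZ rpredM // hy.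
Qed.

Lemma in_lattice_e (k : 'I_n) : in_lattice e`_k.
Proof. by move=> l; rewrite coord_e. Qed.

Lemma in_order_e x : (forall k : 'I_n, in_lattice (x * e`_k)) -> in_order x.
Proof.
move=> hx y hy; rewrite (coordE y) mulr_sumr.
rewrite (eq_bigr (fun i : 'I_n => coord e i y *: (x * e`_i))) => [|i _]; last first.
  by rewrite scalerAr.
exact: in_lattice_sum.
Qed.

Lemma in_order1 : in_order 1. Proof. by move=> y; rewrite mul1r. Qed.

Lemma in_orderM x y : in_order x -> in_order y -> in_order (x * y).
Proof. by move=> hx hy z hz; rewrite -mulrA; apply/hx/hy. Qed.

Lemma in_orderD x y : in_order x -> in_order y -> in_order (x + y).
Proof. by move=> hx hy z hz k; rewrite mulrDl linearD rpredD ?hx ?hy. Qed.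

Lemma order_unit1 : order_unit 1.
Proof. by split; rewrite ?oner_neq0 ?invr1 //; apply: in_order1. Qed.

Lemma order_unitM x y : order_unit x -> order_unit y -> order_unit (x * y).
Proof.
move=> [x0 ox ox'] [y0 oy oy']; split; rewrite ?mulf_neq0 ?invfM //.
  exact: in_orderM.
exact: in_orderM.
Qed.

Lemma order_unitV x : order_unit x -> order_unit x^-1.
Proof. by move=> [x0 ox ox']; split; rewrite ?invr_eq0 ?invrK. Qed.

Lemma order_unitXz x (m : int) : order_unit x -> order_unit (x ^ m).
Proof.
move=> ux; have uX k : order_unit (x ^+ k).
  by elim: k => [|k IH]; [apply: order_unit1 | rewrite exprS; apply: order_unitM].
by case: m => k; rewrite ?NegzE ?exprnN -?exprnP //; apply: order_unitV.
Qed.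

Lemma order_unit_prod (I : Type) (s : seq I) (P : pred I) (f : I -> L) :
  (forall i, order_unit (f i)) -> order_unit (\prod_(i <- s | P i) f i).
Proof.
by move=> hf; apply: big_ind => //; [apply: order_unit1 | apply: order_unitM].
Qed.

Lemma mul_mx_sum x (k : 'I_n) : x * e`_k = \sum_l mul_mx x k l *: e`_l.
Proof. by rewrite [LHS]coordE; apply: eq_bigr => l _; rewrite mxE. Qed.

Lemma mul_mxM x y : mul_mx (x * y) = mul_mx x *m mul_mx y.
Proof.
apply/matrixP => k l; rewrite !mxE mulrAC mul_mx_sum mulr_suml linear_sum.
by apply: eq_bigr => m _; rewrite -scalerAl linearZ [mul_mx y m l]mxE [y * _]mulrC.
Qed.

Lemma mul_mx1 : mul_mx 1 = 1%:M.
Proof. by apply/matrixP => k l; rewrite !mxE mul1r coord_e. Qed.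

Lemma mul_mxZ a x : mul_mx (a *: x) = a *: mul_mx x.
Proof. by apply/matrixP => k l; rewrite !mxE -scalerAl linearZ. Qed.

Lemma mul_mx_int x : in_order x -> forall i j, mul_mx x i j \is a Num.int.
Proof. by move=> hx i j; rewrite mxE; apply/hx/in_lattice_e. Qed.

Lemma in_order_mx x : (forall i j, mul_mx x i j \is a Num.int) -> in_order x.
Proof. by move=> h; apply: in_order_e => k l; have := h k l; rewrite mxE. Qed.

Definition field_norm x := \det (mul_mx x).

Lemma field_norm_neq0 x : x != 0 -> field_norm x != 0.
Proof.
move=> x0; apply/eqP => h.
have : \det (mul_mx (x * x^-1)) = 1 by rewrite divff // mul_mx1 det1.
by rewrite mul_mxM det_mulmx -/(field_norm x) h mul0r => /eqP; rewrite eq_sym oner_eq0.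
Qed.

Lemma field_norm_int x : in_order x -> field_norm x \is a Num.int.
Proof. by move=> ox; apply/det_int/mul_mx_int. Qed.

(** The adjugate of an integer matrix is integral, so an element of the order divides
its norm there. *)
Lemma in_order_norm_div x : x != 0 -> in_order x -> in_order (field_norm x *: x^-1).
Proof.
move=> x0 ox; apply: in_order_mx => i j; rewrite mul_mxZ.
have -> : field_norm x *: mul_mx x^-1 = \adj (mul_mx x).
  have := mul_mx_adj (mul_mx x) => /(congr1 (mulmx (mul_mx x^-1))).
  rewrite mulmxA -mul_mxM mulVf // mul_mx1 mul1mx => ->.
  by rewrite mul_mx_scalar.
rewrite mxE /cofactor rpredM ?rpredX ?rpredN ?rpred1 //.
by apply: det_int => k l; rewrite !mxE; apply/ox/in_lattice_e.
Qed.

(** [x] is an eigenvalue of the integer matrix of multiplication by [x], hence a root of its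
characteristic polynomial. *)
Lemma in_order_integral x : in_order x -> integralOver (intr : int -> L) x.
Proof.
move=> ox.
have [n0|n_gt0] := posnP n.
  have := coordE 1; rewrite big1 => [/eqP|i _]; first by rewrite oner_eq0.
  by have := ltn_ord i; rewrite {2}n0.
pose A : 'M[int]_n := \matrix_(k, l) Num.floor (mul_mx x l k).
exists (char_poly A); first exact: char_poly_monic.
rewrite map_char_poly -eigenvalue_root_char.
apply/eigenvalueP; exists (\row_k e`_k).
  apply/rowP => k; rewrite !mxE mul_mx_sum; apply: eq_bigr => l _.
  have /intrP[m hm] := mul_mx_int ox k l; rewrite mxE in hm.
  by rewrite !mxE hm intrKfloor scaler_int -mulrzl mulrC.
apply/eqP => /rowP/(_ (Ordinal n_gt0)); rewrite !mxE => e0.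
by have := free_not0 (basis_free he) (mem_nth 0 (_ : 0 < size e)%N); rewrite e0 eqxx size_tuple; move/(_ n_gt0).
Qed.

(** Take for [D] a common denominator of the structure constants of the basis. *)
Lemma lattice_in_order : exists2 D : nat, (0 < D)%N & forall x, in_lattice x -> in_order (x *+ D).
Proof.
pose a (p : 'I_n * 'I_n * 'I_n) := coord e p.2 (e`_p.1.1 * e`_p.1.2).
pose D := (\prod_p `|denq (a p)|)%N.
exists D; first by rewrite prodn_gt0 // => p; rewrite absz_gt0 denq_neq0.
have hD p : a p *+ D \is a Num.int.
  rewrite -mulr_natr /D (bigD1 p) //= natrM mulrA rpredM ?rpred_nat //.
  rewrite -{1}(divq_num_den (a p)) natr_absz gtr0_norm ?denq_gt0 //.
  by rewrite divfK ?intr_eq0 ?denq_neq0 // rpred_int.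
move=> x hx; apply: in_order_e => k l.
rewrite {1}(coordE x) -sumrMnl mulr_suml linear_sum rpred_sum // => i _.
rewrite scalerMnr -scalerAl linearZ /= rpredM //.
rewrite mulrnAl linearMn; exact: (hD (i, k, l)).
Qed.

Variables (K : numFieldType) (sg : 'I_n -> {rmorphism L -> K}).

Definition embed_mx : 'M[K]_n := \matrix_(k, j) sg j e`_k.

Lemma embed_sum j x : sg j x = \sum_k ratr (coord e k x) * sg j e`_k.
Proof. by rewrite {1}(coordE x) rmorph_sum; apply: eq_bigr => k _; rewrite morph_ratZ. Qed.

Hypothesis hE : embed_mx \in unitmx.

Lemma coord_embed k x : ratr (coord e k x) = \sum_j sg j x * invmx embed_mx j k.
Proof.
have : (\row_j sg j x) = (\row_k ratr (coord e k x)) *m embed_mx.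
  by apply/rowP => j; rewrite !mxE embed_sum; apply: eq_bigr => l _; rewrite !mxE.
move=> /(congr1 (mulmx^~ (invmx embed_mx))); rewrite mulmxK // => /rowP/(_ k).
by rewrite !mxE => <-; apply: eq_bigr => j _; rewrite mxE.
Qed.

(** The embeddings diagonalise multiplication by [x]. *)
Lemma field_norm_prod x : ratr (field_norm x) = \prod_j sg j x.
Proof.
have h : map_mx ratr (mul_mx x) *m embed_mx = embed_mx *m diag_mx (\row_j sg j x).
  apply/matrixP => k j; rewrite mul_mx_diag !mxE mulrC -rmorphM mul_mx_sum rmorph_sum.
  by apply: eq_bigr => l _; rewrite !mxE morph_ratZ.
have := congr1 determinant h; rewrite !det_mulmx det_diag mulrC.
have /mulfI : \det embed_mx != 0 by rewrite -unitfE -unitmxE.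
move=> inj /inj; rewrite det_map_mx => ->.
by apply: eq_bigr => j _; rewrite mxE.
Qed.

End Order.

(** * Absolute values and lattice elements *)

Section Modulus.
Variable R : rcfType.
Implicit Types x y : R[i].

Lemma normc_ge0 x : 0 <= normc x.
Proof. by case: x => a b; apply: sqrtr_ge0. Qed.

Lemma normc_gt0 x : x != 0 -> 0 < normc x.
Proof. by move=> x0; rewrite lt0r normc_ge0 andbT; apply: contra_neq x0 => /eq0_normc. Qed.

Lemma normc_real (a : R) : normc (a%:C)%C = `|a|.
Proof. by rewrite /= expr0n addr0 sqrtr_sqr. Qed.

Lemma normc_prod (I : Type) (s : seq I) (P : pred I) (F : I -> R[i]) :
  normc (\prod_(i <- s | P i) F i) = \prod_(i <- s | P i) normc (F i).
Proof. exact: (big_morph _ (@normcM R) (@normc1 R)). Qed.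

Lemma normc_sum (I : Type) (s : seq I) (P : pred I) (F : I -> R[i]) :
  normc (\sum_(i <- s | P i) F i) <= \sum_(i <- s | P i) normc (F i).
Proof.
elim/big_rec2: _ => [|i a b _ h]; first by rewrite normc0.
by apply: le_trans (le_normcD _ _) _; rewrite lerD2l.
Qed.

Lemma normcXz x (m : int) : normc (x ^ m) = normc x ^ m.
Proof.
have hX k : normc (x ^+ k) = normc x ^+ k.
  by elim: k => [|k IH]; rewrite ?normc1 // !exprS normcM IH.
by case: m => k; rewrite ?NegzE ?exprnN -?exprnP ?normcV hX.
Qed.

Lemma ratr_complex (q : rat) : ratr q = ((ratr q : R)%:C)%C :> R[i].
Proof. by rewrite fmorph_rat. Qed.

Lemma Re_le_normc x : `|complex.Re x| <= normc x.
Proof.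
case: x => a b /=; rewrite -sqrtr_sqr ler_sqrt ?addr_ge0 ?sqr_ge0 //.
by rewrite lerDl sqr_ge0.
Qed.

End Modulus.

Lemma big_le_max_sum (R : numDomainType) (I : finType) (F : I -> R) (i : I) :
  (forall i, 0 <= F i) -> F i <= \sum_i F i.
Proof. by move=> h; rewrite (bigD1 i) //= lerDl sumr_ge0. Qed.

Lemma fract_itv (R : realType) (x : R) : 0 <= fract x < 1.
Proof.
rewrite /fract subr_ge0 Num.Theory.floor_le ltrBlDl.
by have := floorD1_gt x; rewrite intrD.
Qed.

Section Units.
Variables (R : realType) (L : fieldExtType rat) (iota : {rmorphism L -> R}).
Variables (d : nat) (e : d.+1.-tuple L).
Hypotheses (he : basis_of {:L} e) (he0 : e`_0 = 1).
Variable sg : 'I_d.+1 -> {rmorphism L -> R[i]}.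
Hypothesis hE : embed_mx e sg \in unitmx.
Variable j0 : 'I_d.+1.
Hypothesis hj0 : forall x, sg j0 x = ((iota x)%:C)%C.

Local Notation lattice := (in_lattice e).
Local Notation order := (in_order e).
Local Notation ounit := (order_unit e).

Definition absval (j : 'I_d.+1) (x : L) : R := normc (sg j x).

Local Notation place := absval.

Lemma place_ge0 j x : 0 <= place j x.
Proof. exact: normc_ge0. Qed.

Lemma place_gt0 j x : x != 0 -> 0 < place j x.
Proof. by move=> x0; apply: normc_gt0; rewrite fmorph_eq0. Qed.

Lemma placeM j x y : place j (x * y) = place j x * place j y.
Proof. by rewrite /place rmorphM normcM. Qed.

Lemma placeV j x : place j x^-1 = (place j x)^-1.
Proof. by rewrite /place fmorphV normcV. Qed.

Lemma place_j0 x : place j0 x = `|iota x|.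
Proof. by rewrite /place hj0 normc_real. Qed.

Lemma place_norm x : `|ratr (field_norm e x)| = \prod_j place j x :> R.
Proof.
rewrite -normc_prod -(field_norm_prod he hE) ratr_complex normc_real //.
Qed.

(** This bound and the next one say that the height of a field element may be measured by its
coordinates or by its conjugates: the two are related by a fixed invertible matrix. *)
Lemma place_le_coord : exists2 C : R, 0 < C & forall x B,
  (forall k, `|ratr (coord e k x)| <= B) -> forall j, place j x <= C * B.
Proof.
exists (1 + \sum_j \sum_(k < d.+1) place j e`_k).
  by rewrite ltr_pwDl // !sumr_ge0 // => i _; rewrite sumr_ge0 // => k _; apply: place_ge0.
move=> x B hB j; have B0 : 0 <= B by apply: le_trans (hB ord0).
rewrite /place (embed_sum he); apply: le_trans (normc_sum _ _ _) _.
apply: (@le_trans _ _ (\sum_(k < d.+1) place j e`_k * B)).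
  apply: ler_sum => k _; rewrite normcM ratr_complex normc_real mulrC.
  by apply: ler_wpM2l; [apply: normc_ge0 | apply: hB].
rewrite -mulr_suml ler_wpM2r //.
have := @big_le_max_sum _ _ (fun j => \sum_(k < d.+1) place j e`_k) j.
by move=> h; apply: le_trans (h _) _; rewrite ?lerDr // => i; apply: sumr_ge0 => k _; apply: place_ge0.
Qed.

Lemma coord_le_place : exists2 C : R, 0 < C & forall x B,
  (forall j, place j x <= B) -> forall k, `|ratr (coord e k x)| <= C * B.
Proof.
pose K := invmx (embed_mx e sg).
exists (1 + \sum_k \sum_j normc (K j k)).
  by rewrite ltr_pwDl // !sumr_ge0 // => i _; rewrite sumr_ge0 // => k _; apply: normc_ge0.
move=> x B hB k; have B0 : 0 <= B by apply: le_trans (hB ord0); apply: place_ge0.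
rewrite -normc_real -ratr_complex (coord_embed he hE); apply: le_trans (normc_sum _ _ _) _.
apply: (@le_trans _ _ (\sum_j normc (K j k) * B)).
  apply: ler_sum => j _; rewrite normcM mulrC.
  by apply: ler_wpM2l; [apply: normc_ge0 | apply: hB].
rewrite -mulr_suml ler_wpM2r //.
have := @big_le_max_sum _ _ (fun k => \sum_(j < d.+1) normc (K j k)) k.
by move=> h; apply: le_trans (h _) _; rewrite ?lerDr // => i; apply: sumr_ge0 => j _; apply: normc_ge0.
Qed.

Definition slope (i : 'I_d) : R := iota e`_(lift ord0 i).

(** Subtracting the integer part of [dotz m slope] inside the lattice turns the points of the circle
into real values of lattice elements. *)
Definition lattice_lift (m : 'rV[int]_d) : L :=
  \sum_i (m 0 i)%:~R *: e`_(lift ord0 i) - (Num.floor (dotz m slope))%:~R *: e`_0.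

Definition int_coords (x : L) : 'rV[int]_d := \row_i Num.floor (coord e (lift ord0 i) x).

Lemma iota_lattice_lift m : iota (lattice_lift m) = fract (dotz m slope).
Proof.
rewrite rmorphB rmorph_sum morph_ratZ ratr_int he0 rmorph1 mulr1; congr (_ - _).
by apply: eq_bigr => i _; rewrite morph_ratZ ratr_int.
Qed.

Lemma coord_scale k (a : rat) x : coord e k (a *: x) = a * coord e k x.
Proof. exact: linearZ. Qed.

Lemma coord_lattice_lift m i :
  coord e (lift ord0 i) (lattice_lift m) = (m 0 i)%:~R.
Proof.
rewrite linearB linear_sum (bigD1 i) //= big1 => [|l li].
  by rewrite !coord_scale (coord_e he (lift ord0 i)) (coord_e he ord0) eqxx mulr1 mulr0 addr0 subr0.
by rewrite coord_scale (coord_e he (lift ord0 l)) (inj_eq lift_inj) (negbTE li) mulr0.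
Qed.

Lemma coord0_lattice_lift m :
  coord e ord0 (lattice_lift m) = - (Num.floor (dotz m slope))%:~R.
Proof.
rewrite linearB linear_sum big1 /= => [|l _].
  by rewrite coord_scale (coord_e he ord0) eqxx mulr1 add0r.
by rewrite coord_scale (coord_e he (lift ord0 l)) mulr0.
Qed.

Lemma in_lattice_lift m : lattice (lattice_lift m).
Proof.
move=> k; case: (unliftP ord0 k) => [i ->|->].
  by rewrite coord_lattice_lift rpred_int.
by rewrite coord0_lattice_lift rpredN rpred_int.
Qed.

Lemma int_coords_lift m : int_coords (lattice_lift m) = m.
Proof. by apply/rowP => i; rewrite mxE coord_lattice_lift intrKfloor. Qed.

Lemma coord_int_coords x i : lattice x -> (int_coords x 0 i)%:~R = coord e (lift ord0 i) x.
Proof. by move=> hx; rewrite mxE; have /intrP[m ->] := hx (lift ord0 i); rewrite intrKfloor. Qed.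

Lemma int_coordsD x y : lattice x -> lattice y ->
  int_coords (x + y) = int_coords x + int_coords y.
Proof.
move=> hx hy; apply/rowP => i; rewrite !mxE linearD /=.
have /intrP[m ->] := hx (lift ord0 i); have /intrP[l ->] := hy (lift ord0 i).
by rewrite -intrD !intrKfloor.
Qed.

Lemma int_coordsB x y : lattice x -> lattice y ->
  int_coords (x - y) = int_coords x - int_coords y.
Proof.
move=> hx hy; apply/rowP => i; rewrite !mxE linearB /=.
have /intrP[m ->] := hx (lift ord0 i); have /intrP[l ->] := hy (lift ord0 i).
by rewrite -intrB !intrKfloor.
Qed.

(** An element of the lattice is determined by its integer coordinates up to an integer, which its
real value fixes. *)
Lemma lattice_lift_coords x : lattice x -> 0 <= iota x < 1 -> lattice_lift (int_coords x) = x.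
Proof.
clear hE hj0; move=> hx x01; set y := lattice_lift _.
have hy : lattice y by apply: in_lattice_lift.
have hc i : coord e (lift ord0 i) (y - x) = 0.
  by rewrite linearB /= coord_lattice_lift coord_int_coords // subrr.
have /intrP[m hm] := in_latticeB hy hx ord0.
have yx : y - x = m%:~R *: 1.
  rewrite (coordE he (y - x)) (bigD1 ord0) //= hm he0 big1 ?addr0 // => k k0.
  by case: (unliftP ord0 k) k0 => [i ->|->] //; rewrite hc scale0r.
have : iota y - iota x = m%:~R by rewrite -rmorphB yx morph_ratZ ratr_int rmorph1 mulr1.
have := fract_itv (dotz (int_coords x) slope); rewrite -iota_lattice_lift -/y => y01 ixy.
have m0 : m = 0.
  have : -1 < m%:~R :> R by rewrite -ixy; lra.
  have : m%:~R < 1 :> R by rewrite -ixy; lra.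
  rewrite -[1]/(1%:~R) -[-1 in X in _ -> X -> _]/((-1)%:~R) !ltr_int; lia.
by apply/eqP; rewrite -subr_eq0 yx m0 scale0r.
Qed.

End Units.

(** * Units from the box principle *)

Lemma prod_le_const (R : realDomainType) (I : finType) (P : pred I) (F : I -> R) (B : R) (m : nat) :
  (forall i, P i -> 0 <= F i <= B) -> #|P| = m -> \prod_(i | P i) F i <= B ^+ m.
Proof. by move=> hF <-; rewrite -prodr_const; apply: ler_prod. Qed.

Section UnitsExist.
Variables (R : realType) (L : fieldExtType rat) (iota : {rmorphism L -> R}).
Variables (d : nat) (e : d.+1.-tuple L).
Hypotheses (hd : (0 < d)%N) (he : basis_of {:L} e) (he0 : e`_0 = 1).
Variable sg : 'I_d.+1 -> {rmorphism L -> R[i]}.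
Hypothesis hE : embed_mx e sg \in unitmx.
Variable j0 : 'I_d.+1.
Hypothesis hj0 : forall x, sg j0 x = ((iota x)%:C)%C.

Local Notation lattice := (in_lattice e).
Local Notation order := (in_order e).
Local Notation ounit := (order_unit e).
Local Notation place := (absval sg).
Local Notation slope := (slope iota e).

(** The box principle: among the points of the circle indexed by the cube [{0, ..., Q} ^ d], two share
one of [Q ^ d] equal arcs, and their difference has the required properties. *)
Lemma dirichlet_lattice : exists2 C : R, 0 < C & forall Q : nat, (0 < Q)%N ->
  exists x, [/\ x != 0, lattice x, `|iota x| * Q%:R ^+ d <= 1 &
    forall k, `|ratr (coord e k x)| <= C * Q%:R].
Proof.
exists (2 + \sum_i `|slope i|); first by rewrite ltr_pwDl // sumr_ge0.
move=> Q Q0.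
pose M (m : {ffun 'I_d -> 'I_Q.+1}) : 'rV[int]_d := \row_i (m i : nat)%:Z.
pose S m := dotz (M m) slope.
pose f m : 'I_(Q ^ d).-1.+1 := inord `|Num.floor (Q%:R ^+ d * fract (S m))|%N.
have Qd0 : (0 < Q ^ d)%N by rewrite expn_gt0 Q0.
have fl m : 0 <= Num.floor (Q%:R ^+ d * fract (S m)) < (Q ^ d)%N%:Z.
  have /andP[f0 f1] := fract_itv (S m); have QR0 : 0 < Q%:R ^+ d :> R by rewrite exprn_gt0 ?ltr0n.
  rewrite floor_ge0 mulr_ge0 ?(ltW QR0) //= floor_lt_int -pmulrn natrX.
  by rewrite gtr_pMr.
have /injectivePn[m [m' mm' fmm']] : ~~ injectiveb f.
  apply/negP => /injectiveP /leq_card; rewrite card_ffun !card_ord prednK // leqNgt.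
  by rewrite ltn_exp2r // ltnS leqnn.
have ffl : Num.floor (Q%:R ^+ d * fract (S m)) = Num.floor (Q%:R ^+ d * fract (S m')).
  have := congr1 (@nat_of_ord _) fmm'.
  have /andP[a0 a1] := fl m; have /andP[b0 b1] := fl m'.
  by rewrite !inordK ?prednK //; move: a0 a1 b0 b1; lia.
exists (lattice_lift iota e (M m) - lattice_lift iota e (M m')); split.
- rewrite subr_eq0; apply: contra mm' => /eqP/(congr1 (int_coords e)).
  rewrite !int_coords_lift // => /rowP h; apply/eqP/ffunP => i; apply/val_inj.
  by have := h i; rewrite !mxE => -[].
- by apply: in_latticeB; apply: in_lattice_lift.
- rewrite rmorphB !iota_lattice_lift //.
  have QR0 : 0 < Q%:R ^+ d :> R by rewrite exprn_gt0 ?ltr0n.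
  rewrite -[X in _ * X](gtr0_norm QR0) -normrM mulrBl ler_norml.
  have := floor_itv (Q%:R ^+ d * fract (S m)).
  have := floor_itv (Q%:R ^+ d * fract (S m')).
  rewrite ffl intrD; set a := _%:~R; rewrite ![Q%:R ^+ d * _]mulrC; lra.
- have hi i : `|(m i : nat)%:R - (m' i : nat)%:R| <= Q%:R :> R.
    have := ltn_ord (m i); have := ltn_ord (m' i); rewrite !ltnS -!(ler_nat R).
    have := ler0n R (m i); have := ler0n R (m' i); rewrite ler_norml; lra.
  have Q1 : 1 <= Q%:R :> R by rewrite ler1n.
  have SS0 : 0 <= \sum_i `|slope i| by apply: sumr_ge0.
  move=> k; rewrite linearB /=; case: (unliftP ord0 k) => [i ->|->].
    rewrite !coord_lattice_lift // !mxE rmorphB /= !ratr_int -!pmulrn.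
    by apply: le_trans (hi i) _; nra.
  rewrite !coord0_lattice_lift // rmorphB !rmorphN /= !ratr_int -/(S m) -/(S m').
  have hS : `|S m - S m'| <= Q%:R * \sum_i `|slope i|.
    rewrite /S /dotz -sumrB mulr_sumr; apply: le_trans (ler_norm_sum _ _ _) _.
    apply: ler_sum => i _; rewrite !mxE -mulrBl normrM ler_wpM2r //.
    by rewrite -!pmulrn.
  have := fract_itv (S m); have := fract_itv (S m'); rewrite /fract.
  move: hS; rewrite !ler_norml; set a := _%:~R; set b := _%:~R; nra.
Qed.

Lemma in_orderZ (z : rat) x : z \is a Num.int -> order x -> order (z *: x).
Proof.
by move=> hz hx y hy k; rewrite -scalerAl coord_scale rpredM //; apply: hx.
Qed.

Lemma placeMn j x n : place j (x *+ n) = n%:R * place j x.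
Proof.
rewrite -[x *+ n]mulr_natl placeM; congr (_ * _).
rewrite /absval rmorph_nat -[n%:R](rmorph_nat (real_complex R)).
by rewrite normc_real normr_nat.
Qed.

(** A Dirichlet approximation has real value [O (Q ^- d)] and conjugates [O (Q)], hence bounded norm;
as the norm is a nonzero integer, no other conjugate can be much smaller than [Q]. *)
Lemma order_elements : exists (X : nat -> L) (D : nat) (B : R), 0 < B /\ forall Q, (0 < Q)%N ->
  [/\ X Q *+ D != 0, lattice (X Q),
      forall y, lattice y -> order (y *+ D),
      `|ratr (field_norm e (X Q *+ D))| <= B &
      forall j, place j (X Q *+ D) <= B * Q%:R /\
        (j != j0 -> Q%:R <= B * place j (X Q *+ D))].
Proof.
have [D D0 hD] := lattice_in_order he.
have [C0 C00 hdir] := dirichlet_lattice.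
have [C1 C10 hpl] := place_le_coord he sg.
have /choice[X hX] : forall Q, exists x, (0 < Q)%N -> [/\ x != 0, lattice x,
    `|iota x| * Q%:R ^+ d <= 1 & forall k, `|ratr (coord e k x)| <= C0 * Q%:R].
  case=> [|Q]; first by exists 0.
  by have [x hx] := hdir Q.+1 isT; exists x.
have DR : 0 < D%:R :> R by rewrite ltr0n.
pose B1 := D%:R * (C1 * C0); have B10 : 0 < B1 by rewrite !mulr_gt0.
pose B2 := D%:R * B1 ^+ d; have B20 : 0 < B2 by rewrite mulr_gt0 ?exprn_gt0.
pose B3 := D%:R * B1 ^+ d.-1; have B30 : 0 < B3 by rewrite mulr_gt0 ?exprn_gt0.
exists X, D, (B1 + B2 + B3); split; first by rewrite !addr_gt0.
move=> Q Q0; have [x0 lx ix cx] := hX Q Q0.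
have QR : 0 < Q%:R :> R by rewrite ltr0n.
set a := X Q *+ D.
have a0 : a != 0.
  by rewrite /a -scaler_nat scaler_eq0 negb_or x0 andbT pnatr_eq0 -lt0n.
have pB j : place j a <= B1 * Q%:R.
  rewrite placeMn /B1 -!mulrA ler_pM2l // mulrA -[_ * Q%:R]mulrA.
  exact: hpl.
have p0 : place j0 a * Q%:R ^+ d <= D%:R.
  by rewrite placeMn (place_j0 hj0) -mulrA ler_piMr // ltW.
have pg j : 0 < place j a by apply: place_gt0.
have nE : `|ratr (field_norm e a)| = place j0 a * \prod_(j | j != j0) place j a :> R.
  by rewrite (place_norm he hE) (bigD1 j0).
have n1 : 1 <= `|ratr (field_norm e a)| :> R.
  have /intrP[m hm] := field_norm_int he (hD _ lx).
  have := field_norm_neq0 he a0; rewrite -/a in hm; rewrite hm ratr_int intr_eq0 => m0.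
  by rewrite -intr_norm ler1z -gtz0_ge1 normr_gt0.
split=> //.
- rewrite nE; apply: (@le_trans _ _ B2); last by rewrite -addrA addrCA lerDl addr_ge0 ?ltW.
  apply: (@le_trans _ _ (place j0 a * (B1 * Q%:R) ^+ d)).
    rewrite ler_pM2l //; apply: prod_le_const; last by rewrite cardC1 card_ord.
    by move=> j _; rewrite ltW //=; apply: pB.
  by rewrite exprMn mulrCA mulrC ler_pM2r ?exprn_gt0 // .
- move=> j; split.
    by apply: le_trans (pB j) _; rewrite ler_pM2r // -addrA lerDl addr_ge0 ?ltW.
  move=> jj0; apply: (@le_trans _ _ (B3 * place j a)); last first.
    by rewrite ler_pM2r // lerDr addr_ge0 ?ltW.
  have hprod : \prod_(i | i != j0) place i a <= place j a * (B1 * Q%:R) ^+ d.-1.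
    rewrite (bigD1 j) //= ler_pM2l //.
    apply: prod_le_const => [i _|]; first by rewrite ltW //=; apply: pB.
    have := cardD1 j (predC1 j0); rewrite cardC1 card_ord inE jj0 add1n => h.
    by apply: succn_inj; rewrite prednK //; apply/esym; apply: etrans h _; congr _.+1; apply: eq_card => i; rewrite !inE andbC.
  have : 1 * Q%:R ^+ d <= D%:R * (place j a * (B1 * Q%:R) ^+ d.-1).
    apply: (@le_trans _ _ (`|ratr (field_norm e a)| * Q%:R ^+ d)).
      by rewrite ler_pM2r ?exprn_gt0.
    rewrite nE mulrAC; apply: ler_pM => //.
      by rewrite mulr_ge0 ?exprn_ge0 ?ltW.
    by apply: prodr_ge0 => i _; rewrite ltW.
  have -> : Q%:R ^+ d = Q%:R * Q%:R ^+ d.-1 :> R by rewrite -exprS prednK.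
  rewrite mul1r exprMn.
  have -> : D%:R * (place j a * (B1 ^+ d.-1 * Q%:R ^+ d.-1)) = B3 * place j a * Q%:R ^+ d.-1.
    by rewrite /B3; ring.
  by rewrite ler_pM2r ?exprn_gt0.
Qed.

(** The lattice modulo a fixed integer is finite, and two elements of the order in the same
class are associate as soon as their norms divide that integer. *)
Lemma order_units : exists2 C : R, 0 < C & forall Q, (0 < Q)%N ->
  exists2 u, ounit u & forall j, j != j0 ->
    Q%:R <= C * place j u /\ place j u <= C * Q%:R.
Proof.
have [X [D [B [B0 hX]]]] := order_elements.
(* N! is a multiple of all the norms that occur. *)
pose N := Num.bound B; pose F := N`!; have F0 : (0 < F)%N := fact_gt0 N.
have FQ0 : F%:R != 0 :> rat by rewrite pnatr_eq0 -lt0n.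
pose cls Q : {ffun 'I_d.+1 -> 'I_F.-1.+1} :=
  [ffun k => inord `|(Num.floor (coord e k (X Q)) %% F)%Z|%N].
have assoc Q q : (0 < Q)%N -> (0 < q)%N -> cls Q = cls q ->
    order ((X Q *+ D) / (X q *+ D)).
  move=> Q0 q0 cQq.
  have [_ lQ hD _ _] := hX Q Q0; have [a0 lq _ nq pq] := hX q q0.
  set a := X q *+ D in a0 *.
  pose y := (F%:R^-1 : rat) *: (X Q - X q).
  have ly : lattice y.
    move=> k; rewrite coord_scale linearB /=.
    have := congr1 (fun c : {ffun _ -> _} => nat_of_ord (c k)) cQq; rewrite !ffunE.
    have /intrP[m ->] := lQ k; have /intrP[l ->] := lq k; rewrite !intrKfloor.
    have Fz : (F%:Z != 0) by rewrite eqz_nat -lt0n.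
    have mlt (z : int) : (`|(z %% F)%Z| < F)%N.
      by rewrite -ltz_nat gez0_abs ?modz_ge0 // ltz_pmod // ltz_nat.
    rewrite !inordK ?prednK // => h.
    have /eqP : (m %% F)%Z = (l %% F)%Z.
      by rewrite -[LHS]gez0_abs ?modz_ge0 // h gez0_abs ?modz_ge0.
    rewrite eqz_mod_dvd => /dvdzP[z hz].
    by rewrite -intrB hz intrM mulrC pmulrn mulfK // rpred_int.
  have oF : order (F%:R *: a^-1).
    have nz : field_norm e a != 0 by apply: field_norm_neq0.
    have -> : F%:R *: a^-1 = (F%:R / field_norm e a) *: (field_norm e a *: a^-1).
      by rewrite scalerA divfK.
    apply: in_orderZ; last by apply: in_order_norm_div => //; apply: hD.
    have /intrP[m hm] := field_norm_int he (hD _ lq).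
    rewrite -/a in hm; rewrite hm in nz *; rewrite intr_eq0 in nz.
    have mN : (`|m| <= N)%N.
      rewrite -(ler_nat R) natr_absz intr_norm.
      apply: le_trans (ltW (archi_boundP (ltW B0))).
      by move: nq; rewrite -/a hm ratr_int.
    have /dvdnP[c hc] : (`|m| %| F)%N by apply: dvdn_fact; rewrite absz_gt0 nz.
    rewrite hc natrM natr_absz normrEsg intrM -!mulrA divff ?intr_eq0 // mulr1.
    by rewrite rpredM ?rpred_nat ?rpred_int.
  have -> : X Q *+ D / a = 1 + (F%:R *: a^-1) * (y *+ D).
    have -> : X Q *+ D = a + F%:R *: (y *+ D).
      by rewrite -scalerMnr scalerA divff // scale1r /a -mulrnDl addrCA subrr addr0.
    by rewrite mulrDl divff // -scalerAl [in RHS]mulrC -scalerAr.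
  by apply: in_orderD; [apply: in_order1 | apply: in_orderM => //; apply: hD].
(* One representative for each of the finitely many classes; its size is bounded by the sum q0
   of their indices. *)
have /choice[rep hrep] : forall c, exists q,
    (exists2 Q, (0 < Q)%N & cls Q = c) -> (0 < q)%N /\ cls q = c.
  move=> c; have [[Q Q0 hQ]|no] := pselect (exists2 Q, (0 < Q)%N & cls Q = c).
    by exists Q.
  by exists 0%N.
pose q0 := (\sum_c rep c)%N.
exists (B * B * (1 + q0%:R)); first by rewrite !mulr_gt0 // ltr_pwDl.
move=> Q Q0; set q := rep (cls Q).
have [q_gt0 cq] : (0 < q)%N /\ cls q = cls Q by apply: hrep; exists Q.
have q1 : q%:R <= 1 + q0%:R :> R.
  by rewrite addrC natr1 ler_nat leqW // /q0 (bigD1 (cls Q)) //= leq_addr.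
exists (X Q *+ D / (X q *+ D)).
  have [aQ _ _ _ _] := hX Q Q0; have [aq _ _ _ _] := hX q q_gt0.
  split; first by rewrite mulf_neq0 ?invr_eq0.
    exact: assoc.
  by rewrite invf_div; apply: assoc.
move=> j jj0; rewrite placeM placeV.
have [aQ _ _ _ /(_ j)[pQ /(_ jj0) pQ']] := hX Q Q0.
have [aq _ _ _ /(_ j)[pq /(_ jj0) pq']] := hX q q_gt0.
have pg : 0 < place j (X q *+ D) by apply: place_gt0.
have pG : 0 < place j (X Q *+ D) by apply: place_gt0.
have qR : 1 <= q%:R :> R by rewrite ler1n.
have QR : 0 < Q%:R :> R by rewrite ltr0n.
split; last first.
  rewrite ler_pdivrMr //; apply: le_trans pQ _.
  have : 1 <= B * place j (X q *+ D) by apply: le_trans pq'.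
  have : 0 <= q0%:R :> R by [].
  set z := place _ _ in pg *; set w := q0%:R => w0 Bz.
  have -> : B * B * (1 + w) * Q%:R * z = (B * Q%:R) * (B * z * (1 + w)) by ring.
  rewrite ler_peMr ?mulr_ge0 ?(ltW B0) ?(ltW QR) //; nra.
rewrite mulrA ler_pdivlMr //; apply: (@le_trans _ _ (Q%:R * (B * (1 + q0%:R)))).
  by rewrite ler_pM2l //; apply: le_trans pq _; rewrite ler_pM2l.
have -> : B * B * (1 + q0%:R) * place j (X Q *+ D) =
  (B * place j (X Q *+ D)) * (B * (1 + q0%:R)) by ring.
by rewrite ler_wpM2r // mulr_ge0 ?(ltW B0) // addr_ge0.
Qed.

End UnitsExist.

(** * Units along a ray *)

Section UnitRay.
Variables (R : realType) (L : fieldExtType rat) (iota : {rmorphism L -> R}).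
Variables (d : nat) (e : d.+1.-tuple L).
Hypotheses (hd : (0 < d)%N) (he : basis_of {:L} e) (he0 : e`_0 = 1).
Variable sg : 'I_d.+1 -> {rmorphism L -> R[i]}.
Hypothesis hE : embed_mx e sg \in unitmx.
Variable j0 : 'I_d.+1.
Hypothesis hj0 : forall x, sg j0 x = ((iota x)%:C)%C.

Local Notation ounit := (order_unit e).
Local Notation place := (absval sg).

Lemma order_unit_group u : ounit u -> unit_group u.
Proof.
move=> [u0 ou ou']; split; first exact: (in_order_integral he).
by exists u^-1; [exact: (in_order_integral he) | rewrite divff].
Qed.

Lemma ln_prod (I : Type) (s : seq I) (P : pred I) (F : I -> R) :
  (forall i, 0 < F i) -> ln (\prod_(i <- s | P i) F i) = \sum_(i <- s | P i) ln (F i).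
Proof.
move=> hF; suff [] : 0 < \prod_(i <- s | P i) F i /\
  ln (\prod_(i <- s | P i) F i) = \sum_(i <- s | P i) ln (F i) by [].
elim/big_rec2: _ => [|i a b _ [b0 hb]]; first by rewrite ln1.
by split; [rewrite mulr_gt0 | rewrite lnM ?posrE // hb].
Qed.

Lemma ln_exprz (x : R) (m : int) : 0 < x -> ln (x ^ m) = m%:~R * ln x.
Proof.
move=> x0; have hX k : ln (x ^+ k) = k%:R * ln x by rewrite lnXn // mulr_natl.
case: m => k; first by rewrite -exprnP hX.
by rewrite NegzE -exprnN lnV ?posrE ?exprn_gt0 // hX intrN mulNr.
Qed.

Lemma placeXz j x (m : int) : place j (x ^ m) = place j x ^ m.
Proof. by rewrite /absval fmorphXz normcXz. Qed.

Lemma place_prod j (I : Type) (s : seq I) (P : pred I) (F : I -> L) :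
  place j (\prod_(i <- s | P i) F i) = \prod_(i <- s | P i) place j (F i).
Proof. by rewrite /absval rmorph_prod normc_prod. Qed.

Definition log_vec (x : L) : 'rV[R]_d.+1 :=
  \row_j if j == j0 then 0 else ln (place j x).

Definition pos_unit (x : L) := ounit x /\ 0 < iota x.

(** A maximal family of units with linearly independent logarithmic vectors spans all of
them. Its span is closed and contains vectors at bounded distance from arbitrarily large
multiples of the all-ones vector, hence contains that vector itself. *)
Lemma unit_ray : exists (k : nat) (f : 'I_k -> L) (beta : 'rV[R]_k),
  [/\ forall i, pos_unit (f i), mult_independent f &
      forall j, j != j0 -> \sum_i beta 0 i * ln (place j (f i)) = 1].
Proof.
have [C C0 hunits] := order_units hd he he0 hE hj0.
pose X k (f : 'I_k -> L) : 'M[R]_(k, d.+1) := \matrix_i log_vec (f i).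
pose P k := `[< exists f : 'I_k -> L, (forall i, pos_unit (f i)) /\ row_free (X k f) >].
have P0 : exists k, P k.
  exists 0%N; apply/asboolP; exists (fun=> 1); split; first by case.
  by rewrite /row_free flatmx0 mxrank0.
have Pb k : P k -> (k <= d.+1)%N.
  by move/asboolP => [f [_ /eqP <-]]; apply: rank_leq_col.
have [k /asboolP[f [hf Xfree]] kmax] := ex_maxnP P0 Pb.
have in_span u : pos_unit u -> (log_vec u <= X k f)%MS.
  move=> hu; apply/negP => /negP nsub.
  suff : P (k + 1)%N by move/kmax; rewrite addn1 ltnn.
  apply/asboolP; exists (fun i : 'I_(k + 1) => match fintype.split i with inl i => f i | inr _ => u end).
  split=> [i|]; first by case: (fintype.split i).
  have -> : X (k + 1)%N (fun i : 'I_(k + 1) => match fintype.split i with inl i => f i | inr _ => u end) =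
      col_mx (X k f) (log_vec u).
    apply/row_matrixP => i; rewrite rowK; case: splitP => j hj.
      by rewrite (_ : i = lshift 1 j) ?rowKu ?rowK //; apply/val_inj.
    rewrite (_ : i = rshift k j) ?rowKd; last exact/val_inj.
    by rewrite row_id.
  rewrite /row_free eqn_leq rank_leq_row -addsmxE addn1 -{1}(eqP Xfree) /=.
  apply: rank_ltmx; rewrite ltmxE addsmxSl /=; apply: contra nsub.
  by apply: submx_trans; apply: addsmxSr.
pose ray : 'rV[R]_d.+1 := \row_j (j != j0)%:R.
have ray_in : (ray <= X k f)%MS.
  rewrite submxE; apply/eqP/rowP => l; apply: contrapT => /eqP; rewrite [X in _ != X]mxE => hl.
  (* z is a linear form that vanishes on all logarithmic vectors but not on the ray; s is its value
     on the ray. *)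
  pose z j := cokermx (X k f) j l.
  pose s := \sum_j ray 0 j * z j; pose S := \sum_j `|z j|.
  have s0 : s != 0 by move: hl; rewrite mxE.
  have S0 : 0 <= S by apply: sumr_ge0.
  have hs Q : (0 < Q)%N -> `|s| * ln Q%:R <= `|ln C| * S.
    move=> Q0; have [u uu hu] := hunits Q Q0.
    have QR : 0 < Q%:R :> R by rewrite ltr0n.
    have u0 : u != 0 by case: uu.
    (* Squaring makes the unit positive at the real place. *)
    have pu : pos_unit (u * u).
      split; first exact: order_unitM.
      by rewrite rmorphM -expr2 exprn_even_gt0 ?fmorph_eq0 ?u0.
    have lz : \sum_j (if j == j0 then 0 else ln (place j u)) * z j = 0.
      have /submxP[D hD] := in_span _ pu.
      have : (log_vec (u * u) *m cokermx (X k f)) 0 l = 0.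
        by rewrite hD -mulmxA mulmx_coker mulmx0 mxE.
      rewrite mxE => h2; set T := LHS; suff /eqP : T *+ 2 = 0 by rewrite mulrn_eq0 => /eqP.
      rewrite -[RHS]h2 /T -sumrMnl; apply: eq_bigr => j _; rewrite mxE.
      case: eqP => _; first by rewrite !mul0r mul0rn.
      by rewrite placeM lnM ?posrE ?place_gt0 // mulrDl mulr2n.
    have -> : `|s| * ln Q%:R = `|\sum_j (ln Q%:R * ray 0 j - if j == j0 then 0 else ln (place j u)) * z j|.
      rewrite (eq_bigr (fun j => ln Q%:R * (ray 0 j * z j) -
         (if j == j0 then 0 else ln (place j u)) * z j)); last by move=> j _; rewrite mulrBl mulrA.
      by rewrite sumrB lz subr0 -mulr_sumr normrM mulrC [X in _ = X * _]ger0_norm // ln_ge0 // ler1n.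
    rewrite mulr_sumr; apply: le_trans (ler_norm_sum _ _ _) _.
    apply: ler_sum => j _; rewrite normrM ler_wpM2r // mxE.
    case: eqP => [_|/eqP jj0]; first by rewrite /= mulr0 subr0 normr0.
    have [h1 h2] := hu j jj0; have pg : 0 < place j u by apply: place_gt0.
    have : ln Q%:R <= ln (C * place j u) by rewrite ler_ln ?posrE // mulr_gt0.
    have : ln (place j u) <= ln (C * Q%:R) by rewrite ler_ln ?posrE // mulr_gt0.
    rewrite !lnM ?posrE //; have := ler_norm (ln C); rewrite mulr1 ler_norml; lra.
  have sp : 0 < `|s| by rewrite normr_gt0.
  pose Q := (Num.bound (expR ((`|ln C| * S + 1) / `|s|))).
  have hQ : expR ((`|ln C| * S + 1) / `|s|) < Q%:R by apply: archi_boundP; apply: expR_ge0.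
  have Q0 : (0 < Q)%N by rewrite -(ltr_nat R); apply: le_lt_trans hQ; apply: expR_ge0.
  have : (`|ln C| * S + 1) / `|s| < ln Q%:R.
    by rewrite -ltr_expR lnK ?posrE ?ltr0n.
  rewrite ltr_pdivrMr // mulrC => h1.
  by have := hs Q Q0; move: h1; lra.
have /submxP[beta hbeta] := ray_in.
exists k, f, beta; split=> //.
  move=> a ha i.
  have : (\row_i (a i)%:~R) *m X k f = 0.
    apply/rowP => j; rewrite !mxE; case: (eqVneq j j0) => [->|jj0].
      by rewrite big1 // => l _; rewrite !mxE eqxx mulr0.
    have f0 l : 0 < place j (f l) by apply: place_gt0; have [[]] := hf l.
    transitivity (ln (place j (\prod_(i < k) f i ^ a i))); last first.
      by rewrite ha /absval rmorph1 normc1 ln1.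
    rewrite place_prod ln_prod => [|l]; last by rewrite placeXz exprz_gt0.
    by apply: eq_bigr => l _; rewrite !mxE (negbTE jj0) placeXz ln_exprz.
  move/eqP; rewrite mulmx_free_eq0 // => /eqP/rowP/(_ i); rewrite !mxE.
  by move/eqP; rewrite intr_eq0 => /eqP.
move=> j jj0; have /rowP/(_ j) := hbeta; rewrite !mxE jj0 => h; rewrite -[RHS]/(true%:R) h.
by apply: eq_bigr => l _; rewrite !mxE (negbTE jj0).
Qed.

(** Independent units number at most [r]; trivial units with exponent zero fill up the family. *)
Lemma unit_ray_rank (r : nat) :
  (forall (n : nat) (f : 'I_n -> L),
     (forall i, unit_group (f i)) -> mult_independent f -> (n <= r)%N) ->
  exists (f : 'I_r -> L) (beta : 'rV[R]_r),
    (forall i, pos_unit (f i)) /\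
    forall j, j != j0 -> \sum_i beta 0 i * ln (place j (f i)) = 1.
Proof.
move=> hr; have [k [f [beta [hf indf hb]]]] := unit_ray.
have kr : (k <= r)%N.
  by apply: (hr k f) => // i; apply: order_unit_group; have [] := hf i.
exists (fun i => oapp f 1 (insub (i : nat))), (\row_i oapp (beta 0) 0 (insub (i : nat))).
split=> [i|j jj0].
  by case: insubP => //= _; split; [apply: order_unit1 | rewrite rmorph1].
rewrite (bigID (fun i : 'I_r => i < k)%N) /= [X in _ + X]big1 ?addr0 => [|i ik]; last first.
  by rewrite mxE insubF ?mul0r //; apply: negbTE.
rewrite -[RHS](hb j jj0) (big_ord_narrow kr); apply: eq_bigr => i _.
by rewrite mxE /= insubT //= => lt; congr (beta 0 _ * ln (place j (f _))); apply/val_inj.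
Qed.

End UnitRay.

(** * Polar coordinates *)

Section ComplexExp.
Variable R : realType.

Definition cexp (a b : R) : R[i] := Complex (expR a * cos b) (expR a * sin b).

Lemma cexpD a b a' b' : cexp (a + a') (b + b') = cexp a b * cexp a' b'.
Proof.
rewrite /cexp expRD cosD sinD; apply/eqP; rewrite eq_complex /=.
by apply/andP; split; apply/eqP; ring.
Qed.

Lemma cexp0 : cexp 0 0 = 1.
Proof. by rewrite /cexp expR0 cos0 sin0 mulr1 mulr0. Qed.

Lemma cexp_neq0 a b : cexp a b != 0.
Proof.
apply/eqP => h; have := cexpD a b (- a) (- b); rewrite h mul0r !subrr cexp0 => /eqP.
by rewrite oner_eq0.
Qed.

Lemma cexpXz a b (m : int) : cexp a b ^ m = cexp (m%:~R * a) (m%:~R * b).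
Proof.
have hX k : cexp a b ^+ k = cexp (k%:R * a) (k%:R * b).
  by elim: k => [|k IH]; rewrite ?mul0r ?cexp0 // exprS IH -cexpD -natr1 !mulrDl !mul1r ![a + _]addrC ![b + _]addrC.
case: m => k; first by rewrite -exprnP hX.
rewrite NegzE -exprnN hX; apply: (mulfI (cexp_neq0 (k.+1%:R * a) (k.+1%:R * b))).
by rewrite mulfV ?cexp_neq0 // -cexpD !intrN !mulNr !subrr cexp0.
Qed.

Lemma cexp_prod (I : Type) (s : seq I) (P : pred I) (f g : I -> R) :
  \prod_(i <- s | P i) cexp (f i) (g i) =
  cexp (\sum_(i <- s | P i) f i) (\sum_(i <- s | P i) g i).
Proof.
by elim/big_rec3: _ => [|i a b c _ ->]; rewrite ?cexp0 // cexpD.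
Qed.

Lemma cexp_real a : ((expR a)%:C)%C = cexp a 0.
Proof. by rewrite /cexp cos0 sin0 mulr1 mulr0. Qed.

(** The angle is measured in turns. *)
Lemma polar_form (z : R[i]) : z != 0 -> exists b, z = cexp (ln (normc z)) (2 * pi * b).
Proof.
move=> z0; have n0 : 0 < normc z by apply: normc_gt0.
have pi0 : 2 * pi != 0 :> R by rewrite mulf_neq0 // gt_eqF // pi_gt0.
suff [b hb] : exists b, z = cexp (ln (normc z)) b.
  by exists (b / (2 * pi)); rewrite mulrC divfK.
case: z n0 z0 => x y n0 _; set n := normc _ in n0 *.
have nE : n ^+ 2 = x ^+ 2 + y ^+ 2 by rewrite /n /= sqr_sqrtr // addr_ge0 // sqr_ge0.
have xn : -1 <= x / n <= 1.
  rewrite ler_pdivlMr // ler_pdivrMr // mulN1r mul1r -ler_norml -(ger0_norm (ltW n0)).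
  by rewrite -ler_sqr ?nnegrE // !real_normK ?num_real // nE lerDl sqr_ge0.
have [/andP[a0 api] ca] := acos_def xn.
have sE : n * sin (acos (x / n)) = `|y|.
  apply: (pexpIrn (n := 2)); rewrite ?nnegrE ?mulr_ge0 ?(ltW n0) ?sin_ge0_pi ?a0 //.
  rewrite exprMn real_normK ?num_real //.
  have := cos2Dsin2 (acos (x / n)); rewrite ca => /(congr1 ( *%R (n ^+ 2))).
  have n2 : n ^+ 2 * (x / n) ^+ 2 = x ^+ 2 by rewrite -exprMn mulrC divfK ?gt_eqF.
  by rewrite mulrDr n2 mulr1 nE => /addrI.
have [y0|y0] := leP 0 y.
  exists (acos (x / n)); rewrite /cexp lnK ?posrE // ca sE ger0_norm //.
  by rewrite mulrC divfK ?gt_eqF.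
exists (- acos (x / n)); rewrite /cexp lnK ?posrE // cosN sinN ca mulrN sE ltr0_norm // opprK.
by rewrite mulrC divfK ?gt_eqF.
Qed.

Lemma cexp_periodic a b (m : int) : cexp a (b + 2 * pi * m%:~R) = cexp a b.
Proof.
rewrite -{1}[a]addr0 cexpD.
suff -> : cexp 0 (2 * pi * m%:~R) = 1 by rewrite mulr1.
have -> : cexp 0 (2 * pi * m%:~R) = cexp 0 (2 * pi) ^ m by rewrite cexpXz mulr0 [m%:~R * _]mulrC.
suff -> : cexp 0 (2 * pi) = 1 by rewrite exp1rz.
by rewrite /cexp expR0 !mul1r mulr_natl cos2pi sin2pi.
Qed.

Lemma mvt_lipschitz (f f' : R -> R) :
  (forall x : R, is_derive x (1 : R) f (f' x)) -> (forall x, `|f' x| <= 1) ->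
  forall x y, `|f x - f y| <= `|x - y|.
Proof.
move=> df bf; have le x y : x <= y -> `|f y - f x| <= `|y - x|.
  rewrite le_eqVlt => /orP[/eqP->|xy]; first by rewrite !subrr.
  have cf : {within `[x, y], continuous f}.
    apply: continuous_subspaceT => z; apply: differentiable_continuous.
    by apply/derivable1_diffP; have [] := df z.
  have [c _ ->] := MVT xy (fun z _ => df z) cf.
  by rewrite normrM ler_piMl.
by move=> x y; have [/le|/ltW/le] := leP x y; [rewrite distrC [X in _ <= X]distrC | ].
Qed.

Lemma cos_lipschitz (x y : R) : `|cos x - cos y| <= `|x - y|.
Proof.
by apply: (@mvt_lipschitz cos (fun x => - sin x)) => z; rewrite ?normrN ?sin_max.
Qed.

Lemma sin_lipschitz (x y : R) : `|sin x - sin y| <= `|x - y|.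
Proof. by apply: (@mvt_lipschitz sin cos) => z; rewrite ?cos_max. Qed.

Lemma expR_lipschitz (M x y : R) : x <= M -> y <= M -> `|expR x - expR y| <= expR M * `|x - y|.
Proof.
have le a b : a <= b -> b <= M -> expR b - expR a <= expR M * (b - a).
  move=> ab bM; apply: (@le_trans _ _ (expR b * (b - a))); last first.
    by rewrite ler_wpM2r ?subr_ge0 // ler_expR.
  have := expR_ge1Dx (a - b); rewrite -(ler_pM2l (expR_gt0 b)) -expRD [b + _]addrC subrK; lra.
move=> xM yM; have [xy|/ltW yx] := leP x y.
  by rewrite distrC [X in _ * X]distrC !ger0_norm ?subr_ge0 ?ler_expR //; apply: le.
by rewrite !ger0_norm ?subr_ge0 ?ler_expR //; apply: le.
Qed.

(** The exponential is Lipschitz only where the modulus is bounded, whence the bound [M]. *)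
Lemma cexp_lipschitz (M a b a' b' : R) (k : R[i]) : a <= M -> a' <= M ->
  `|complex.Re (cexp a b * k) - complex.Re (cexp a' b' * k)| <=
  2 * expR M * normc k * (`|a - a'| + `|b - b'|).
Proof.
move=> aM a'M; case: k => u w; set N := normc _.
have N0 : 0 <= N by apply: normc_ge0.
have uN : `|u| <= N by apply: (Re_le_normc (Complex u w)).
have wN : `|w| <= N.
  rewrite /N /= -sqrtr_sqr ler_sqrt ?addr_ge0 ?sqr_ge0 //.
  by rewrite lerDr sqr_ge0.
have eM : expR a' <= expR M by rewrite ler_expR.
have e0 : 0 <= expR M by apply: expR_ge0.
have part (f : R -> R) (q : R) : (forall x, `|f x| <= 1) -> (forall x y, `|f x - f y| <= `|x - y|) ->
    `|q| <= N -> `|expR a * f b * q - expR a' * f b' * q| <= expR M * N * (`|a - a'| + `|b - b'|).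
  move=> f1 fl qN; rewrite -mulrBl normrM -mulrA [N * _]mulrC mulrA.
  apply: ler_pM => //.
  have -> : expR a * f b - expR a' * f b' = (expR a - expR a') * f b + expR a' * (f b - f b') by ring.
  apply: le_trans (ler_normD _ _) _; rewrite !normrM mulrDr lerD //.
    apply: le_trans (expR_lipschitz aM a'M); by rewrite ler_piMr.
  by apply: ler_pM => //; rewrite ger0_norm // expR_ge0.
rewrite /=; have hc := part cos u (@cos_max R) cos_lipschitz uN.
have hs := part sin w (@sin_max R) sin_lipschitz wN.
rewrite (_ : _ - _ = (expR a * cos b * u - expR a' * cos b' * u) - (expR a * sin b * w - expR a' * sin b' * w)); last by ring.
apply: le_trans (ler_normB _ _) _.
rewrite -!mulrA mulr_natl mulr2n !mulrA; exact: lerD.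
Qed.

End ComplexExp.

(** * A one-parameter family of units *)

Section UnitFlow.
Variables (R : realType) (L : fieldExtType rat) (iota : {rmorphism L -> R}).
Variables (d : nat) (e : d.+1.-tuple L).
Hypotheses (hd : (0 < d)%N) (he : basis_of {:L} e) (he0 : e`_0 = 1).
Variable sg : 'I_d.+1 -> {rmorphism L -> R[i]}.
Hypothesis hE : embed_mx e sg \in unitmx.
Variable j0 : 'I_d.+1.
Hypothesis hj0 : forall x, sg j0 x = ((iota x)%:C)%C.
Variables (r : nat) (eps : 'I_r -> L) (beta : 'rV[R]_r).
Hypotheses (heps : forall i, pos_unit iota e (eps i))
  (hbeta : forall j, j != j0 -> \sum_i beta 0 i * ln (absval sg j (eps i)) = 1).

Local Notation ounit := (order_unit e).
Local Notation place := (absval sg).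

Definition unit_scale (t : R) : L := \prod_i eps i ^ Num.floor (beta 0 i * ln t).

Lemma unit_scale_unit t : ounit (unit_scale t).
Proof. by apply: (order_unit_prod (e := e)) => i; apply: order_unitXz; have [] := heps i. Qed.

Lemma unit_scale_gt0 t : 0 < iota (unit_scale t).
Proof.
rewrite rmorph_prod prodr_gt0 // => i _.
by rewrite fmorphXz exprz_gt0 //; have [] := heps i.
Qed.

Lemma place_eps_gt0 j i : 0 < place j (eps i).
Proof. by apply: place_gt0; have [[]] := heps i. Qed.

Definition log_eps j i : R := ln (place j (eps i)).

Definition frac_part (t : R) : 'rV[R]_r := map_mx (@fract R) (ln t *: beta).

Lemma frac_part_itv t i : 0 <= frac_part t 0 i < 1.
Proof. by rewrite mxE fract_itv. Qed.

Lemma sum_floor_beta (f : 'I_r -> R) t :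
  \sum_i (Num.floor (beta 0 i * ln t))%:~R * f i =
  ln t * (\sum_i beta 0 i * f i) - \sum_i frac_part t 0 i * f i.
Proof.
rewrite mulr_sumr -sumrB; apply: eq_bigr => i _.
rewrite !mxE [ln t * beta 0 i]mulrC /fract; ring.
Qed.

(** By the choice of [beta], replacing the integer exponents by [beta_i log t] would give exactly [t];
only the fractional parts remain. *)
Lemma place_unit_scale j t : j != j0 -> 0 < t ->
  place j (unit_scale t) = t * expR (- \sum_i frac_part t 0 i * log_eps j i).
Proof.
move=> jj0 t0.
have h : ln (place j (unit_scale t)) = ln t - \sum_i frac_part t 0 i * log_eps j i.
  rewrite place_prod ln_prod => [|i]; last by rewrite placeXz exprz_gt0 // place_eps_gt0.
  rewrite -[ln t in RHS]mulr1 -(hbeta jj0) -sum_floor_beta; apply: eq_bigr => i _.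
  by rewrite placeXz ln_exprz // place_eps_gt0.
by rewrite -[LHS]lnK ?posrE ?h ?expRD ?lnK ?posrE // place_gt0 //; have [] := unit_scale_unit t.
Qed.

Lemma sum_frac_le t (f : 'I_r -> R) : `|\sum_i frac_part t 0 i * f i| <= \sum_i `|f i|.
Proof.
apply: le_trans (ler_norm_sum _ _ _) _; apply: ler_sum => i _; rewrite normrM ler_piMl //.
by have /andP[h1 h2] := frac_part_itv t i; rewrite ger0_norm // ltW.
Qed.

Lemma unit_norm1 x : ounit x -> \prod_j place j x = 1.
Proof.
move=> [x0 ox ox']; rewrite -(place_norm he hE).
have /intrP[m hm] := field_norm_int he ox; have /intrP[m' hm'] := field_norm_int he ox'.
have : m * m' = 1.
  apply: (@intr_inj rat); rewrite intrM -hm -hm' /field_norm -det_mulmx -(mul_mxM he) divff //.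
  by rewrite (mul_mx1 he) det1.
move=> /(congr1 absz); rewrite abszM => /eqP; rewrite muln_eq1 => /andP[/eqP m1 _].
by rewrite hm ratr_int -intr_norm -abszE m1.
Qed.

(** The bounds at the other places give the one at the real place, because a unit has norm one. *)
Lemma unit_scale_bounds : exists2 C : R, 1 <= C & forall t, 0 < t ->
  (forall j, j != j0 -> t <= C * place j (unit_scale t) /\ place j (unit_scale t) <= C * t) /\
  1 <= C * (iota (unit_scale t) * t ^+ d) /\ iota (unit_scale t) * t ^+ d <= C.
Proof.
pose S := \sum_j \sum_i `|log_eps j i|; have S0 : 0 <= S.
  by apply: sumr_ge0 => j _; apply: sumr_ge0.
pose C := expR S; have C1 : 1 <= C by rewrite -expR0 ler_expR.
have C0 : 0 < C by apply: expR_gt0.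
have hp j t : j != j0 -> 0 < t ->
    t <= C * place j (unit_scale t) /\ place j (unit_scale t) <= C * t.
  move=> jj0 t0; rewrite (place_unit_scale jj0 t0) mulrCA -expRD.
  have Sj : `|\sum_i frac_part t 0 i * log_eps j i| <= S.
    apply: le_trans (sum_frac_le _ _) _.
    by apply: (@big_le_max_sum R _ (fun j => \sum_i `|log_eps j i|)) => k; apply: sumr_ge0.
  move: Sj; rewrite ler_norml => /andP[s1 s2].
  split; first by rewrite ler_peMr ?(ltW t0) // -expR0 ler_expR; lra.
  by rewrite [C * t]mulrC ler_pM2l // ler_expR; lra.
exists (C ^+ d); first by rewrite exprn_ege1.
have CCd : C <= C ^+ d by rewrite -[X in X <= _]expr1 ler_weXn2l.
move=> t t0; split.
  move=> j jj0; have [h1 h2] := hp j t jj0 t0; split.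
    by apply: le_trans h1 _; rewrite ler_wpM2r // place_ge0.
  by apply: le_trans h2 _; rewrite ler_wpM2r // ltW.
set w := iota _; have w0 : 0 < w by apply: unit_scale_gt0.
have hn : w * \prod_(j | j != j0) place j (unit_scale t) = 1.
  by rewrite -[RHS](unit_norm1 (unit_scale_unit t)) [RHS](bigD1 j0) //= (place_j0 hj0) gtr0_norm.
have cd : #|predC1 j0| = d by rewrite cardC1 card_ord.
have up : \prod_(j | j != j0) place j (unit_scale t) <= (C * t) ^+ d.
  apply: prod_le_const => // j jj0; rewrite place_ge0 /=; exact: (hp j t jj0 t0).2.
have lo : t ^+ d <= \prod_(j | j != j0) (C * place j (unit_scale t)).
  rewrite -{1}cd -prodr_const; apply: ler_prod => j jj0; rewrite (ltW t0) /=.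
  exact: (hp j t jj0 t0).1.
have loE : \prod_(j | j != j0) (C * place j (unit_scale t)) =
    C ^+ d * \prod_(j | j != j0) place j (unit_scale t).
  by rewrite big_split /= prodr_const cd.
split.
  by rewrite mulrCA -exprMn -hn ler_pM2l.
by rewrite -[X in _ <= X]mulr1 -hn mulrCA -loE ler_pM2l.
Qed.

Variable phase : 'I_d.+1 -> 'I_r -> R.
Hypothesis hphase : forall j i, sg j (eps i) = cexp (log_eps j i) (2 * pi * phase j i).

(** The velocity, in the variable [log t], of the angles of the conjugates of [unit_scale t]. *)
Definition rotation : 'rV[R]_d.+1 := \row_j \sum_i beta 0 i * phase j i.

(** The normalised conjugates of the scaling unit, as a function of the angles [x] and of the
fractional parts [z]. *)
Definition flow (x : 'rV[R]_d.+1) (z : 'rV[R]_r) (j : 'I_d.+1) : R[i] :=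
  cexp (- \sum_i z 0 i * log_eps j i) (2 * pi * (x 0 j - \sum_i z 0 i * phase j i)).

Lemma embed_unit_scale j t : j != j0 -> 0 < t ->
  sg j (unit_scale t) = (t%:C)%C * flow (ln t *: rotation) (frac_part t) j.
Proof.
move=> jj0 t0; rewrite rmorph_prod.
rewrite (eq_bigr (fun i => cexp ((Num.floor (beta 0 i * ln t))%:~R * log_eps j i)
  ((Num.floor (beta 0 i * ln t))%:~R * (2 * pi * phase j i)))) => [|i _]; last first.
  by rewrite fmorphXz hphase cexpXz.
rewrite cexp_prod -[t in (t%:C)%C]lnK ?posrE // cexp_real -cexpD add0r sum_floor_beta hbeta // mulr1.
congr cexp; rewrite !mxE mulrBr.
rewrite (eq_bigr (fun i => 2 * pi * ((Num.floor (beta 0 i * ln t))%:~R * phase j i))) => [|i _]; last by ring.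
by rewrite -mulr_sumr sum_floor_beta mulrBr.
Qed.

Definition coord_weight (j : 'I_d.+1) (i : 'I_d) : R[i] := invmx (embed_mx e sg) j (lift ord0 i).

(** The shift of the window caused by the lattice element [s], once the negligible
contribution of the distinguished embedding is left out. *)
Definition displacement (x : 'rV[R]_d.+1) (z : 'rV[R]_r) (s : L) : 'rV[R]_d :=
  \row_i \sum_(j | j != j0) complex.Re (flow x z j * (sg j s * coord_weight j i)).

Definition real_coords (s : L) : 'rV[R]_d := \row_i ratr (coord e (lift ord0 i) s).

Lemma displacement0 x z : displacement x z 0 = 0.
Proof. by apply/rowP => i; rewrite !mxE big1 // => j _; rewrite rmorph0 mul0r mulr0. Qed.

(** The only term of the trace formula left out of [displacement] comes from the real place, where
the unit is bounded, in fact tiny. *)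
Lemma displacement_close (s : L) : exists2 C : R, 0 <= C & forall t, 1 <= t -> forall i,
  `|(t^-1 *: real_coords (unit_scale t * s)) 0 i -
    displacement (ln t *: rotation) (frac_part t) s 0 i| <= C / t.
Proof.
have [C C1 hC] := unit_scale_bounds.
have C0 : 0 <= C by lra.
exists (C * (\sum_i normc (sg j0 s * coord_weight j0 i))).
  by rewrite mulr_ge0 // sumr_ge0 // => i _; apply: normc_ge0.
move=> t t1 i; have t0 : 0 < t by lra.
have [_ [_ wC]] := hC t t0.
have wle : iota (unit_scale t) <= C.
  apply: le_trans wC; rewrite ler_peMr ?(ltW (unit_scale_gt0 t)) // exprn_ege1 //.
have -> : (t^-1 *: real_coords (unit_scale t * s)) 0 i =
    t^-1 * complex.Re (\sum_j sg j (unit_scale t * s) * coord_weight j i).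
  by rewrite !mxE -(coord_embed he hE) ratr_complex.
have ReD : forall P : pred 'I_d.+1, forall F : 'I_d.+1 -> R[i],
    complex.Re (\sum_(j | P j) F j) = \sum_(j | P j) complex.Re (F j).
  by move=> P F; elim/big_rec2: _ => [//|j a b _ <-]; case: (F j); case: b.
have ReM : forall (a : R) (k : R[i]), complex.Re ((a%:C)%C * k) = a * complex.Re k.
  by move=> a [u w] /=; rewrite mul0r subr0.
rewrite ReD mulr_sumr (bigD1 j0) //= mxE.
rewrite (eq_bigr (fun j => complex.Re (flow (ln t *: rotation) (frac_part t) j *
  (sg j s * coord_weight j i)))) => [|j jj0]; last first.
  by rewrite rmorphM embed_unit_scale // -!mulrA ReM mulKf // gt_eqF.
rewrite addrK rmorphM hj0 -mulrA ReM normrM normfV (gtr0_norm t0) mulrC ler_pM2r ?invr_gt0 //.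
rewrite normrM gtr0_norm ?unit_scale_gt0 //; apply: ler_pM => //.
  by rewrite ltW // unit_scale_gt0.
apply: le_trans (Re_le_normc _) _.
by apply: (@big_le_max_sum R _ (fun i => normc (sg j0 s * coord_weight j0 i))) => k; apply: normc_ge0.
Qed.

Lemma displacement_periodic (x x' : 'rV[R]_d.+1) (z : 'rV[R]_r) (s : L) : (forall j, x 0 j - x' 0 j \is a Num.int) ->
  displacement x z s = displacement x' z s.
Proof.
move=> hx; apply/rowP => i; rewrite !mxE; apply: eq_bigr => j _; congr (complex.Re (_ * _)).
have /intrP[m hm] := hx j; rewrite /flow -[RHS](cexp_periodic _ _ m) -hm; congr cexp; ring.
Qed.

Lemma displacement_lipschitz (s : L) : exists2 C : R, 0 <= C & forall (x x' : 'rV[R]_d.+1) (z z' : 'rV[R]_r) (D : R),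
  (forall i, 0 <= z 0 i <= 1) -> (forall i, 0 <= z' 0 i <= 1) ->
  (forall j, `|x 0 j - x' 0 j| <= D) -> (forall i, `|z 0 i - z' 0 i| <= D) ->
  forall i, `|displacement x z s 0 i - displacement x' z' s 0 i| <= C * D.
Proof.
pose M := \sum_j \sum_i `|log_eps j i|.
pose P := \sum_j \sum_i `|phase j i|.
pose N := \sum_i \sum_j normc (sg j s * coord_weight j i).
have M0 : 0 <= M by do 2![apply: sumr_ge0 => ? _].
have P0 : 0 <= P by do 2![apply: sumr_ge0 => ? _].
have pi0 : 0 <= pi :> R by apply: pi_ge0.
pose Q := M + 2 * pi * (1 + P).
have Q0 : 0 <= Q by rewrite addr_ge0 // !mulr_ge0 // addr_ge0.
have N0 : 0 <= N by do 2![apply: sumr_ge0 => ? _]; apply: normc_ge0.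
exists (2 * expR M * N * Q); first by rewrite !mulr_ge0 // expR_ge0.
move=> x x' z z' D hz hz' hx hzz i.
have D0 : 0 <= D by apply: le_trans (hx j0).
have rowsum (f : 'I_d.+1 -> 'I_r -> R) j : \sum_i `|f j i| <= \sum_j \sum_i `|f j i|.
  by apply: (@big_le_max_sum R _ (fun j => \sum_i `|f j i|)) => k; apply: sumr_ge0.
have bnd j (y : 'rV[R]_r) : (forall i, 0 <= y 0 i <= 1) -> - \sum_i y 0 i * log_eps j i <= M.
  move=> hy; apply: le_trans (rowsum log_eps j); apply: le_trans (ler_norm _) _; rewrite normrN.
  apply: le_trans (ler_norm_sum _ _ _) _; apply: ler_sum => k _; rewrite normrM ler_piMl //.
  by have /andP[y0 y1] := hy k; rewrite ger0_norm.
have dif (f : 'I_d.+1 -> 'I_r -> R) j :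
    `|\sum_i z 0 i * f j i - \sum_i z' 0 i * f j i| <= (\sum_j \sum_i `|f j i|) * D.
  apply: (@le_trans _ _ ((\sum_i `|f j i|) * D)); last by rewrite ler_wpM2r.
  rewrite -sumrB mulr_suml; apply: le_trans (ler_norm_sum _ _ _) _.
  apply: ler_sum => k _; rewrite -mulrBl normrM mulrC ler_wpM2l //.
rewrite !mxE -sumrB; apply: le_trans (ler_norm_sum _ _ _) _.
apply: (@le_trans _ _ (\sum_(j | j != j0) 2 * expR M * normc (sg j s * coord_weight j i) * (Q * D))).
  apply: ler_sum => j _; apply: le_trans (cexp_lipschitz _ _ _ (bnd j z hz) (bnd j z' hz')) _.
  apply: ler_wpM2l; first by rewrite !mulr_ge0 ?expR_ge0 ?normc_ge0.
  rewrite /Q [X in _ <= X]mulrDl; apply: lerD.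
    rewrite -opprD normrN; exact: dif.
  rewrite -mulrBr normrM ger0_norm ?mulr_ge0 // -[X in _ <= X]mulrA ler_wpM2l ?mulr_ge0 //.
  have -> : x 0 j - \sum_i z 0 i * phase j i - (x' 0 j - \sum_i z' 0 i * phase j i) =
    (x 0 j - x' 0 j) - (\sum_i z 0 i * phase j i - \sum_i z' 0 i * phase j i) by ring.
  by apply: le_trans (ler_normB _ _) _; rewrite [X in _ <= X]mulrDl mul1r lerD.
rewrite -mulr_suml -mulr_sumr -[X in _ <= X]mulrA.
apply: ler_wpM2r; first by rewrite mulr_ge0.
apply: ler_wpM2l; first by rewrite mulr_ge0 // expR_ge0.
apply: (@le_trans _ _ (\sum_j normc (sg j s * coord_weight j i))).
  by rewrite [X in _ <= X](bigD1 j0) //= lerDr normc_ge0.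
apply: (@big_le_max_sum R _ (fun i => \sum_j normc (sg j s * coord_weight j i))) => k.
by apply: sumr_ge0 => ? _; apply: normc_ge0.
Qed.

End UnitFlow.

(** * Lattice points near the boundary of a convex set *)

Section Boundary.
Variable R : realType.

(** Indices pairwise at distance at most [q] fit in an interval with [q + 1] integers. *)
Lemma card_diameter (K : nat) (S : {pred 'I_K}) (q : R) :
  (forall i j, i \in S -> j \in S -> (i <= j)%N -> (j - i)%:R <= q) -> 0 <= q ->
  #|S|%:R <= q + 1.
Proof.
move=> hS q0; have [i0 Si0|S0] := pickP (mem S); last first.
  by rewrite eq_card0 // addr_ge0.
have [m Sm mmin] := @arg_minnP _ i0 (mem S) val Si0.
apply: (@le_trans _ _ (Num.truncn q).+1%:R); last first.
  by rewrite -natr1 lerD2r; have /andP[] := truncn_itv q0.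
rewrite ler_nat cardE -(size_map (@nat_of_ord K)) -(size_iota m (Num.truncn q).+1).
apply: uniq_leq_size; first by rewrite map_inj_uniq ?enum_uniq //; apply: val_inj.
move=> _ /mapP [i + ->]; rewrite mem_enum => Si.
have mi : (m <= i)%N := mmin _ Si.
rewrite mem_iota mi /= addnS ltnS -leq_subLR truncn_ge_nat //.
exact: hS.
Qed.

(** Two displaced copies of an arithmetic progression can be separated by an interval only
next to one of its two endpoints. *)
Lemma interval_boundary_count (K : nat) (I : R -> bool) (phi psi : 'I_K -> R) (eta delta : R) :
  0 < eta -> 0 <= delta ->
  (forall x y z, I x -> I z -> x <= y -> y <= z -> I y) ->
  (forall i j : 'I_K, (i <= j)%N -> (j - i)%:R * eta <= phi j - phi i) ->
  (forall i, `|phi i - psi i| <= delta) ->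
  #|[pred i | I (phi i) != I (psi i)]|%:R <= 4 * (delta / eta + 1).
Proof.
move=> eta0 delta0 cI sp close.
have q0 : 0 <= delta / eta by rewrite divr_ge0 ?(ltW eta0).
have card_le (S : {pred 'I_K}) :
    (forall i j, i \in S -> j \in S -> phi j <= phi i + delta) -> #|S|%:R <= delta / eta + 1.
  move=> hS; apply: card_diameter => // i j Si Sj ij.
  rewrite ler_pdivlMr //; apply: le_trans (sp _ _ ij) _.
  by rewrite lerBlDl hS.
(* The four cases: which of the two points lies in I, and on which side the other one falls. *)
pose S1 := [pred i | [&& I (phi i), ~~ I (psi i) & phi i <= psi i]].
pose S2 := [pred i | [&& I (phi i), ~~ I (psi i) & psi i <= phi i]].
pose S3 := [pred i | [&& ~~ I (phi i), I (psi i) & phi i <= psi i]].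
pose S4 := [pred i | [&& ~~ I (phi i), I (psi i) & psi i <= phi i]].
have cl i : (psi i <= phi i + delta) /\ (phi i <= psi i + delta).
  by have := close i; rewrite ler_norml; lra.
have h1 : #|S1|%:R <= delta / eta + 1.
  apply: card_le => i j /and3P[Ii nIi le_i] /and3P[Ij _ _]; have [c _] := cl i.
  apply: le_trans c; rewrite leNgt; apply: contra nIi => /ltW le_ij.
  exact: (cI (phi i) _ (phi j)).
have h2 : #|S2|%:R <= delta / eta + 1.
  apply: card_le => i j /and3P[Ii _ _] /and3P[Ij nIj le_j]; have [_ c] := cl j.
  apply: le_trans c _; rewrite lerD2r leNgt; apply: contra nIj => /ltW le_ij.
  exact: (cI (phi i) _ (phi j)).
have h3 : #|S3|%:R <= delta / eta + 1.
  apply: card_le => i j /and3P[_ Ii _] /and3P[nIj Ij le_j]; have [c _] := cl i.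
  apply: le_trans c; rewrite leNgt; apply: contra nIj => /ltW le_ij.
  exact: (cI (psi i) _ (psi j)).
have h4 : #|S4|%:R <= delta / eta + 1.
  apply: card_le => i j /and3P[nIi Ii le_i] /and3P[_ Ij _]; have [_ c] := cl j.
  apply: le_trans c _; rewrite lerD2r leNgt; apply: contra nIi => /ltW le_ij.
  exact: (cI (psi i) _ (psi j)).
have hc : (#|[pred i | I (phi i) != I (psi i)]| <= #|S1| + #|S2| + #|S3| + #|S4|)%N.
  have leU (P Q : {pred 'I_K}) : (#|[predU P & Q]| <= #|P| + #|Q|)%N.
    by rewrite -cardUI leq_addr.
  apply: (@leq_trans #|[predU [predU [predU S1 & S2] & S3] & S4]|).
    apply: subset_leq_card; apply/fintype.subsetP => i; rewrite !inE.
    by case: (I (phi i)); case: (I (psi i)); case: (leP (phi i) (psi i)) => // /ltW ->.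
  by do 3![apply: leq_trans (leU _ _) _; rewrite leq_add2r].
apply: (@le_trans _ _ (#|S1| + #|S2| + #|S3| + #|S4|)%:R); first by rewrite ler_nat.
by rewrite !natrD; lra.
Qed.

Variable d : nat.

Definition grid_point (K : nat) (phi : 'I_d -> 'I_K -> R) (m : {ffun 'I_d -> 'I_K}) : 'rV[R]_d :=
  \row_i phi i (m i).

Definition set_coord (K : nat) (m : {ffun 'I_d -> 'I_K}) (k : 'I_d) (a : 'I_K) :
  {ffun 'I_d -> 'I_K} := [ffun i => if i == k then a else m i].

(** Averaging over one coordinate: this reduces a count over the cube to counts on lines. *)
Lemma sum_set_coord (K : nat) (k : 'I_d) (F : {ffun 'I_d -> 'I_K} -> R) :
  \sum_m \sum_a F (set_coord m k a) = K%:R * \sum_m F m.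
Proof.
rewrite pair_bigA /=.
(* Exchanging the coordinate k of m with a is an involution of the pairs (m, a). *)
pose h (p : {ffun 'I_d -> 'I_K} * 'I_K) := (set_coord p.1 k p.2, p.1 k).
have hK : involutive h.
  move=> [m a]; rewrite /h /=; congr (_, _); last by rewrite ffunE eqxx.
  by apply/ffunP => i; rewrite !ffunE; case: eqP => [->|].
rewrite (reindex_inj (inv_inj hK)) /=.
rewrite (eq_bigr (fun p : {ffun 'I_d -> 'I_K} * 'I_K => F p.1)) => [|[m a] _].
  rewrite -(pair_bigA _ (fun m a => F m)) /= mulr_sumr; apply: eq_bigr => m _.
  by rewrite sumr_const card_ord mulr_natl.
by congr F; apply/ffunP => i; rewrite !ffunE; case: eqP => [->|].
Qed.

Lemma natr_card_sum (T : finType) (P : pred T) : #|P|%:R = \sum_x (P x)%:R :> R.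
Proof. by rewrite -sum1_card natr_sum big_mkcond; apply: eq_bigr => x _; rewrite unfold_in; case: (P x). Qed.

Definition line_convex (A : set 'rV[R]_d) := forall x y t, 0 <= t <= 1 -> A x -> A y ->
  A (t *: x + (1 - t) *: y).

(** Changing the coordinates one at a time reduces the count to the lines parallel to the
axes, on which a convex set is an interval. *)
Lemma convex_boundary_count (A : set 'rV[R]_d) (K : nat) (phi psi : 'I_d -> 'I_K -> R)
    (eta delta : R) :
  line_convex A -> 0 < eta -> 0 <= delta -> (0 < d)%N -> (0 < K)%N ->
  (forall k (i j : 'I_K), (i <= j)%N -> (j - i)%:R * eta <= phi k j - phi k i) ->
  (forall k i, `|phi k i - psi k i| <= delta) ->
  #|[pred m | `[< A (grid_point phi m) >] != `[< A (grid_point psi m) >]]|%:R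
    <= d%:R * (4 * (delta / eta + 1)) * K%:R ^+ d.-1.
Proof.
move=> cA eta0 delta0 d0 K0 sp close.
(* The first k coordinates of hyb k m are taken from psi, the other ones from phi. *)
pose hyb k (m : {ffun 'I_d -> 'I_K}) : 'rV[R]_d := \row_i (if (i < k)%N then psi i (m i) else phi i (m i)).
pose step k (m : {ffun 'I_d -> 'I_K}) := `[< A (hyb k m) >] != `[< A (hyb k.+1 m) >].
have KR : 0 < K%:R :> R by rewrite ltr0n.
have hstep (k : 'I_d) : #|step k|%:R <= 4 * (delta / eta + 1) * K%:R ^+ d.-1.
  rewrite -(ler_pM2l KR) natr_card_sum -(sum_set_coord k).
  have -> : K%:R * (4 * (delta / eta + 1) * K%:R ^+ d.-1) =
      \sum_(m : {ffun 'I_d -> 'I_K}) 4 * (delta / eta + 1).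
    rewrite sumr_const card_ffun !card_ord -[RHS]mulr_natr natrX -{2}(prednK d0) exprS.
    by rewrite mulrCA.
  apply: ler_sum => m _.
  pose line (x : R) : 'rV[R]_d :=
    \row_i (if i == k then x else if (i < k)%N then psi i (m i) else phi i (m i)).
  rewrite (eq_bigr (fun a => (`[< A (line (phi k a)) >] != `[< A (line (psi k a)) >])%:R)).
    rewrite -(natr_card_sum (fun a => `[< A (line (phi k a)) >] != `[< A (line (psi k a)) >])).
    apply: ((@interval_boundary_count K (fun x => `[< A (line x) >]) _ _ _ _) eta0 delta0 _ (sp k) (close k)).
    move=> x y z /asboolP Ax /asboolP Az xy yz; apply/asboolP.
    have [xz|xz] := eqVneq x z; first by rewrite (_ : y = x) //; lra.
    have xz0 : 0 < z - x by rewrite subr_gt0 lt_neqAle xz (le_trans xy).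
    have -> : line y = ((z - y) / (z - x)) *: line x + (1 - (z - y) / (z - x)) *: line z.
      apply/rowP => i; rewrite !mxE; case: eqP => _; last by rewrite -mulrDl addrC subrK mul1r.
      by field; rewrite gt_eqF.
    apply: cA => //; apply/andP; split; first by rewrite divr_ge0 ?(ltW xz0) // subr_ge0.
    by rewrite ler_pdivrMr // mul1r; lra.
  move=> a _; congr ((`[< A _ >] != `[< A _ >])%:R).
    apply/rowP => i; rewrite !mxE ffunE; case: (eqVneq i k) => [->|//].
    by rewrite ltnn.
  apply/rowP => i; rewrite !mxE ffunE ltnS; case: (eqVneq i k) => [->|ik].
    by rewrite leqnn.
  by rewrite leq_eqVlt (inj_eq val_inj) (negbTE ik).
have sub m : `[< A (grid_point phi m) >] != `[< A (grid_point psi m) >] ->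
    exists k : 'I_d, step k m.
  have -> : grid_point phi m = hyb 0%N m by apply/rowP => i; rewrite !mxE.
  have -> : grid_point psi m = hyb d m by apply/rowP => i; rewrite !mxE ltn_ord.
  move=> ne; apply: contrapT => /forallNP no; move/eqP: ne; apply.
  have H k : (k <= d)%N -> `[< A (hyb 0%N m) >] = `[< A (hyb k m) >].
    elim: k => [//|k IH] lt; rewrite IH ?(ltnW lt) //.
    by have /negP := no (Ordinal lt); rewrite negbK => /eqP.
  exact: H.
rewrite natr_card_sum; apply: (@le_trans _ _ (\sum_m \sum_(k < d) (step k m)%:R)).
  apply: ler_sum => m _; rewrite /=; case: (boolP (`[< A (grid_point phi m) >] != _)) => [/sub[k hk]|_]; last exact: sumr_ge0.
  by rewrite (bigD1 k) //= hk lerDl sumr_ge0.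
have -> : d%:R * (4 * (delta / eta + 1)) * K%:R ^+ d.-1 =
    \sum_(k < d) 4 * (delta / eta + 1) * K%:R ^+ d.-1.
  by rewrite sumr_const card_ord -mulrA mulr_natl.
by rewrite exchange_big; apply: ler_sum => k _; rewrite -(natr_card_sum (step k)).
Qed.

End Boundary.

(** * Counting lattice points with a given pattern *)

Section FiniteCount.

Lemma card_fset_set_image (T : finType) (U : choiceType) (f : T -> U) (P : pred T) (S : set U) :
  injective f -> (forall u, S u <-> exists2 x, P x & f x = u) -> #|` fset_set S|%fset = #|P|.
Proof.
move=> finj hS.
have SE : S = f @` [set x | P x].
  by apply/seteqP; split=> u; [case/hS => x Px <-; exists x | case=> x Px <-; apply/hS; exists x].
have finS : finite_set S by rewrite SE; apply: finite_image; apply: finite_finset.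
have -> : fset_set S = [fset f x | x in P]%fset.
  apply/fsetP => u; rewrite in_fset_set //; apply/idP/imfsetP => /=.
    by move/set_mem/hS => [x Px <-]; exists x.
  by case=> x Px ->; apply/mem_set/hS; exists x.
by rewrite card_imfset //= cardE; congr size.
Qed.

Lemma leq_card_fset_set (T : finType) (U : choiceType) (f : T -> U) (S : set U) :
  injective f -> finite_set S -> (forall x, S (f x)) -> (#|T| <= #|` fset_set S|%fset)%N.
Proof.
move=> finj finS hS; rewrite cardE -(size_map f); apply: uniq_leq_size.
  by rewrite map_inj_uniq ?enum_uniq.
by move=> _ /mapP [x _ ->]; rewrite in_fset_set //; apply/mem_set.
Qed.

Definition divn_ord (K N : nat) (N0 : (0 < N)%N) (a : 'I_(K * N)) : 'I_K :=
  Ordinal (etrans (ltn_divLR a K N0) (ltn_ord a)).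

(** Dividing all the coordinates by [N] is exactly [N ^ d] to one on the cube of side [K * N]. *)
Lemma card_divn_ord_fiber (d K N : nat) (N0 : (0 < N)%N) (Q : pred {ffun 'I_d -> 'I_K}) :
  #|[pred f : {ffun 'I_d -> 'I_(K * N)} | Q [ffun k => divn_ord N0 (f k)]]| = (N ^ d * #|Q|)%N.
Proof.
have fib1 (b : 'I_K) : #|[pred a : 'I_(K * N) | divn_ord N0 a == b]| = N.
  have hlt (j : 'I_N) : (b * N + j < K * N)%N.
    apply: (@leq_trans (b.+1 * N)); first by rewrite mulSn addnC ltn_add2r.
    by rewrite leq_mul2r ltn_ord orbT.
  pose h (j : 'I_N) : 'I_(K * N) := Ordinal (hlt j).
  have hinj : injective h by move=> i j /(congr1 val) /= /addnI /val_inj.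
  rewrite -[RHS]card_ord -(card_codom hinj); apply: eq_card => a; rewrite inE.
  apply/eqP/codomP => [/(congr1 val) /= hb|[j ->]]; last first.
    by apply/val_inj; rewrite /= divnMDl // divn_small ?addn0.
  exists (Ordinal (ltn_pmod a N0)); apply/val_inj; rewrite /= -hb; exact: divn_eq.
have fib (g : {ffun 'I_d -> 'I_K}) :
    #|[pred f : {ffun 'I_d -> 'I_(K * N)} | [ffun k => divn_ord N0 (f k)] == g]| = (N ^ d)%N.
  transitivity #|family (fun k : 'I_d => [pred a : 'I_(K * N) | divn_ord N0 a == g k])|.
    apply: eq_card => f; rewrite !inE; apply/eqP/familyP => [<- k|h].
      by rewrite inE ffunE.
    by apply/ffunP => k; rewrite ffunE; have := h k; rewrite inE => /eqP.
  rewrite card_family -[in RHS](card_ord d) cardE /image_mem.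
  by elim: (enum _) => //= k s ->; rewrite fib1 expnS.
rewrite -sum1_card (partition_big (fun f : {ffun 'I_d -> 'I_(K * N)} => [ffun k => divn_ord N0 (f k)]) Q) //=.
rewrite [RHS]mulnC -sum_nat_const; apply: eq_bigr => g Qg.
rewrite -(fib g) -sum1_card; apply: eq_bigl => f; rewrite !inE.
by case: eqP => [->|]; rewrite ?andbT ?andbF.
Qed.

End FiniteCount.

(** For proportions an error in the denominator costs no more than one in the numerator. *)
Lemma ratio_diff (R : realFieldType) (a b a' b' E : R) :
  0 < b -> 0 <= a' -> a' <= b' -> `|a - a'| <= E -> `|b - b'| <= E ->
  `|a / b - a' / b'| <= 2 * E / b.
Proof.
move=> b0 a'0 a'b' haa hbb.
have q01 : 0 <= a' / b' <= 1.
  have [b'0|b'0] := eqVneq b' 0; first by rewrite b'0 invr0 mulr0 lexx ler01.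
  have b'p : 0 < b' by rewrite lt0r b'0 (le_trans a'0).
  by rewrite divr_ge0 ?(ltW b'p) //= ler_pdivrMr // mul1r.
have qE : a' = a' / b' * b'.
  have [b'0|b'0] := eqVneq b' 0; last by rewrite divfK.
  by apply/eqP; rewrite b'0 mulr0 eq_le a'0 andbT -b'0.
have -> : a / b - a' / b' = ((a - a') + a' / b' * (b' - b)) / b.
  by rewrite {2}qE mulrBr addrA subrK mulrBl mulfK ?gt_eqF.
rewrite normrM normfV (gtr0_norm b0) ler_pM2r ?invr_gt0 //.
apply: le_trans (ler_normD _ _) _; rewrite mulr_natl mulr2n lerD // normrM distrC.
by case/andP: q01 => q0 q1; rewrite (ger0_norm q0); apply: le_trans hbb; rewrite ler_piMl.
Qed.

Section Pattern.
Variables (R : realType) (d : nat).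
Hypothesis hd : (0 < d)%N.
Variables (A : set 'rV[R]_d) (c : nat).
Hypotheses (cA : line_convex A) (c0 : (0 < c)%N)
  (hc : forall x, A x -> forall i, `|x 0 i| <= c%:R).
Variables (I : finType) (i0 : I).
Implicit Types (v : I -> 'rV[R]_d) (B : pred {ffun I -> bool}).

(** The information on a point that a pattern may use: which of its finitely many shifts lie in the
set. A pattern is then a predicate on such Boolean vectors. *)
Definition memb v (x : 'rV[R]_d) : {ffun I -> bool} := [ffun i => `[< A (x + v i) >]].

Definition pattern_count B v (t : R) : nat :=
  #|` fset_set [set m : 'rV[int]_d | B (memb v (t^-1 *: map_mx intr m))]|%fset.

(** With [v i0 = 0], a guarded pattern is shown only by points of the set itself, so that it has
finitely many occurrences. *)
Definition guarded B := forall g, B g -> g i0.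

(** Coordinates of the integer points of a cube centred near the origin, scaled by [1 / t]. *)
Definition grid (t : R) (o K : nat) (k : 'I_d) (a : 'I_K) : R := ((a : nat)%:R - o%:R) / t.

(** Any cube that contains the dilated set will do, which allows to compare different values of [t]
on the same cube. *)
Lemma pattern_count_grid B v t o K : guarded B -> v i0 = 0 -> 0 < t -> c%:R * t <= o%:R ->
  (2 * o < K)%N ->
  pattern_count B v t = #|[pred f | B (memb v (grid_point (@grid t o K) f))]|.
Proof.
clear hd cA c0; move=> gB v0 t0 cto oK.
pose emb (f : {ffun 'I_d -> 'I_K}) : 'rV[int]_d := \row_i ((f i : nat)%:Z - o%:Z).
have embE f : t^-1 *: map_mx intr (emb f) = grid_point (@grid t o K) f.
  by apply/rowP => i; rewrite !mxE rmorphB /= mulrC.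
apply: (@card_fset_set_image _ _ emb).
  move=> f g /rowP h; apply/ffunP => i; apply/val_inj; have := h i; rewrite !mxE.
  by move/addIr => -[].
move=> m; split=> [/= Bm|[f Pf <-]]; last by rewrite /= embE.
have Am : A (t^-1 *: map_mx intr m).
  by have := gB _ Bm; rewrite ffunE v0 addr0 => /asboolP.
have hm i : (- o%:Z <= m 0 i) && (m 0 i <= o%:Z).
  have := hc Am i; rewrite !mxE normrM normfV (gtr0_norm t0) mulrC ler_pdivrMr //.
  move/le_trans/(_ cto); rewrite ler_norml -!(ler_int R).
  by rewrite rmorphN.
have mlt i : (absz (m 0 i + o%:Z)%R < K)%N by have := hm i; lia.
exists [ffun i => Ordinal (mlt i)]; last first.
  by apply/rowP => i; rewrite !mxE ffunE /= gez0_abs ?addrK //; have /andP[] := hm i; rewrite -subr_ge0 opprK.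
rewrite /= -embE; congr (B (memb v (_ *: map_mx _ _))): Bm.
by apply/rowP => i; rewrite !mxE ffunE /= gez0_abs ?addrK //; have /andP[] := hm i; rewrite -subr_ge0 opprK.
Qed.

Lemma finite_window t : 0 < t -> finite_set [set m : 'rV[int]_d | A (t^-1 *: map_mx intr m)].
Proof.
clear hd cA c0; move=> t0; pose o := (Num.truncn (c%:R * t)).+1.
have co : c%:R * t <= o%:R by apply/ltW/truncnS_gt.
pose emb (f : {ffun 'I_d -> 'I_(2 * o).+1}) : 'rV[int]_d := \row_i ((f i : nat)%:Z - o%:Z).
apply: (@sub_finite_set _ _ (emb @` setT)); last by apply: finite_image; apply: finite_finset.
move=> m /= Am.
have hm i : (- o%:Z <= m 0 i) && (m 0 i <= o%:Z).
  have := hc Am i; rewrite !mxE normrM normfV (gtr0_norm t0) mulrC ler_pdivrMr //.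
  by move/le_trans/(_ co); rewrite ler_norml -!(ler_int R) rmorphN.
have mlt i : (absz (m 0 i + o%:Z)%R < (2 * o).+1)%N.
  by have := hm i; move: (o) => n; lia.
exists [ffun i => Ordinal (mlt i)] => //.
apply/rowP => i; rewrite !mxE ffunE /= gez0_abs ?addrK //.
by have /andP[] := hm i; rewrite -subr_ge0 opprK.
Qed.

(** If a pattern distinguishes two points then so does one of the shifted copies of the set. *)
Lemma pattern_grid_diff B v v' (K : nat) (phi psi : 'I_d -> 'I_K -> R) (eta delta : R) :
  0 < eta -> 0 <= delta -> (0 < K)%N ->
  (forall k (i j : 'I_K), (i <= j)%N -> (j - i)%:R * eta <= phi k j - phi k i) ->
  (forall i k a, `|(phi k a + v i 0 k) - (psi k a + v' i 0 k)| <= delta) ->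
  `|#|[pred f | B (memb v (grid_point phi f))]|%:R -
    #|[pred f | B (memb v' (grid_point psi f))]|%:R|
  <= #|I|%:R * (d%:R * (4 * (delta / eta + 1)) * K%:R ^+ d.-1).
Proof.
move=> eta0 delta0 K0 sp close.
pose bad i (f : {ffun 'I_d -> 'I_K}) :=
  `[< A (grid_point phi f + v i) >] != `[< A (grid_point psi f + v' i) >].
rewrite 2!natr_card_sum -sumrB; apply: le_trans (ler_norm_sum _ _ _) _.
apply: (@le_trans _ _ (\sum_f \sum_i (bad i f)%:R)).
  apply: ler_sum => f _ /=; have [->|ne] := eqVneq (memb v (grid_point phi f)) (memb v' (grid_point psi f)).
    by rewrite subrr normr0 sumr_ge0.
  have [i hi] : exists i, bad i f.
    apply: contrapT => /forallNP no; move/eqP: ne; apply; apply/ffunP => i; rewrite !ffunE.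
    by apply/eqP; have /negP := no i; rewrite negbK.
  rewrite (bigD1 i) //= hi; apply: (@le_trans _ _ 1); last by rewrite lerDl sumr_ge0.
  by case: (B _); case: (B _); rewrite ?subrr ?subr0 ?sub0r ?normrN ?normr1 ?normr0.
rewrite [X in _ <= X]mulr_natl -sumr_const.
rewrite exchange_big; apply: ler_sum => i _; rewrite -(natr_card_sum R (bad i)).
have shift (u : I -> 'rV[R]_d) (th : 'I_d -> 'I_K -> R) f :
    grid_point th f + u i = grid_point (fun k a => th k a + u i 0 k) f.
  by apply/rowP => k; rewrite !mxE.
rewrite (@eq_card _ _ [pred m | `[< A (grid_point (fun k a => phi k a + v i 0 k) m) >] !=
    `[< A (grid_point (fun k a => psi k a + v' i 0 k) m) >]]) => [|f]; last first.
  by rewrite !inE unfold_in /bad !shift.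
apply: convex_boundary_count => // k a b ab.
by rewrite opprD addrACA subrr addr0; apply: sp.
Qed.

End Pattern.

(** * Pattern frequencies *)

Section Limit.
Variables (R : realType) (d : nat).
Hypothesis hd : (0 < d)%N.
Variables (A : set 'rV[R]_d) (c : nat).
Hypotheses (cA : line_convex A) (c0 : (0 < c)%N)
  (hc : forall x, A x -> forall i, `|x 0 i| <= c%:R).
Variables (p : 'rV[R]_d) (rho : R).
Hypotheses (rho0 : 0 < rho) (hrho : forall x : 'rV[R]_d, (forall i, `|x 0 i - p 0 i| <= rho) -> A x).
Variables (I : finType) (i0 : I).
Implicit Types (v : I -> 'rV[R]_d) (B : pred {ffun I -> bool}).

Local Notation pcount := (pattern_count A).

Definition total_count (t : R) : nat := pcount (fun g : {ffun I -> bool} => g i0) (fun=> 0) t.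

Definition box_radius (t : R) : nat := (c * (Num.truncn t).+1)%N.

Lemma box_radius_ge t : c%:R * t <= (box_radius t)%:R.
Proof. by rewrite natrM ler_pM2l ?ltr0n // ltW // truncnS_gt. Qed.

Lemma box_size_le t : 1 <= t -> (2 * box_radius t).+1%:R <= (5 * c)%N%:R * t.
Proof.
move=> t1; have ht : (Num.truncn t)%:R <= t by rewrite truncn_le; lra.
have c1 : 1 <= c%:R :> R by rewrite ler1n.
by rewrite -natr1 /box_radius !natrM -natr1; nra.
Qed.

Lemma pattern_count_total v t : v i0 = 0 -> pcount (fun g => g i0) v t = total_count t.
Proof.
by move=> v0; congr (size (fset_set _)); apply/seteqP; split=> m; rewrite /= !ffunE v0.
Qed.

Lemma pattern_count_le_total B v t : guarded i0 B -> v i0 = 0 -> 0 < t ->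
  (pcount B v t <= total_count t)%N.
Proof.
move=> gB v0 t0; rewrite -(pattern_count_total t v0).
have hK : (2 * box_radius t < (2 * box_radius t).+1)%N by [].
rewrite (pattern_count_grid hc gB v0 t0 (box_radius_ge t) hK).
rewrite (pattern_count_grid hc _ v0 t0 (box_radius_ge t) hK) //.
by apply: subset_leq_card; apply/fintype.subsetP => f; rewrite !inE; apply: gB.
Qed.

Lemma sum_pattern_count (W : finType) (B : W -> pred {ffun I -> bool}) v t :
  (forall w, guarded i0 (B w)) -> (forall g, (\sum_w B w g = g i0)%N) -> v i0 = 0 -> 0 < t ->
  (\sum_w pcount (B w) v t = total_count t)%N.
Proof.
move=> gB hsum v0 tp; rewrite -(pattern_count_total t v0).
have hK : (2 * box_radius t < (2 * box_radius t).+1)%N by [].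
rewrite (pattern_count_grid hc _ v0 tp (box_radius_ge t) hK) //.
rewrite (eq_bigr (fun w => \sum_f B w (memb A v (grid_point (@grid R d t (box_radius t) (2 * box_radius t).+1) f)))%N).
  rewrite exchange_big -sum1_card [in RHS]big_mkcond; apply: eq_bigr => f _.
  by rewrite hsum inE; case: (memb _ _ _ _).
move=> w _; rewrite (pattern_count_grid hc (gB w) v0 tp (box_radius_ge t) hK).
by rewrite -sum1_card big_mkcond; apply: eq_bigr => f _; rewrite inE; case: (B w _).
Qed.

(** The window contains the cube with centre [p] and half side [rho]. *)
Lemma total_count_ge t : 2 / rho <= t -> (rho / 2) ^+ d * t ^+ d <= (total_count t)%:R.
Proof.
move=> ht; have t0 : 0 < t by apply: lt_le_trans ht; rewrite divr_gt0.
have tr : 2 <= t * rho by rewrite -ler_pdivrMr.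
pose k := Num.truncn (t * rho).
have kt : k%:R <= t * rho by rewrite truncn_le; lra.
have kt' : t * rho < k.+1%:R by apply: truncnS_gt.
pose q (i : 'I_d) := Num.floor (t * p 0 i) + 1.
pose emb (f : {ffun 'I_d -> 'I_k}) : 'rV[int]_d := \row_i (q i + (f i : nat)%:Z).
apply: (@le_trans _ _ (k ^ d)%N%:R).
  rewrite -exprMn natrX; apply: lerXn2r; rewrite ?nnegrE ?mulr_ge0 ?divr_ge0 ?(ltW t0) ?(ltW rho0) //.
  by move: kt'; rewrite -natr1; lra.
rewrite ler_nat -[X in (X <= _)%N](_ : #|{ffun 'I_d -> 'I_k}| = _); last by rewrite card_ffun !card_ord.
apply: (@leq_card_fset_set _ _ emb).
- move=> f g /rowP h; apply/ffunP => i; apply/val_inj; have := h i; rewrite !mxE.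
  by move/addrI => -[].
- have -> : [set m : 'rV[int]_d | memb A (fun=> 0) (t^-1 *: map_mx intr m) i0] =
      [set m : 'rV[int]_d | A (t^-1 *: map_mx intr m)].
    by apply/seteqP; split=> m /=; rewrite ffunE addr0 => /asboolP.
  exact: (finite_window hc t0).
move=> f /=; rewrite ffunE addr0; apply/asboolP/hrho => i; rewrite !mxE.
have -> : t^-1 * (q i + (f i : nat)%:Z)%:~R - p 0 i = ((q i)%:~R + (f i)%:R - t * p 0 i) / t.
  by rewrite intrD -pmulrn; field; rewrite gt_eqF.
rewrite normrM normfV (gtr0_norm t0) ler_pdivrMr // mulrC /q intrD.
have h1 : (Num.floor (t * p 0 i))%:~R <= t * p 0 i by apply: floor_le.
have h2 : t * p 0 i < (Num.floor (t * p 0 i))%:~R + 1 by have := floorD1_gt (t * p 0 i); rewrite intrD.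
have h3 : (f i)%:R + 1 <= k%:R :> R by rewrite natr1 ler_nat.
have h4 : 0 <= (f i)%:R :> R by [].
by rewrite ler_norml; move: h1 h2 h3 h4 kt; set F := _%:~R; lra.
Qed.

Definition ratio B v (t : R) : R := (pcount B v t)%:R / (total_count t)%:R.

Lemma grid_spacing (t : R) o K (k : 'I_d) (i j : 'I_K) : 0 < t -> (i <= j)%N ->
  (j - i)%:R * t^-1 <= grid t o k j - grid t o k i.
Proof. by move=> t_gt0 ij; rewrite /grid -mulrBl opprB addrA subrK natrB. Qed.

Let tmin : R := 1 + 2 / rho.
Let vol : R := (rho / 2) ^+ d.
Let cst (kappa : R) : R := 2 * (#|I|%:R * (d%:R * 4)) * kappa ^+ d.-1 / vol.

Let vol_gt0 : 0 < vol. Proof. by rewrite exprn_gt0 // divr_gt0. Qed.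

Let cst_ge0 kappa : 0 <= kappa -> 0 <= cst kappa.
Proof. by move=> k0; rewrite divr_ge0 ?(ltW vol_gt0) // !mulr_ge0 // exprn_ge0. Qed.

Let tmin_ge1 : 1 <= tmin. Proof. by rewrite lerDl divr_ge0 // ltW. Qed.

Let total_gt t : tmin <= t -> 0 < t /\ vol * t ^+ d <= (total_count t)%:R.
Proof.
move=> ht; split; first by apply: lt_le_trans ht; apply: lt_le_trans tmin_ge1.
by rewrite total_count_ge //; apply: le_trans ht; rewrite lerDr.
Qed.

Let total_pos t : tmin <= t -> 0 < (total_count t)%:R :> R.
Proof.
by move=> /total_gt[tp h]; apply: lt_le_trans h; apply: mulr_gt0 => //; apply: exprn_gt0.
Qed.

(** Boundary effects are of order [t ^ (d - 1)], against a total of order [t ^ d]. *)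
Let boundary_error t q kappa (K : R) : tmin <= t -> 0 <= q -> 0 <= K -> K <= kappa * t ->
  2 * (#|I|%:R * (d%:R * (4 * (q + 1)) * K ^+ d.-1)) / (total_count t)%:R
  <= cst kappa * (q + 1) / t.
Proof.
move=> ht q0 K0 Kk; have [tp tv] := total_gt ht; have Tp := total_pos ht.
have kap0 : 0 <= kappa by rewrite -(pmulr_lge0 _ tp) (le_trans K0).
rewrite ler_pdivrMr // /cst.
have -> : 2 * (#|I|%:R * (d%:R * 4)) * kappa ^+ d.-1 / vol * (q + 1) / t * (total_count t)%:R =
  2 * (#|I|%:R * (d%:R * 4)) * (q + 1) * (kappa ^+ d.-1 * ((total_count t)%:R / (vol * t))).
  by field; rewrite ?gt_eqF.
have -> : 2 * (#|I|%:R * (d%:R * (4 * (q + 1)) * K ^+ d.-1)) =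
  2 * (#|I|%:R * (d%:R * 4)) * (q + 1) * K ^+ d.-1 by ring.
apply: ler_wpM2l; first by rewrite !mulr_ge0 // addr_ge0.
apply: (@le_trans _ _ ((kappa * t) ^+ d.-1)).
  by apply: lerXn2r; rewrite ?nnegrE ?mulr_ge0 // ltW.
rewrite exprMn ler_wpM2l ?exprn_ge0 // ler_pdivlMr ?mulr_gt0 //.
by rewrite mulrCA -exprSr prednK.
Qed.

(** Same grid, displaced translates of the window. *)
Lemma ratio_shift : exists2 C : R, 0 <= C & forall B v v' t delta,
  guarded i0 B -> v i0 = 0 -> v' i0 = 0 -> tmin <= t -> 0 <= delta ->
  (forall i k, `|v i 0 k - v' i 0 k| <= delta) ->
  `|ratio B v t - ratio B v' t| <= C * (delta + t^-1).
Proof.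
exists (cst (5 * c)%N%:R); first exact: cst_ge0.
move=> B v v' t delta gB v0 v'0 ht delta0 hv; have [tp tv] := total_gt ht.
have hK : (2 * box_radius t < (2 * box_radius t).+1)%N by [].
have t1 : 1 <= t by apply: le_trans ht.
have -> : cst (5 * c)%N%:R * (delta + t^-1) = cst (5 * c)%N%:R * (delta / t^-1 + 1) / t.
  by rewrite invrK; field; rewrite gt_eqF.
apply: le_trans (boundary_error ht _ _ (box_size_le t1)); last 2 first.
- by rewrite invrK mulr_ge0 // ltW.
- by [].
apply: ratio_diff; rewrite ?total_pos ?ler0n ?ler_nat ?pattern_count_le_total // ?subrr ?normr0.
  rewrite (pattern_count_grid hc gB v0 tp (box_radius_ge t) hK).
  rewrite (pattern_count_grid hc gB v'0 tp (box_radius_ge t) hK).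
  apply: pattern_grid_diff => //; first by rewrite invr_gt0.
    by move=> k i j; apply: grid_spacing.
  by move=> i k a; rewrite opprD addrACA subrr add0r.
by rewrite !mulr_ge0 // ?exprn_ge0 // addr_ge0 // mulr_ge0 // ?invrK ltW.
Qed.

(** Same translates, on the [N] times finer grid: rounding each fine grid point down to the coarse
grid moves it by at most [1 / t]. *)
Lemma ratio_refine : exists2 C : R, 0 <= C & forall B v t (N : nat),
  guarded i0 B -> v i0 = 0 -> tmin <= t -> (0 < N)%N ->
  `|ratio B v t - ratio B v (N%:R * t)| <= C * t^-1.
Proof.
exists (cst (5 * c)%N%:R * (1 + 1)); first by rewrite mulr_ge0 ?addr_ge0 ?cst_ge0.
move=> B v t N gB v0 ht N0; have [tp tv] := total_gt ht.
have NR : 0 < N%:R :> R by rewrite ltr0n.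
have Ntp : 0 < N%:R * t by rewrite mulr_gt0.
have t1 : 1 <= t by apply: le_trans ht.
set o := box_radius t; set K := (2 * o).+1.
have hK : (2 * o < K)%N by [].
have co : c%:R * t <= o%:R by apply: box_radius_ge.
have co' : c%:R * (N%:R * t) <= (o * N)%N%:R by rewrite natrM mulrCA [X in X <= _]mulrC ler_pM2r.
have hK' : (2 * (o * N) < K * N)%N by rewrite mulnA ltn_pmul2r.
pose phi := @grid R d (N%:R * t) (o * N) (K * N).
pose psi (k : 'I_d) (a : 'I_(K * N)) := @grid R d t o K k (divn_ord N0 a).
set E := #|I|%:R * (d%:R * (4 * (t^-1 / (N%:R * t)^-1 + 1)) * (K * N)%N%:R ^+ d.-1).
have fine (B' : pred {ffun I -> bool}) : guarded i0 B' ->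
    `|(N ^ d)%N%:R * (pcount B' v t)%:R - (pcount B' v (N%:R * t))%:R| <= E.
  move=> gB'.
  rewrite (pattern_count_grid hc gB' v0 Ntp co' hK') (pattern_count_grid hc gB' v0 tp co hK).
  rewrite distrC -natrM -(card_divn_ord_fiber N0 (fun f => B' (memb A v (grid_point (grid t o (K:=K)) f)))).
  rewrite [X in `|_ - X%:R|](_ : _ = #|[pred f | B' (memb A v (grid_point psi f))]|); last first.
    apply: eq_card => f; rewrite !inE; congr (B' (memb A v _)).
    by apply/rowP => k; rewrite !mxE ffunE.
  apply: pattern_grid_diff => //; first by rewrite invr_gt0.
  - by rewrite invr_ge0 ltW.
  - by rewrite muln_gt0.
  - by move=> k i j; apply: grid_spacing.
  move=> i k a; rewrite opprD addrACA subrr addr0 /phi /psi /grid /=.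
  have aE : (a : nat)%:R = (a %/ N)%:R * N%:R + (a %% N)%:R :> R.
    by rewrite {1}(divn_eq a N) natrD natrM.
  have -> : ((a : nat)%:R - (o * N)%N%:R) / (N%:R * t) - ((a %/ N)%:R - o%:R) / t =
     ((a %% N)%:R / N%:R) * t^-1 :> R.
    by rewrite aE natrM; field; rewrite !gt_eqF.
  rewrite normrM normfV (gtr0_norm tp) ler_piMl ?invr_ge0 ?(ltW tp) //.
  by rewrite ger0_norm ?divr_ge0 // ler_pdivrMr // mul1r ler_nat ltnW // ltn_mod.
have Nd0 : 0 < (N ^ d)%N%:R :> R by rewrite ltr0n expn_gt0 N0.
have -> : ratio B v t = ((N ^ d)%N%:R * (pcount B v t)%:R) / ((N ^ d)%N%:R * (total_count t)%:R).
  by rewrite -mulf_div divff ?gt_eqF // mul1r.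
have leE : 2 * E / ((N ^ d)%N%:R * (total_count t)%:R) <= cst (5 * c)%N%:R * (1 + 1) / t.
  apply: le_trans (boundary_error ht _ _ (box_size_le t1)) => //.
  rewrite -/o -/K [_^-1 in X in X <= _]invfM [X in X <= _]mulrA ler_pM2r ?invr_gt0 ?total_pos // ler_pdivrMr //.
  rewrite /E natrM exprMn natrX.
  have -> : t^-1 / (N%:R * t)^-1 = N%:R by field; rewrite !gt_eqF.
  have -> : N%:R ^+ d = N%:R * N%:R ^+ d.-1 :> R by rewrite -exprS prednK.
  have N1 : 1 <= N%:R :> R by rewrite ler1n.
  have -> : 2 * (#|I|%:R * (d%:R * (4 * (N%:R + 1)) * (K%:R ^+ d.-1 * N%:R ^+ d.-1))) =
    (2 * (#|I|%:R * (d%:R * 4 * (K%:R ^+ d.-1 * N%:R ^+ d.-1)))) * (N%:R + 1) :> R by ring.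
  have -> : 2 * (#|I|%:R * (d%:R * (4 * (1 + 1)) * K%:R ^+ d.-1)) * (N%:R * N%:R ^+ d.-1) =
    (2 * (#|I|%:R * (d%:R * 4 * (K%:R ^+ d.-1 * N%:R ^+ d.-1)))) * (N%:R + N%:R) :> R by ring.
  by rewrite ler_wpM2l ?lerD2l // !mulr_ge0 // exprn_ge0.
apply: le_trans leE; apply: ratio_diff.
- by rewrite mulr_gt0 // total_pos.
- exact: ler0n.
- by rewrite ler_nat pattern_count_le_total.
- exact: fine.
by rewrite -!(pattern_count_total _ v0); apply: fine.
Qed.

(** Same translates, grids of nearly equal mesh: the points with the same index are at distance
[O (t' - t) / t]. *)
Lemma ratio_dilate : exists2 C : R, 0 <= C & forall B v t t',
  guarded i0 B -> v i0 = 0 -> tmin <= t -> t <= t' -> t' <= 2 * t ->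
  `|ratio B v t - ratio B v t'| <= C * (t' - t + 1) / t.
Proof.
pose kap : R := 2 * (5 * c)%N%:R; have kap1 : 1 <= kap.
  have : 1 <= c%:R :> R by rewrite ler1n.
  by rewrite /kap natrM; lra.
exists (cst kap * kap); first by rewrite mulr_ge0 ?cst_ge0 //; lra.
move=> B v t t' gB v0 ht tt' t't; have [tp tv] := total_gt ht.
have ht' : tmin <= t' by apply: le_trans tt'.
have [tp' tv'] := total_gt ht'.
have t1 : 1 <= t' by apply: le_trans ht'.
set o := box_radius t'; set K := (2 * o).+1.
have hK : (2 * o < K)%N by [].
have co' : c%:R * t' <= o%:R by apply: box_radius_ge.
have co : c%:R * t <= o%:R by apply: le_trans co'; rewrite ler_pM2l // ltr0n.
have Kt' : K%:R <= (5 * c)%N%:R * t' by apply: box_size_le.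
have Kt : K%:R <= kap * t.
  by apply: le_trans Kt' _; rewrite /kap -mulrA mulrCA ler_wpM2l.
pose del : R := K%:R * (t^-1 - t'^-1).
have del0 : 0 <= del by rewrite mulr_ge0 // subr_ge0 lef_pV2 ?posrE.
set E := #|I|%:R * (d%:R * (4 * (del / t'^-1 + 1)) * K%:R ^+ d.-1).
have diff (B' : pred {ffun I -> bool}) : guarded i0 B' ->
    `|(pcount B' v t)%:R - (pcount B' v t')%:R| <= E.
  move=> gB'.
  rewrite (pattern_count_grid hc gB' v0 tp co hK) (pattern_count_grid hc gB' v0 tp' co' hK).
  rewrite distrC; apply: pattern_grid_diff => //; first by rewrite invr_gt0.
    by move=> k i j; apply: grid_spacing.
  move=> i k a; rewrite opprD addrACA subrr addr0 /grid -mulrBr normrM [X in _ * X]distrC.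
  rewrite [X in _ * X]ger0_norm ?subr_ge0 ?lef_pV2 ?posrE // ler_wpM2r ?subr_ge0 ?lef_pV2 ?posrE //.
  have : (a : nat)%:R <= K%:R :> R by rewrite ler_nat ltnW.
  have : o%:R <= K%:R :> R by rewrite ler_nat leqW // leq_pmull.
  have : 0 <= o%:R :> R by []. have : 0 <= (a : nat)%:R :> R by [].
  by rewrite ler_norml; lra.
have qE : del / t'^-1 = K%:R * (t' - t) / t.
  by rewrite /del; field; rewrite !gt_eqF.
have q0 : 0 <= del / t'^-1 by rewrite mulr_ge0 // invrK ltW.
apply: (@le_trans _ _ (2 * E / (total_count t)%:R)).
  apply: ratio_diff; rewrite ?total_pos ?ler0n ?ler_nat ?pattern_count_le_total //.
    exact: diff.
  by rewrite -!(pattern_count_total _ v0); apply: diff.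
apply: le_trans (boundary_error ht q0 _ Kt) _ => //.
rewrite ler_pM2r ?invr_gt0 // -mulrA ler_wpM2l ?cst_ge0 //; first lra.
by rewrite qE [kap * (_ + _)]mulrDr mulr1 lerD // ler_pdivrMr // [kap * _ * _]mulrAC ler_wpM2r // subr_ge0.
Qed.

(** Refine both grids until their meshes are nearly equal. *)
Lemma ratio_cauchy : exists2 C : R, 0 <= C & forall B v t t',
  guarded i0 B -> v i0 = 0 -> tmin <= t -> tmin <= t' ->
  `|ratio B v t - ratio B v t'| <= C * (t^-1 + t'^-1).
Proof.
have [C1 C10 refine] := ratio_refine; have [C2 C20 dilate] := ratio_dilate.
exists (C1 + 2 * C2); first by lra.
move=> B v t t' gB v0 ht ht'.
have [tp _] := total_gt ht; have [tp' _] := total_gt ht'.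
have t1 : 1 <= t by apply: le_trans ht.
(* N' is so large that the integer part N of N' t' / t is at least t; the scales N t and N' t'
   then differ by at most t. *)
pose N' := Num.bound (t * (t + 1) / t').
have hN' : t * (t + 1) / t' < N'%:R.
  by apply: archi_boundP; rewrite !mulr_ge0 ?invr_ge0 ?addr_ge0 ?ltW.
have N'0 : (0 < N')%N.
  by rewrite -(ltr_nat R); apply: le_lt_trans hN'; rewrite !mulr_ge0 ?invr_ge0 ?addr_ge0 ?ltW.
pose N := Num.truncn (N'%:R * t' / t).
have big : t + 1 < N'%:R * t' / t.
  by rewrite ltr_pdivlMr // mulrC -ltr_pdivrMr.
have /andP[N1 N2] : N%:R <= N'%:R * t' / t < N.+1%:R by apply: truncn_itv; lra.
rewrite -natr1 in N2.
have Nt : t <= N%:R by lra.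
have N0 : (0 < N)%N by rewrite -(ltr_nat R); apply: lt_le_trans Nt.
have hT : N%:R * t <= N'%:R * t' by rewrite -ler_pdivlMr.
have hT' : N'%:R * t' < N%:R * t + t by move: N2; rewrite ltr_pdivrMr // mulrDl mul1r.
have NR1 : 1 <= N%:R :> R by apply: le_trans Nt.
have tT : t <= N%:R * t by rewrite ler_peMl // ltW.
have h1 := refine B v t N gB v0 ht N0.
have h2 := refine B v t' N' gB v0 ht' N'0.
have h3 : `|ratio B v (N%:R * t) - ratio B v (N'%:R * t')| <= C2 * (2 * t^-1).
  apply: le_trans (dilate B v _ _ gB v0 (le_trans ht tT) hT _) _; first by lra.
  rewrite -mulrA ler_wpM2l // ler_pdivrMr ?mulr_gt0 ?(lt_le_trans tp) //.
  have -> : 2 * t^-1 * (N%:R * t) = 2 * N%:R by field; rewrite gt_eqF.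
  by lra.
have tri : forall a b c e : R, `|a - b| <= `|a - c| + `|c - e| + `|b - e|.
  move=> a b c' e'; have -> : a - b = (a - c') + (c' - e') - (b - e') by ring.
  by apply: le_trans (ler_normB _ _) _; rewrite lerD2r ler_normD.
apply: le_trans (tri _ _ (ratio B v (N%:R * t)) (ratio B v (N'%:R * t'))) _.
apply: le_trans (lerD (lerD h1 h3) h2) _; rewrite -subr_ge0.
have -> : (C1 + 2 * C2) * (t^-1 + t'^-1) - (C1 * t^-1 + C2 * (2 * t^-1) + C1 * t'^-1) =
  2 * (C2 * t'^-1) by ring.
by rewrite !mulr_ge0 // invr_ge0 ltW.
Qed.

(** The limit [H B v] is the normalised volume of the set of points of [A] that show the pattern.
The estimate of [ratio_cauchy] makes it a supremum and gives the rate of convergence. *)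
Lemma ratio_limit : exists C T : R, exists H : pred {ffun I -> bool} -> (I -> 'rV[R]_d) -> R,
  [/\ 0 <= C, 1 <= T, forall t, T <= t -> T^-1 ^+ d * t ^+ d <= (total_count t)%:R,
   forall B v t, guarded i0 B -> v i0 = 0 -> T <= t -> `|ratio B v t - H B v| <= C / t &
   forall B v v' t delta, guarded i0 B -> v i0 = 0 -> v' i0 = 0 -> T <= t -> 0 <= delta ->
     (forall i k, `|v i 0 k - v' i 0 k| <= delta) ->
     `|ratio B v t - ratio B v' t| <= C * (delta + t^-1)].
Proof.
have [C1 C10 cauchy] := ratio_cauchy; have [C2 C20 shift] := ratio_shift.
have [H hH] : exists H : pred {ffun I -> bool} -> (I -> 'rV[R]_d) -> R, forall B v t,
    guarded i0 B -> v i0 = 0 -> tmin <= t -> `|ratio B v t - H B v| <= C1 / t.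
  exists (fun B v => sup [set ratio B v t - C1 / t | t in [set t | tmin <= t]]).
  move=> B v t gB v0 ht; set S := [set _ | _ in _].
  have ub t' : tmin <= t' -> ubound S (ratio B v t' + C1 / t').
    move=> ht' _ [s hs <-]; have := cauchy B v s t' gB v0 hs ht'.
    by rewrite ler_norml mulrDr; lra.
  have S0 : S !=set0 by exists (ratio B v t - C1 / t), t.
  have h1 : ratio B v t - C1 / t <= sup S.
    by apply: ub_le_sup; [exists (ratio B v t + C1 / t); apply: ub | exists t].
  have h2 : sup S <= ratio B v t + C1 / t by apply: ge_sup => //; apply: ub.
  by rewrite ler_norml; lra.
exists (C1 + C2), tmin, H; split=> //; first lra.
- move=> t ht; have [tp tv] := total_gt ht; apply: le_trans tv.
  rewrite ler_wpM2r ?exprn_ge0 ?(ltW tp) //; apply: lerXn2r; rewrite ?nnegrE ?divr_ge0 ?(ltW rho0) //.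
    by rewrite invr_ge0 (le_trans ler01 tmin_ge1).
  rewrite -[rho / 2]invrK lef_pV2 ?posrE ?invr_gt0 ?divr_gt0 ?(lt_le_trans ltr01 tmin_ge1) //.
  by rewrite invf_div lerDr.
- move=> B v t gB v0 ht; apply: le_trans (hH B v t gB v0 ht) _.
  by have [tp _] := total_gt ht; rewrite ler_pM2r ?invr_gt0 // lerDl.
move=> B v v' t delta gB v0 v'0 ht delta0 hv.
apply: le_trans (shift B v v' t delta gB v0 v'0 ht delta0 hv) _.
have [tp _] := total_gt ht; rewrite ler_wpM2r ?lerDr // addr_ge0 // invr_ge0 ltW //.
Qed.

End Limit.

Lemma le_of_le_inv (R : realType) (x y C T : R) :
  (forall t, T <= t -> x <= y + C / t) -> x <= y.
Proof.
move=> h; rewrite leNgt; apply/negP => yx.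
have xy0 : 0 < x - y by rewrite subr_gt0.
pose t := `|T| + 1 + `|C| / (x - y).
have Cge : 0 <= `|C| / (x - y) by rewrite divr_ge0 // ltW.
have tp : 0 < t by rewrite /t; have := normr_ge0 T; lra.
have Tt : T <= t by rewrite /t; have := ler_norm T; lra.
have := h t Tt; rewrite -lerBlDl ler_pdivlMr //.
have : (x - y) * (`|C| / (x - y)) = `|C| by rewrite mulrC divfK ?gt_eqF.
have := ler_norm C; rewrite /t; move: Cge; set q := _ / _ => q0 Cn hq.
have := normr_ge0 T; nra.
Qed.

(** Inequalities between proportions pass to the limit; the hypotheses below are the conclusions of
[ratio_limit]. *)

Section LimitProperties.
Variables (R : realType) (d : nat) (A : set 'rV[R]_d) (I : finType) (i0 : I).
Variables (C T : R) (H : pred {ffun I -> bool} -> (I -> 'rV[R]_d) -> R).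
Hypotheses (C0 : 0 <= C) (T1 : 1 <= T).
Hypothesis tot : forall t, T <= t -> T^-1 ^+ d * t ^+ d <= (total_count A i0 t)%:R.
Hypothesis lim : forall B (v : I -> 'rV[R]_d) (t : R), guarded i0 B -> v i0 = 0 -> T <= t ->
  `|ratio A i0 B v t - H B v| <= C / t.
Hypothesis shift : forall B (v v' : I -> 'rV[R]_d) (t delta : R), guarded i0 B -> v i0 = 0 -> v' i0 = 0 ->
  T <= t -> 0 <= delta -> (forall i k, `|v i 0 k - v' i 0 k| <= delta) ->
  `|ratio A i0 B v t - ratio A i0 B v' t| <= C * (delta + t^-1).

Lemma frequency_lipschitz B (v v' : I -> 'rV[R]_d) (delta : R) : guarded i0 B -> v i0 = 0 -> v' i0 = 0 ->
  0 <= delta -> (forall i k, `|v i 0 k - v' i 0 k| <= delta) ->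
  `|H B v - H B v'| <= C * delta.
Proof.
move=> gB v0 v'0 d0 hv; apply: (@le_of_le_inv _ _ _ (3 * C) T) => t Tt.
have h1 := lim gB v0 Tt; have h2 := lim gB v'0 Tt; have h3 := shift gB v0 v'0 Tt d0 hv.
have tri : forall a b c e : R, `|a - b| <= `|c - a| + `|c - e| + `|e - b|.
  move=> a b c' e'; have -> : a - b = - (c' - a) + (c' - e') + (e' - b) by ring.
  apply: le_trans (ler_normD _ _) _; rewrite lerD2r; apply: le_trans (ler_normD _ _) _.
  by rewrite normrN.
apply: le_trans (tri _ _ (ratio A i0 B v t) (ratio A i0 B v' t)) _; lra.
Qed.

Lemma frequency_ge0 B (v : I -> 'rV[R]_d) : guarded i0 B -> v i0 = 0 -> 0 <= H B v.
Proof.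
move=> gB v0; apply: (@le_of_le_inv _ _ _ C T) => t Tt.
have := lim gB v0 Tt; have : 0 <= ratio A i0 B v t by rewrite divr_ge0.
by rewrite ler_norml; lra.
Qed.

Lemma frequency_sum (W : finType) (B : W -> pred {ffun I -> bool}) (v : I -> 'rV[R]_d) :
  (forall w, guarded i0 (B w)) -> v i0 = 0 ->
  (forall t, T <= t -> (\sum_w pattern_count A (B w) v t = total_count A i0 t)%N) ->
  \sum_w H (B w) v = 1.
Proof.
move=> gB v0 hsum.
have key t : T <= t -> `|1 - \sum_w H (B w) v| <= (#|W|%:R * C) / t.
  move=> Tt; have tp : 0 < t by apply: lt_le_trans Tt; apply: lt_le_trans T1.
  have Tp : 0 < (total_count A i0 t)%:R :> R.
    apply: lt_le_trans (tot Tt); have T0 : 0 < T by apply: lt_le_trans T1.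
    by rewrite mulr_gt0 // exprn_gt0 // invr_gt0.
  have rsum : \sum_w ratio A i0 (B w) v t = 1.
    by rewrite /ratio -mulr_suml -natr_sum hsum // divff // gt_eqF.
  rewrite -[X in `|X - _|]rsum -sumrB; apply: le_trans (ler_norm_sum _ _ _) _.
  have -> : #|W|%:R * C / t = \sum_(w : W) (C / t).
    by rewrite sumr_const mulr_natl mulrnAl.
  by apply: ler_sum => w _; apply: lim.
apply/le_anti/andP; split.
  apply: (@le_of_le_inv _ _ _ (#|W|%:R * C) T) => t /key.
  by rewrite ler_norml; lra.
apply: (@le_of_le_inv _ _ _ (#|W|%:R * C) T) => t /key.
by rewrite ler_norml; lra.
Qed.

End LimitProperties.

(** * First returns and words *)

Section FirstReturn.
Variables (V : zmodType) (R : realDomainType) (J : nat) (s : 'I_J -> V) (len : V -> R).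
Variable j0 : 'I_J.
Implicit Type (mem : V -> bool).

(** The steps are ordered by [len]. The default [j0] makes the words of steps a partition even when
no step leads back into [mem]. *)
Definition next_step mem (x : V) : 'I_J :=
  odflt j0 [pick j | mem (x + s j) &&
    [forall j', mem (x + s j') ==> (len (s j) <= len (s j'))]].

Definition return_path mem (n : nat) : V := iter n (fun x => x + s (next_step mem x)) 0.

Definition return_word (l : nat) mem : l.+1.-tuple 'I_J :=
  [tuple next_step mem (return_path mem n) | n < l.+1].

(** All the positions that the first [n] returns from [0] may visit, whatever the set. *)
Fixpoint step_sums (n : nat) : seq V :=
  if n is n'.+1 then step_sums n' ++ [seq x + s j | x <- step_sums n', j <- enum 'I_J]
  else [:: 0].

Lemma step_sums0 n : 0 \in step_sums n.
Proof. by elim: n => [|n IH]; rewrite ?mem_head // mem_cat IH. Qed.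

Lemma step_sumsS n x : x \in step_sums n -> x \in step_sums n.+1.
Proof. by move=> h; rewrite mem_cat h. Qed.

Lemma step_sums_add n x j : x \in step_sums n -> x + s j \in step_sums n.+1.
Proof.
by move=> h; rewrite mem_cat; apply/orP; right; apply/allpairsP; exists (x, j); rewrite /= mem_enum.
Qed.

Lemma step_sums_le n m x : (n <= m)%N -> x \in step_sums n -> x \in step_sums m.
Proof.
by move/subnK <-; elim: (m - n)%N => [//|k IH] h; apply/step_sumsS/IH.
Qed.

Lemma return_path_sums mem n : return_path mem n \in step_sums n.
Proof. by elim: n => [|n IH]; rewrite ?mem_head //; apply: step_sums_add. Qed.

Lemma eq_next_step mem mem' x : (forall j, mem (x + s j) = mem' (x + s j)) ->
  next_step mem x = next_step mem' x.
Proof.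
move=> h; congr odflt; apply: eq_pick => j; rewrite h; congr (_ && _).
by apply: eq_forallb => j'; rewrite h.
Qed.

(** A word of length [l + 1] depends on finitely many membership questions only. *)
Lemma eq_return_word l mem mem' : {in step_sums l.+1, mem =1 mem'} ->
  return_word l mem = return_word l mem'.
Proof.
move=> h; have step n x : (n <= l)%N -> x \in step_sums n -> next_step mem x = next_step mem' x.
  move=> nl hx; apply: eq_next_step => j; apply: h.
  by apply: (@step_sums_le n.+1) => //; apply: step_sums_add.
have path n : (n <= l)%N -> return_path mem n = return_path mem' n.
  elim: n => [//|n IH] nl; rewrite /return_path !iterS -!/(return_path _ n) (IH (ltnW nl)).
  by rewrite (step n) ?(ltnW nl) // return_path_sums.
apply: eq_mktuple => n; have nl : (n <= l)%N by rewrite -ltnS.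
by rewrite /= -(path _ nl); apply: (step n) => //; apply: return_path_sums.
Qed.

Lemma next_step_eq mem x j : injective (len \o s) -> mem (x + s j) ->
  (forall j', mem (x + s j') -> len (s j) <= len (s j')) -> next_step mem x = j.
Proof.
move=> inj mj minj; rewrite /next_step; case: pickP => [k /andP[mk /forallP mink]|/(_ j)] /=.
  by apply: inj; apply/le_anti; rewrite /= minj // andbT; apply: (implyP (mink j)).
by rewrite mj => /forallP[] j'; apply/implyP/minj.
Qed.

Definition shift_type (l : nat) := seq_sub (step_sums l.+1).

Definition shift0 (l : nat) : shift_type l := SeqSub (step_sums0 l.+1).

(** The word expressed through the finitely many memberships on which it depends, as a pattern whose
occurrences can be counted. *)
Definition reads_word (l : nat) (w : l.+1.-tuple 'I_J) (g : {ffun shift_type l -> bool}) : bool :=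
  g (shift0 l) && (return_word l (fun x => oapp g false (insub x)) == w).

Lemma reads_word_guarded l w : guarded (shift0 l) (@reads_word l w).
Proof. by move=> g /andP[]. Qed.

Lemma reads_wordE l w (f : V -> bool) :
  @reads_word l w [ffun i => f (val i)] = f 0 && (return_word l f == w).
Proof.
rewrite /reads_word ffunE; congr (_ && (_ == w)); apply: eq_return_word => x hx.
by rewrite insubT /= ffunE.
Qed.

Lemma sum_reads_word l (g : {ffun shift_type l -> bool}) :
  (\sum_w reads_word w g = g (shift0 l))%N.
Proof.
rewrite /reads_word; case: (g _) => /=; last by rewrite big1.
rewrite (bigD1 (return_word l (fun x => oapp g false (insub x)))) //= eqxx big1 => [|w].
  by rewrite addn0.
by rewrite eq_sym => /negbTE ->.
Qed.

End FirstReturn.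

(** * Points in increasing order *)

Section OrderedPoints.
Variables (R : realType) (T : choiceType) (f : T -> R) (M : {fset T}).
Hypothesis f_inj : injective f.

Definition ordered_points : seq T := sort (relpre f <=%R) M.

Lemma sort_values : sort <=%R [seq f m | m <- M] = [seq f m | m <- ordered_points].
Proof. by rewrite sort_map. Qed.

Lemma mem_ordered_points m : (m \in ordered_points) = (m \in M).
Proof. by rewrite mem_sort. Qed.

Lemma size_ordered_points : size ordered_points = #|` M|%fset.
Proof. by rewrite size_sort. Qed.

Lemma ordered_points_lt x0 i j : (i < j < size ordered_points)%N ->
  f (nth x0 ordered_points i) < f (nth x0 ordered_points j).
Proof.
move=> /andP[ij js].
have us : uniq ordered_points by rewrite sort_uniq fset_uniq.
have tr : transitive (relpre f <=%R) by move=> a b c; apply: le_trans.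
have tot : total (relpre f <=%R) by move=> a b; apply: le_total.
have := sorted_leq_nth tr _ x0 (sort_sorted tot M).
move=> /(_ (fun a => lexx _) i j); rewrite !inE -/ordered_points js (ltn_trans ij js) (ltnW ij).
move=> /(_ isT isT isT) /= h; rewrite lt_neqAle h andbT (inj_eq f_inj) nth_uniq ?(ltn_trans ij) //.
by rewrite neq_ltn ij.
Qed.

Lemma ordered_points_next x0 i x : (i.+1 < size ordered_points)%N -> x \in M ->
  f (nth x0 ordered_points i) < f x -> f (nth x0 ordered_points i.+1) <= f x.
Proof.
move=> hi; rewrite -mem_ordered_points => xM.
rewrite -{1 2}(nth_index x0 xM) => h; set k := index x _ in h *.
have ks : (k < size ordered_points)%N by rewrite index_mem.
have ik : (i < k)%N.
  rewrite ltnNge; apply/negP; rewrite leq_eqVlt => /orP[/eqP ki|ki].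
    by rewrite ki ltxx in h.
  have := @ordered_points_lt x0 k i; rewrite ki (ltnW hi) => /(_ isT) h'.
  by have := lt_trans h h'; rewrite ltxx.
move: ik; rewrite leq_eqVlt => /orP[/eqP -> //|ik].
by apply/ltW/ordered_points_lt; rewrite ik.
Qed.

(** Words are read only from the first [ell - l - 1] points; the others contribute at most [l + 1]. *)
Lemma count_first_points (P : pred T) x0 (l : nat) :
  let n := (#|` M|%fset - l - 1)%N in
  let c := count (fun i => P (nth x0 ordered_points i.-1)) (iota 1 n) in
  (c <= count P M)%N /\ (count P M <= c + l.+1)%N.
Proof.
move=> n c.
have -> : c = count P (take n ordered_points).
  rewrite /c -{1}(mkseq_nth x0 (take n ordered_points)) count_map.
  have -> : size (take n ordered_points) = n.
    by rewrite size_takel // size_ordered_points /n -subnDA leq_subr.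
  rewrite (iotaDl 1 0) count_map; apply: eq_in_count => i; rewrite mem_iota /= add0n => hi.
  by rewrite /= nth_take.
have -> : count P M = count P ordered_points by apply/esym/permP; rewrite perm_sort.
rewrite -[in count P ordered_points](cat_take_drop n ordered_points) count_cat leq_addr leq_add2l; split=> //.
apply: leq_trans (count_size _ _) _; rewrite size_drop size_ordered_points /n.
by rewrite -subnDA addn1 leq_subLR addnC -leq_subLR.
Qed.

End OrderedPoints.

(** * Gaps *)

Lemma lattice_pointsE (R : realType) (d : nat) (A : set 'rV[R]_d) (t : R) (m : 'rV[int]_d) :
  0 < t -> lattice_points A t m <-> A (t^-1 *: map_mx intr m).
Proof.
move=> t0; split=> [[v Av <-]|Am]; first by rewrite scalerA mulVf ?gt_eqF // scale1r.
by exists (t^-1 *: map_mx intr m) => //; rewrite scalerA divff ?gt_eqF // scale1r.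
Qed.

Section Gaps.
Variables (R : realType) (L : fieldExtType rat) (iota : {rmorphism L -> R}).
Variables (d : nat) (e : d.+1.-tuple L).
Hypotheses (he : basis_of {:L} e) (he0 : e`_0 = 1).
Variable sg : 'I_d.+1 -> {rmorphism L -> R[i]}.
Hypothesis hE : embed_mx e sg \in unitmx.
Variable j0 : 'I_d.+1.
Hypothesis hj0 : forall x, sg j0 x = ((iota x)%:C)%C.
Variables (A : set 'rV[R]_d) (c : nat) (p : 'rV[R]_d) (rho : R).
Hypotheses (hc : forall x, A x -> forall i, `|x 0 i| <= c%:R).
Hypotheses (rho0 : 0 < rho)
  (hrho : forall x : 'rV[R]_d, (forall i, `|x 0 i - p 0 i| <= rho) -> A x).
Variables (w : R -> L) (Cw : R).
Hypotheses (hwu : forall t, order_unit e (w t)) (hw0 : forall t, 0 < iota (w t)) (Cw1 : 1 <= Cw).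
Hypothesis hwj : forall t j, 0 < t -> j != j0 ->
  t <= Cw * absval sg j (w t) /\ absval sg j (w t) <= Cw * t.
Hypothesis hwi : forall t, 0 < t ->
  1 <= Cw * (iota (w t) * t ^+ d) /\ iota (w t) * t ^+ d <= Cw.

Local Notation lattice := (in_lattice e).
Local Notation place := (absval sg).
Local Notation slope := (slope iota e).
Local Notation lift_of := (lattice_lift iota e).
Local Notation value m := (fract (dotz m slope)).

Lemma in_lattice_unit t x : lattice x -> lattice (w t * x).
Proof. by have [_ h _] := hwu t; apply: h. Qed.

Lemma place_unit_mul t j x : 1 <= t -> place j (w t * x) <= Cw * t * place j x.
Proof.
have C1 := Cw1; move=> t1; have t0 : 0 < t by lra.
rewrite placeM ler_wpM2r ?place_ge0 //; have [->|jj0] := eqVneq j j0; last by case: (hwj t0 jj0).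
rewrite (place_j0 hj0) gtr0_norm //; have [_ h] := hwi t0.
apply: (@le_trans _ _ Cw); last by rewrite ler_peMr //; lra.
by apply: le_trans h; rewrite ler_peMr ?exprn_ege1 // ltW.
Qed.

Lemma coord_unit_mul : exists2 B : R, 0 < B & forall t (k l : 'I_d.+1), 1 <= t ->
  `|ratr (coord e l (w t * e`_k))| <= B * t.
Proof.
have C1 := Cw1; have [C C0 hC] := coord_le_place he hE.
pose P := \sum_j \sum_(k < d.+1) place j e`_k.
have P0 : 0 <= P by do 2![apply: sumr_ge0 => ? _]; apply: place_ge0.
exists (C * (Cw * (1 + P))); first by rewrite !mulr_gt0 //; lra.
move=> t k l t1; rewrite -mulrA; apply: hC => j; apply: le_trans (place_unit_mul _ _ t1) _.
rewrite -[X in _ <= X]mulrA [X in _ <= Cw * X]mulrC mulrA ler_wpM2l //; first by rewrite mulr_ge0 //; lra.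
have h1 : place j e`_k <= \sum_(k < d.+1) place j e`_k.
  by apply: (@big_le_max_sum R _ (fun k : 'I_d.+1 => place j e`_k)) => i; apply: place_ge0.
have h2 : \sum_(k < d.+1) place j e`_k <= P.
  apply: (@big_le_max_sum R _ (fun j => \sum_(k < d.+1) place j e`_k)) => i.
  by apply: sumr_ge0 => ? _; apply: place_ge0.
lra.
Qed.

(** The lattice is spanned by the products of the basis with any unit; choosing a unit of size
slightly below [t] gives a basis that is short compared with [t] and small in the real
embedding, so rounding a target vector in this basis hits any small ball. *)
Lemma lattice_covering : exists C T : R, [/\ 0 <= C, 1 <= T & forall t m, T <= t ->
  A (t^-1 *: map_mx intr m) -> exists x, [/\ lattice x, 0 < iota x, iota x * t ^+ d <= C &
    A (t^-1 *: map_mx intr (m + int_coords e x))]].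
Proof.
have C1 := Cw1; have [B B0 hB] := coord_unit_mul.
(* Rounding moves a point by at most d + 1 basis vectors of length B * kap * t. *)
pose kap := rho / (d.+1%:R * B).
have dB0 : 0 < d.+1%:R * B by rewrite mulr_gt0 ?ltr0n.
have kap0 : 0 < kap by rewrite divr_gt0.
pose S := \sum_(k < d.+1) `|iota e`_k|.
have S1 : 1 <= S.
  by rewrite /S (bigD1 ord0) //= he0 rmorph1 normr1 lerDl sumr_ge0.
exists (3 * (Cw * S) * kap^-1 ^+ d), (1 + kap^-1); split.
- by rewrite !mulr_ge0 ?exprn_ge0 ?invr_ge0 ?(ltW kap0) //; lra.
- by rewrite lerDl invr_ge0 ltW.
move=> t m Tt Am; have t1 : 1 <= t by apply: le_trans Tt; rewrite lerDl invr_ge0 ltW.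
have t0 : 0 < t by lra.
pose t' := kap * t.
have t'1 : 1 <= t'.
  by rewrite /t' -(ler_pM2l (_ : 0 < kap^-1)) ?invr_gt0 // mulKf ?gt_eqF // mulr1; lra.
have t'0 : 0 < t' by lra.
set u := w t'.
pose M : 'M[R]_d.+1 := map_mx ratr (mul_mx e u).
have Mu : M \in unitmx.
  rewrite unitmxE det_map_mx unitfE fmorph_eq0.
  by apply: (field_norm_neq0 he); have [] := hwu t'.
pose tau i := t * p 0 i - (m 0 i)%:~R.
(* Aiming at twice the rounding error keeps the real value positive. *)
pose a := 2 * (iota u * S).
pose X : 'rV[R]_d.+1 := \row_k (if unlift ord0 k is Some i then tau i else a - \sum_i tau i * slope i).
pose xi := X *m invmx M.
have xiM : xi *m M = X by rewrite mulmxKV.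
have XE : \sum_(l < d.+1) X 0 l * iota e`_l = a.
  rewrite big_ord_recl mxE unlift_none he0 rmorph1 mulr1.
  by rewrite [X in _ + X](eq_bigr (fun i => tau i * slope i)) ?subrK // => i _; rewrite mxE liftK.
have uE (k : 'I_d.+1) : \sum_(l < d.+1) M k l * iota e`_l = iota u * iota e`_k.
  rewrite -rmorphM (mul_mx_sum he u k) rmorph_sum; apply: eq_bigr => l _.
  by rewrite !mxE morph_ratZ.
have xE : \sum_(k < d.+1) xi 0 k * (iota u * iota e`_k) = a.
  rewrite -XE -xiM; under [RHS]eq_bigr => l _ do rewrite mxE mulr_suml.
  rewrite exchange_big; apply: eq_bigr => k _; rewrite -uE mulr_sumr.
  by apply: eq_bigr => l _; rewrite mulrA.
pose x := \sum_k (Num.floor (xi 0 k))%:~R *: (u * e`_k).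
have fr k : 0 <= xi 0 k - (Num.floor (xi 0 k))%:~R <= 1.
  by have := fract_itv (xi 0 k); rewrite /fract; lra.
have lx : lattice x.
  by apply: in_lattice_sum => k; [rewrite rpred_int | apply: in_lattice_unit; apply: in_lattice_e].
have cx l : `|X 0 l - ratr (coord e l x)| <= d.+1%:R * (B * t').
  have -> : X 0 l - ratr (coord e l x) = \sum_k (xi 0 k - (Num.floor (xi 0 k))%:~R) * M k l.
    rewrite -xiM mxE linear_sum rmorph_sum -sumrB; apply: eq_bigr => k _.
    have Mkl : M k l = ratr (coord e l (u * e`_k)) by rewrite !mxE.
    by rewrite mulrBl /= coord_scale rmorphM /= ratr_int -Mkl.
  apply: le_trans (ler_norm_sum _ _ _) _.
  rewrite -[X in X%:R * _](card_ord d.+1) mulr_natl -sumr_const; apply: ler_sum => k _.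
  rewrite normrM; have /andP[f0 f1] := fr k; rewrite (ger0_norm f0).
  apply: (@le_trans _ _ `|M k l|); first by rewrite ler_piMl.
  by rewrite !mxE; apply: hB.
have ix : `|a - iota x| <= iota u * S.
  have -> : a - iota x = \sum_k (xi 0 k - (Num.floor (xi 0 k))%:~R) * (iota u * iota e`_k).
    rewrite -{1}xE rmorph_sum -sumrB; apply: eq_bigr => k _.
    by rewrite mulrBl morph_ratZ ratr_int rmorphM.
  apply: le_trans (ler_norm_sum _ _ _) _; rewrite mulr_sumr; apply: ler_sum => k _.
  rewrite normrM; have /andP[f0 f1] := fr k; rewrite (ger0_norm f0).
  by rewrite normrM (gtr0_norm (hw0 _)) ler_piMl // mulr_ge0 // ltW // hw0.
have uS0 : 0 < iota u * S by rewrite mulr_gt0 ?hw0 //; lra.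
have [ix1 ix2] : iota u * S <= iota x /\ iota x <= 3 * (iota u * S).
  by move: ix; rewrite /a ler_norml; lra.
exists x; split=> //; first lra.
  have [_ hu] := hwi t'0.
  apply: (@le_trans _ _ (3 * (iota u * S) * t ^+ d)); first by rewrite ler_wpM2r // exprn_ge0 // ltW.
  have -> : t ^+ d = kap^-1 ^+ d * t' ^+ d by rewrite -exprMn /t' mulKf ?gt_eqF.
  have -> : 3 * (iota u * S) * (kap^-1 ^+ d * t' ^+ d) = (iota u * t' ^+ d) * (3 * S * kap^-1 ^+ d) by ring.
  have -> : 3 * (Cw * S) * kap^-1 ^+ d = Cw * (3 * S * kap^-1 ^+ d) by ring.
  by rewrite ler_wpM2r // !mulr_ge0 ?exprn_ge0 ?invr_ge0 ?(ltW kap0) //; lra.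
apply: hrho => i.
have -> : (t^-1 *: map_mx intr (m + int_coords e x)) 0 i =
  t^-1 * ((m 0 i)%:~R + (int_coords e x 0 i)%:~R) by rewrite mxE mxE mxE intrD.
have -> : t^-1 * ((m 0 i)%:~R + (int_coords e x 0 i)%:~R) - p 0 i =
  (ratr (coord e (lift ord0 i) x) - tau i) / t.
  rewrite -(coord_int_coords i lx) ratr_int /tau; field; by rewrite gt_eqF.
rewrite normrM normfV (gtr0_norm t0) ler_pdivrMr // distrC.
have := cx (lift ord0 i); rewrite mxE liftK => /le_trans; apply.
rewrite /t' /kap.
have -> : d.+1%:R * (B * (rho / (d.+1%:R * B) * t)) = rho * t.
  by field; rewrite gt_eqF //= pnatr_eq0.
by rewrite lexx.
Qed.

(** For large [t] a longer gap would contain the point provided by [lattice_covering]; for bounded [t]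
it suffices that gaps are shorter than one. *)
Lemma gap_upper_bound : exists2 G : R, 0 <= G & forall t m m', 1 <= t ->
  A (t^-1 *: map_mx intr m) ->
  (forall x, A (t^-1 *: map_mx intr x) -> value m < value x -> value m' <= value x) ->
  (value m' - value m) * t ^+ d <= G.
Proof.
have [C [T [C0 T1 cover]]] := lattice_covering.
exists (C + T ^+ d); first by rewrite addr_ge0 // exprn_ge0 //; lra.
move=> t m m' t1 Am next; have t0 : 0 < t by lra.
have td0 : 0 < t ^+ d by rewrite exprn_gt0.
have /andP[v0 v1] := fract_itv (dotz m slope); have /andP[v0' v1'] := fract_itv (dotz m' slope).
have [Tt|tT] := leP T t; last first.
  apply: (@le_trans _ _ (T ^+ d)); last by rewrite lerDr.
  apply: (@le_trans _ _ (t ^+ d)); first by rewrite ler_piMl ?(ltW td0) //; lra.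
  by apply: lerXn2r; rewrite ?nnegrE ?(ltW t0) ?(ltW tT) //; lra.
apply: (@le_trans _ _ C); last by rewrite lerDl exprn_ge0 //; lra.
rewrite leNgt; apply/negP => big.
have [x [lx ix0 ixC Ax]] := cover t m Tt Am.
have xlt : iota x < value m' - value m by rewrite -(ltr_pM2r td0); apply: le_lt_trans big.
have lm : lattice (lift_of m) by apply: in_lattice_lift.
have ly : lattice (lift_of m + x).
  by move=> k; rewrite linearD rpredD ?lm ?lx.
have yE : iota (lift_of m + x) = value m + iota x by rewrite rmorphD iota_lattice_lift.
have /(lattice_lift_coords he he0 ly) : 0 <= iota (lift_of m + x) < 1 by rewrite yE; lra.
rewrite int_coordsD // int_coords_lift // => hy.
have vE : value (m + int_coords e x) = value m + iota x.
  by rewrite -(iota_lattice_lift iota he0) hy yE.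
have := next _ Ax; rewrite vE ltrDl ix0 => /(_ isT); lra.
Qed.

(** A gap is the real value of a lattice element with conjugates [O (t)], so dividing by the unit
leaves bounded conjugates; at the real place this uses [gap_upper_bound]. *)
Lemma rescaled_gap_bounded : exists N : nat, forall t m m', 1 <= t ->
  A (t^-1 *: map_mx intr m) -> A (t^-1 *: map_mx intr m') -> value m < value m' ->
  (forall x, A (t^-1 *: map_mx intr x) -> value m < value x -> value m' <= value x) ->
  let s := (w t)^-1 * (lift_of m' - lift_of m) in
  [/\ lattice s, 0 < iota s & forall k, `|ratr (coord e k s)| <= N%:R :> R].
Proof.
have C1 := Cw1; have [G G0 hG] := gap_upper_bound.
have [C C0 hC] := coord_le_place he hE; have [C' C'0 hC'] := place_le_coord he sg.
pose S := \sum_i `|slope i|; have S0 : 0 <= S by apply: sumr_ge0.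
pose H := 2 * c%:R * (1 + S) + 1; have H0 : 0 <= H by rewrite addr_ge0 // !mulr_ge0 // addr_ge0.
pose Q := Cw * G + Cw * (C' * H).
have Q0 : 0 <= Q by rewrite addr_ge0 // !mulr_ge0 ?(ltW C'0) //; lra.
exists (Num.bound (C * Q)) => t m m' t1 Am Am' mm' next s.
have t0 : 0 < t by lra.
have [w0 _ ow'] := hwu t.
have ld : lattice (lift_of m' - lift_of m) by apply: in_latticeB; apply: in_lattice_lift.
have iE : iota s = (iota (w t))^-1 * (value m' - value m).
  by rewrite rmorphM fmorphV rmorphB !iota_lattice_lift.
have s0 : 0 < iota s by rewrite iE mulr_gt0 ?invr_gt0 ?hw0 // subr_gt0.
split=> //; first exact: ow'.
have bndA x : A (t^-1 *: map_mx intr x) -> forall i, `|(x 0 i)%:~R| <= c%:R * t :> R.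
  move=> Ax i; have := hc Ax i; rewrite mxE mxE normrM normfV (gtr0_norm t0) mulrC.
  by rewrite ler_pdivrMr.
have dm i : `|(m' 0 i)%:~R - (m 0 i)%:~R| <= 2 * c%:R * t :> R.
  apply: le_trans (ler_normB _ _) _.
  by have := bndA m Am i; have := bndA m' Am' i; lra.
have ct0 : 0 <= 2 * c%:R * t :> R by rewrite !mulr_ge0 // ltW.
have HtE : H * t = 2 * c%:R * t + 2 * c%:R * t * S + t by rewrite /H; ring.
have ctS : 0 <= 2 * c%:R * t * S by rewrite mulr_ge0.
have hd k : `|ratr (coord e k (lift_of m' - lift_of m))| <= H * t.
  rewrite linearB rmorphB /=; case: (unliftP ord0 k) => [i ->|->].
    by rewrite !coord_lattice_lift // !ratr_int HtE; apply: le_trans (dm i) _; lra.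
  rewrite !coord0_lattice_lift // !rmorphN /= !ratr_int.
  have hdz : `|dotz m' slope - dotz m slope| <= 2 * c%:R * t * S.
    rewrite /dotz -sumrB /S mulr_sumr; apply: le_trans (ler_norm_sum _ _ _) _.
    by apply: ler_sum => i _; rewrite -mulrBl normrM ler_wpM2r.
  have := fract_itv (dotz m slope); have := fract_itv (dotz m' slope); rewrite /fract.
  move: hdz; rewrite HtE !ler_norml.
  by set a := _%:~R; set b := _%:~R; lra.
move=> k; apply: le_trans (ltW (archi_boundP (mulr_ge0 (ltW C0) Q0))).
apply: hC => j; have [->|jj0] := eqVneq j j0.
  rewrite (place_j0 hj0) gtr0_norm // iE mulrC ler_pdivrMr ?hw0 //.
  have h := hG t m m' t1 Am next; have [h1 _] := hwi t0.
  have td0 : 0 < t ^+ d by rewrite exprn_gt0.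
  rewrite -(ler_pM2r td0); apply: (le_trans h).
  apply: (@le_trans _ _ (G * (Cw * (iota (w t) * t ^+ d)))); first by rewrite ler_peMr.
  have -> : G * (Cw * (iota (w t) * t ^+ d)) = (Cw * G) * (iota (w t) * t ^+ d) by ring.
  rewrite -[X in _ <= X]mulrA ler_wpM2r //; first by rewrite mulr_ge0 ?(ltW (hw0 t)) // ltW.
  by rewrite /Q lerDl !mulr_ge0 ?(ltW C'0) //; lra.
rewrite placeM placeV; have [h1 _] := hwj t0 jj0.
have pw : 0 < place j (w t) by apply: place_gt0.
rewrite mulrC ler_pdivrMr //; apply: le_trans (hC' _ _ hd j) _.
apply: (@le_trans _ _ (C' * H * (Cw * place j (w t)))).
  by rewrite [X in X <= _]mulrA ler_wpM2l // mulr_ge0 // ltW.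
have -> : C' * H * (Cw * place j (w t)) = Cw * (C' * H) * place j (w t) by ring.
by rewrite ler_wpM2r ?(ltW pw) // /Q lerDr mulr_ge0 //; lra.
Qed.

End Gaps.

(** * Gaps as first returns *)

Section StepSet.
Variables (R : realType) (L : fieldExtType rat) (iota : {rmorphism L -> R}).
Variables (d : nat) (e : d.+1.-tuple L).
Hypotheses (he : basis_of {:L} e) (he0 : e`_0 = 1).

(** Only finitely many lattice elements have coordinates bounded by [N]. *)
Lemma finite_step_set (N : nat) : exists (J : nat) (s : 'I_J -> L),
  [/\ (0 < J)%N, injective s, forall j, in_lattice e (s j) /\ 0 < iota (s j) &
   forall x, in_lattice e x -> 0 < iota x ->
     (forall k, `|ratr (coord e k x)| <= N%:R :> R) -> exists j, s j = x].
Proof.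
(* The bound N.+1 rather than N ensures that the set contains 1, hence is not empty. *)
pose F (f : {ffun 'I_d.+1 -> 'I_(2 * N.+1).+1}) : L :=
  \sum_k ((f k : nat)%:Z - N.+1%:Z)%:~R *: e`_k.
pose S := [seq x <- undup [seq F f | f <- enum {: {ffun 'I_d.+1 -> 'I_(2 * N.+1).+1}}] | 0 < iota x].
have S_in x : in_lattice e x -> 0 < iota x ->
    (forall k, `|ratr (coord e k x)| <= N.+1%:R :> R) -> x \in S.
  move=> lx x0 hx; rewrite mem_filter x0 mem_undup.
  pose m k := Num.floor (coord e k x).
  have mE k : (m k)%:~R = coord e k x by have /intrP[l hl] := lx k; rewrite /m hl intrKfloor.
  have hm k : `|m k| <= N.+1%:Z.
    by rewrite -(ler_int R) intr_norm -ratr_int mE hx.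
  have mlt k : (absz (m k + N.+1%:Z)%R < (2 * N.+1).+1)%N by clear -hm; have := hm k; lia.
  have m0 k : 0 <= m k + N.+1%:Z by clear -hm; have := hm k; lia.
  apply/mapP; exists [ffun k => Ordinal (mlt k)]; first by rewrite mem_enum.
  rewrite {1}(coordE he x); apply: eq_bigr => k _.
  by rewrite ffunE /= gez0_abs // addrK mE.
have S_lat x : x \in S -> in_lattice e x /\ 0 < iota x.
  rewrite mem_filter mem_undup => /andP[x0 /mapP[f _ xE]]; split=> //; rewrite xE.
  by apply: in_lattice_sum => k; [rewrite rpred_int | apply: in_lattice_e].
have S_uniq : uniq S by rewrite filter_uniq ?undup_uniq.
exists (size S), (fun j => S`_j); split.
- have : 1 \in S; last by case: S {S_in S_lat S_uniq}.
  apply: S_in; rewrite ?rmorph1 // -he0; first exact: (in_lattice_e he ord0).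
  move=> k; rewrite (coord_e he ord0) ratr_nat; case: eqP => _; rewrite ?normr1 ?normr0 ?ler0n //.
  by rewrite ler1n.
- by move=> i j /eqP; rewrite nth_uniq // => /eqP /val_inj.
- by move=> j; apply: S_lat; rewrite mem_nth.
move=> x lx x0 hx; have xS : x \in S.
  by apply: S_in => // k; apply: le_trans (hx k) _; rewrite ler_nat.
have lt : (index x S < size S)%N by rewrite index_mem.
by exists (Ordinal lt); rewrite /= nth_index.
Qed.

End StepSet.

Section Dynamics.
Variables (R : realType) (L : fieldExtType rat) (iota : {rmorphism L -> R}).
Variables (d : nat) (e : d.+1.-tuple L).
Hypotheses (he : basis_of {:L} e) (he0 : e`_0 = 1).
Variables (A : set 'rV[R]_d) (w : R -> L).
Hypotheses (hwu : forall t, order_unit e (w t)) (hw0 : forall t, 0 < iota (w t)).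
Variables (J : nat) (s : 'I_J -> L) (js : 'I_J).
Hypotheses (s_inj : injective s) (s_lat : forall j, in_lattice e (s j))
  (s_pos : forall j, 0 < iota (s j)).

Local Notation lattice := (in_lattice e).
Local Notation slope := (slope iota e).
Local Notation lift_of := (lattice_lift iota e).
Local Notation value m := (fract (dotz m slope)).
Local Notation inA t m := (A (t^-1 *: map_mx intr m)).

Definition scaled_shift (t : R) (x : L) : 'rV[R]_d := t^-1 *: real_coords R e (w t * x).

Definition shift_mem (t : R) (m : 'rV[int]_d) (x : L) : bool :=
  `[< A (t^-1 *: map_mx intr m + scaled_shift t x) >].

Hypothesis s_step : forall t m m', 1 < t -> inA t m -> inA t m' -> value m < value m' ->
  (forall x, inA t x -> value m < value x -> value m' <= value x) ->
  exists j, w t * s j = lift_of m' - lift_of m.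

Lemma shift_memE t m x : lattice x ->
  shift_mem t m x = `[< inA t (m + int_coords e (w t * x)) >].
Proof.
move=> lx; have lwx : lattice (w t * x) by have [_ h _] := hwu t; apply: h.
congr (`[< A _ >]); rewrite -scalerDr; congr (_ *: _); apply/rowP => i.
by rewrite mxE mxE [RHS]mxE [in RHS]mxE intrD -[(int_coords e _ 0 i)%:~R]ratr_int coord_int_coords // mxE.
Qed.

(** The step to the next point is the shortest one that stays in the window: a shorter one would give
a point in between. *)
Lemma next_point t m0 x m m' : 1 < t -> lattice x -> m = m0 + int_coords e (w t * x) ->
  inA t m -> inA t m' -> value m < value m' ->
  (forall x, inA t x -> value m < value x -> value m' <= value x) ->
  let j := next_step s iota js (shift_mem t m0) x in
  w t * s j = lift_of m' - lift_of m /\ m' = m0 + int_coords e (w t * (x + s j)).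
Proof.
move=> t1 lx mE Am Am' mm' next j.
have lw y : lattice y -> lattice (w t * y) by have [_ h _] := hwu t; apply: h.
have stepE k : m0 + int_coords e (w t * (x + s k)) = m + int_coords e (w t * s k).
  by rewrite mulrDr int_coordsD ?mE ?addrA //; apply: lw.
have [k hk] := s_step t1 Am Am' mm' next.
have kE : m' = m0 + int_coords e (w t * (x + s k)).
  rewrite stepE hk int_coordsB ?int_coords_lift //; try exact: in_lattice_lift.
  by rewrite addrC subrK.
suff -> : j = k by [].
apply: next_step_eq.
- by move=> a b /fmorph_inj /s_inj.
- rewrite shift_memE; first by rewrite -kE; apply/asboolP.
  by move=> l; rewrite linearD rpredD ?lx ?s_lat.
move=> j'; rewrite shift_memE => [|l]; last by rewrite linearD rpredD ?lx ?s_lat.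
move=> /asboolP; rewrite stepE => Ax; rewrite leNgt; apply/negP => lt.
have kv : iota (w t) * iota (s k) = value m' - value m.
  by rewrite -rmorphM hk rmorphB !iota_lattice_lift.
have lt' : iota (w t) * iota (s j') < value m' - value m by rewrite -kv ltr_pM2l ?hw0.
have pos : 0 < iota (w t) * iota (s j') by rewrite mulr_gt0 ?hw0 ?s_pos.
have ly : lattice (lift_of m + w t * s j').
  by move=> l; rewrite linearD rpredD ?in_lattice_lift ?lw.
have yE : iota (lift_of m + w t * s j') = value m + iota (w t) * iota (s j').
  by rewrite rmorphD iota_lattice_lift // rmorphM.
have /andP[v0 v1] := fract_itv (dotz m slope); have /andP[v0' v1'] := fract_itv (dotz m' slope).
have /(lattice_lift_coords he he0 ly) : 0 <= iota (lift_of m + w t * s j') < 1 by rewrite yE; lra.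
rewrite int_coordsD ?int_coords_lift //; [|exact: in_lattice_lift|exact: lw] => hy.
have vE : value (m + int_coords e (w t * s j')) = value m + iota (w t) * iota (s j').
  by rewrite -(iota_lattice_lift iota he0) hy yE.
have := next _ Ax; rewrite vE ltrDl pos => /(_ isT); lra.
Qed.

Lemma value_inj : injective (fun m : 'rV[int]_d => value m).
Proof.
move=> m m' /=; rewrite -!(iota_lattice_lift iota he0) => /fmorph_inj.
by move/(congr1 (int_coords e)); rewrite !int_coords_lift.
Qed.

Local Notation points t := (ordered_points (fun m : 'rV[int]_d => value m) (fset_set (lattice_points A t))).

Lemma delta_points t i : (0 < i)%N -> (i < size (points t))%N ->
  delta A slope t i = value (nth 0 (points t) i) - value (nth 0 (points t) i.-1).
Proof.
move=> i0 hi; rewrite /delta /y /sorted_points (sort_values (fun m : 'rV[int]_d => value m)).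
by rewrite !(nth_map (0 : 'rV[int]_d)) //; apply: leq_ltn_trans (leq_pred i) hi.
Qed.

(** Iterating [next_point]: the first returns from a point visit the points that follow it on the
circle, so the word of steps is the word of rescaled gaps. *)
Lemma return_word_gaps t (l i : nat) : 1 < t -> finite_set (lattice_points A t) ->
  (0 < i)%N -> (i + l < size (points t))%N ->
  forall n : 'I_l.+1, delta A slope t (i + n) =
    iota (w t) * iota (s (tnth (return_word s iota js l (shift_mem t (nth 0 (points t) i.-1))) n)).
Proof.
move=> t1 fin i0 il n; have t0 : 0 < t by lra.
set ms := points t in il *; set m0 := nth 0 ms i.-1.
have inM k : (k < size ms)%N -> inA t (nth 0 ms k).
  move=> hk; apply/(lattice_pointsE A _ t0).
  have := mem_nth 0 hk; rewrite mem_ordered_points in_fset_set // => h; exact: set_mem h.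
have inM' x : inA t x -> x \in fset_set (lattice_points A t).
  by move=> Ax; rewrite in_fset_set //; apply/mem_set/(lattice_pointsE A _ t0).
have step k x : (k.+1 < size ms)%N -> lattice x -> nth 0 ms k = m0 + int_coords e (w t * x) ->
    let j := next_step s iota js (shift_mem t m0) x in
    w t * s j = lift_of (nth 0 ms k.+1) - lift_of (nth 0 ms k) /\
    nth 0 ms k.+1 = m0 + int_coords e (w t * (x + s j)).
  move=> hk lx hx; apply: next_point => //.
  - by apply: inM; apply: ltnW.
  - exact: inM.
  - by apply: (ordered_points_lt value_inj); rewrite ltnSn.
  move=> x' Ax' lt; apply: (ordered_points_next value_inj) => //; exact: inM'.
pose path k := return_path s iota js (shift_mem t m0) k.
have path_lat k : lattice (path k).
  elim: k => [|k IH] c; first by rewrite /path /= linear0 rpred0.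
  by rewrite /path /return_path iterS linearD rpredD // ?s_lat //; apply: IH.
have path_pt k : (i.-1 + k < size ms)%N -> nth 0 ms (i.-1 + k) = m0 + int_coords e (w t * path k).
  elim: k => [|k IH] hk.
    by rewrite addn0 mulr0; apply/rowP => c; rewrite !mxE linear0 floor0 addr0.
  rewrite addnS in hk *; have [_ ->] := step _ _ hk (path_lat k) (IH (ltnW hk)).
  by congr (_ + int_coords e (_ * _)).
have nl : (n <= l)%N by rewrite -ltnS.
have hin : (i + n < size ms)%N by apply: leq_ltn_trans il; rewrite leq_add2l.
have iE : (i + n)%N = (i.-1 + n).+1 by rewrite -addSn prednK.
rewrite delta_points; [|by rewrite addn_gt0 i0|exact: hin].
rewrite -/ms; move: hin; rewrite iE /= => hin.
have [h _] := step _ _ hin (path_lat n) (path_pt _ (ltnW hin)).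
by rewrite -rmorphM tnth_mktuple h rmorphB !iota_lattice_lift.
Qed.

End Dynamics.

Section WordCount.
Variables (R : realType) (d : nat) (A : set 'rV[R]_d).

Lemma ell_total (I : finType) (i0 : I) t : 0 < t -> ell A t = total_count A i0 t.
Proof.
move=> t0; congr (size (fset_set _)); apply/seteqP; split=> m /=; rewrite ffunE addr0.
  by move=> /(lattice_pointsE _ _ t0) ?; apply/asboolP.
by move=> /asboolP ?; apply/(lattice_pointsE _ _ t0).
Qed.

Lemma count_pattern (I : finType) (i0 : I) (B : pred {ffun I -> bool}) (v : I -> 'rV[R]_d)
    (Q : pred 'rV[int]_d) t :
  0 < t -> finite_set (lattice_points A t) ->
  (forall m, B (memb A v (t^-1 *: map_mx intr m)) =
     `[< A (t^-1 *: map_mx intr m) >] && Q m) ->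
  pattern_count A B v t = count Q (fset_set (lattice_points A t)).
Proof.
move=> t0 fin hB.
have SE : [set m : 'rV[int]_d | B (memb A v (t^-1 *: map_mx intr m))] =
    lattice_points A t `&` [set m | Q m].
  apply/seteqP; split=> m /=; rewrite hB.
    by case/andP => /asboolP Am Qm; split=> //; apply/(lattice_pointsE _ _ t0).
  by case=> /(lattice_pointsE _ _ t0) Am Qm; rewrite Qm andbT; apply/asboolP.
rewrite /pattern_count SE -size_filter; apply/perm_size/uniq_perm.
- exact: fset_uniq.
- by rewrite filter_uniq // fset_uniq.
move=> m; rewrite mem_filter !in_fset_set //; last exact: finite_setIl.
by rewrite in_setI andbC; congr (_ && _); apply/idP/idP => [/set_mem|Qm]; [|apply/mem_set].
Qed.

End WordCount.

(** * Windows and the circle *)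

Section WindowCircle.
Variables (R : realType) (d : nat).

Lemma row_norm_ge (x : 'rV[R]_d) i : `|x 0 i| <= `|x|.
Proof.
rewrite [leRHS]mx_normrE.
exact: (le_bigmax 0 (fun ij : 'I_1 * 'I_d => `|x ij.1 ij.2|) (0, i)).
Qed.

Lemma row_norm_le (x : 'rV[R]_d) (b : R) : 0 <= b -> (forall i, `|x 0 i| <= b) -> `|x| <= b.
Proof.
move=> b0 hb; rewrite [leLHS]mx_normrE; apply: bigmax_le => // -[i j] _ /=.
by rewrite (ord1 i).
Qed.

Lemma convex_line_convex (A : set 'rV[R]_d) : convex_set A -> line_convex A.
Proof.
move=> cA x y t /andP[t0 t1] Ax Ay.
have := cA x y (Itv01 t0 t1); rewrite !inE => /(_ Ax Ay).
by [].
Qed.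

Lemma bounded_coordinates (A : set 'rV[R]_d) : bounded_set A ->
  exists2 c : nat, (0 < c)%N & forall x, A x -> forall i, `|x 0 i| <= c%:R.
Proof.
move=> [M [Mreal hM]].
have h := hM (`|M| + 1); exists (Num.bound (`|M| + 1)).+1 => // x Ax i.
apply: le_trans (row_norm_ge x i) _.
have : `|x| <= `|M| + 1 by apply: h => //; have := ler_norm M; lra.
move/le_trans; apply; rewrite -natr1 ltW // ltr_wpDr //.
by apply: archi_boundP; apply: addr_ge0.
Qed.

Lemma interior_cube (A : set 'rV[R]_d) : A° !=set0 ->
  exists (p : 'rV[R]_d) (rho : R), 0 < rho /\
    forall x : 'rV[R]_d, (forall i, `|x 0 i - p 0 i| <= rho) -> A x.
Proof.
move=> [p /nbhs_ballP[r /= r0 hr]]; exists p, (r / 2); split; first by rewrite divr_gt0.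
move=> x hx; apply: hr; rewrite -ball_normE /=.
apply: le_lt_trans (_ : r / 2 < r); last by rewrite ltr_pdivrMr //; lra.
apply: row_norm_le => [|i]; first by rewrite divr_ge0 // ltW.
by rewrite !mxE distrC.
Qed.

Lemma circle_dist_repr (a b : circle R) :
  exists m : int, `|repr a - repr b - m%:~R| = circle_dist a b.
Proof.
rewrite /circle_dist; set x := repr a - repr b.
have /andP[f0 f1] := fract_itv x.
case: (leP (fract x) (1 - fract x)) => h.
  by exists (Num.floor x); rewrite -/(fract x) ger0_norm.
exists (Num.floor x + 1); rewrite intrD opprD addrA -/(fract x).
by rewrite ler0_norm ?opprB //; lra.
Qed.

Lemma repr_pi_int (a : R) : repr (\pi_(circle R) a)%qT - a \is a Num.int.
Proof.
have : (repr (\pi_(circle R) a)%qT == a %[mod (circle R)])%qT by rewrite reprK.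
by rewrite eqmodE.
Qed.

End WindowCircle.

(** * Frequencies of words of gaps *)

Lemma powR_expRN1 (R : realType) (t : R) : 0 < t -> (expR (-1)) `^ ln t = t^-1.
Proof.
by move=> t0; rewrite -expRM mulN1r expRN lnK.
Qed.

Lemma index_bound (q l i : nat) : (0 < i)%N -> (i <= q - l - 1)%N -> (i + l < q)%N.
Proof. lia. Qed.

Lemma dist_chain (R : realDomainType) (x a b h E1 E2 E3 : R) :
  `|a - x| <= E1 -> `|a - b| <= E2 -> `|b - h| <= E3 -> `|x - h| <= E1 + E2 + E3.
Proof.
move=> h1 h2 h3; have -> : x - h = - (a - x) + (a - b) + (b - h) by ring.
apply: le_trans (ler_normD _ _) _; apply: lerD => //.
by apply: le_trans (ler_normD _ _) _; apply: lerD => //; rewrite normrN.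
Qed.

Lemma rate_sum (R : realFieldType) (a C S t : R) :
  (a + C * (S + 1) + C) / t = a / t + C * (S / t + t^-1) + C / t.
Proof. by rewrite !mulrDl -mulrA mulrDl mul1r. Qed.

Theorem theoremC (R : realType) (d : nat) (hd : (1 <= d)%N)
  (A : set 'rV[R]_d)
  (hAbounded : bounded_set A) (hAconvex : convex_set A) (hAint : A° !=set0)
  (L : fieldExtType rat) (iota : {rmorphism L -> R})
  (b : d.-tuple L) (hb : basis_of {:L} (1 :: b))
  (omega : 'I_d -> R) (homega : forall i, omega i = iota (tnth b i))
  (r : nat) (hr1 : (1 <= r)%N) (hr : unit_group_rank L r) :
  exists (J : nat) (s : 'I_J -> L) (u : R -> L),
    [/\ injective s,
        forall t : R, 1 < t -> unit_group (u t),
        forall (t : R) (i : nat), 1 < t -> (1 <= i <= ell A t - 1)%N ->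
          exists j, iota (u t) * delta A omega t i = iota (s j)
      & forall l : nat,
        exists (k : nat) (h : 'rV[circle R]_k -> 'rV[R]_r ->
                              l.+1.-tuple 'I_J -> R)
               (theta : 'rV[R]_k) (beta : 'rV[R]_r) (alpha : R),
          [/\ (k <= d + 1)%N,
              maps_to_simplex h,
              torus_cube_lipschitz h,
              0 < alpha < 1
            & forall w : l.+1.-tuple 'I_J,
              exists C : R, \forall t \near +oo,
                `|word_proportion A omega (fun j => iota (s j)) (iota (u t)) t w
                  - h (torus_pi (ln t *: theta))
                      (map_mx (@fract R) (ln t *: beta)) w|
                <= C * alpha `^ ln t]].
Proof.
set e : d.+1.-tuple L := [tuple of 1 :: b].
have he : basis_of {:L} e by [].
have he0 : e`_0 = 1 by [].
have omE : omega = slope iota e.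
  by apply/funext => i; rewrite homega /slope (tnth_nth 0).
rewrite {hb homega}omE.
have [sg [hE hall]] := number_field_embeddings R[i] he.
have [j0 hj0'] := hall (real_complex R \o iota : {rmorphism L -> R[i]}).
have hj0 x : sg j0 x = ((iota x)%:C)%C by rewrite -hj0'.
have [eps [beta [heps hbeta]]] := unit_ray_rank hd he he0 hE hj0 hr.2.
have /choice[ph hph] : forall q : 'I_d.+1 * 'I_r, exists a,
    sg q.1 (eps q.2) = cexp (log_eps sg eps q.1 q.2) (2 * pi * a).
  by move=> q; apply: polar_form; rewrite fmorph_eq0; have [[]] := heps q.2.
pose phase j i := ph (j, i).
have hphase j i : sg j (eps i) = cexp (log_eps sg eps j i) (2 * pi * phase j i) := hph (j, i).
pose w t := unit_scale eps beta t.
have hwu t : order_unit e (w t) by apply: unit_scale_unit heps t.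
have hw0 t : 0 < iota (w t) by apply: unit_scale_gt0 heps t.
have [Cw Cw1 hCw] := unit_scale_bounds hd he hE hj0 heps hbeta.
have hwj t j : 0 < t -> j != j0 -> t <= Cw * absval sg j (w t) /\ absval sg j (w t) <= Cw * t.
  by move=> t0; have [h _] := hCw t t0; apply: h.
have hwi t : 0 < t -> 1 <= Cw * (iota (w t) * t ^+ d) /\ iota (w t) * t ^+ d <= Cw.
  by move=> t0; have [] := hCw t t0.
have [c c0 hc] := bounded_coordinates hAbounded.
have cA := convex_line_convex hAconvex.
have [p [rho [rho0 hrho]]] := interior_cube hAint.
have [N hN] := rescaled_gap_bounded he he0 hE hj0 hc rho0 hrho hwu hw0 Cw1 hwj hwi.
have [J [s [J0 sinj slp sall]]] := finite_step_set iota he he0 N.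
have slat j : in_lattice e (s j) by have [] := slp j.
have spos j : 0 < iota (s j) by have [] := slp j.
pose js := Ordinal J0.
have sstep t m m' : 1 < t -> A (t^-1 *: map_mx intr m) -> A (t^-1 *: map_mx intr m') ->
    fract (dotz m (slope iota e)) < fract (dotz m' (slope iota e)) ->
    (forall x, A (t^-1 *: map_mx intr x) -> fract (dotz m (slope iota e)) < fract (dotz x (slope iota e)) ->
      fract (dotz m' (slope iota e)) <= fract (dotz x (slope iota e))) ->
    exists j, w t * s j = lattice_lift iota e m' - lattice_lift iota e m.
  move=> t1 Am Am' mm' next; have [ls ps cs] := hN t m m' (ltW t1) Am Am' mm' next.
  have [j hj] := sall _ ls ps cs; exists j; rewrite hj mulVKf //; by have [] := hwu t.
have fin t : 0 < t -> finite_set (lattice_points A t).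
  move=> t0; have -> : lattice_points A t = [set m : 'rV[int]_d | A (t^-1 *: map_mx intr m)].
    by apply/seteqP; split=> m /(lattice_pointsE A _ t0).
  exact: (finite_window hc t0).
have gaps := return_word_gaps he he0 hwu hw0 js sinj slat spos sstep.
exists J, s, (fun t => (w t)^-1); split=> //.
- by move=> t _; apply: (order_unit_group he); apply: order_unitV.
- move=> t i t1 /andP[i0 il]; have t0 : 0 < t by apply: lt_trans t1.
  have hi : (i + 0 < ell A t)%N.
    by apply: index_bound i0 _; rewrite subn0.
  have := gaps t 0%N i t1 (fin t t0) i0; rewrite size_ordered_points => /(_ hi ord0).
  rewrite addn0 => ->; eexists; rewrite fmorphV mulKf //; by rewrite gt_eqF.
move=> l.
pose I : finType := shift_type s l; pose i0 : I := shift0 s l.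
have [C [T [H [C0 T1 tot lim shift]]]] := ratio_limit hd cA c0 hc rho0 hrho i0.
pose B (v : l.+1.-tuple 'I_J) : pred {ffun I -> bool} := reads_word iota js v.
have gB v : guarded i0 (B v) by apply: reads_word_guarded.
pose disp (x : 'rV[R]_d.+1) (z : 'rV[R]_r) : I -> 'rV[R]_d :=
  fun i => displacement e sg j0 eps phase x z (val i).
have disp0 x z : disp x z i0 = 0 by apply: displacement0.
have disp_per (x x' : 'rV[R]_d.+1) (z : 'rV[R]_r) : (forall j, x 0 j - x' 0 j \is a Num.int) -> disp x z = disp x' z.
  by move=> hx; apply/funext => i; apply: displacement_periodic.
exists d.+1, (fun x z v => H (B v) (disp (map_mx repr x) z)), (rotation beta phase), beta, (expR (-1)).
split.
- by rewrite addn1.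
- move=> x z _; split=> [|v]; last exact: (frequency_ge0 lim).
  apply: (frequency_sum T1 tot lim) => // t Tt.
  apply: (sum_pattern_count c0 hc) => //; first exact: sum_reads_word.
  by apply: lt_le_trans Tt; apply: lt_le_trans T1.
- have /choice[K hK] : forall i : I, exists K : R, 0 <= K /\ forall (x x' : 'rV[R]_d.+1) (z z' : 'rV[R]_r) D,
      (forall i, 0 <= z 0 i <= 1) -> (forall i, 0 <= z' 0 i <= 1) ->
      (forall j, `|x 0 j - x' 0 j| <= D) -> (forall i, `|z 0 i - z' 0 i| <= D) ->
      forall k, `|disp x z i 0 k - disp x' z' i 0 k| <= K * D.
    by move=> i; have [K K0 hK] := displacement_lipschitz e sg j0 eps phase (val i); exists K.
  have sK0 : 0 <= \sum_i K i by apply: sumr_ge0 => i _; have [] := hK i.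
  exists (C * \sum_i K i) => x x' z z' hz hz' v; set D := Num.max _ _.
  have D0 : 0 <= D by rewrite le_max normr_ge0 orbT.
  have /choice[m hm] := fun j => circle_dist_repr (x 0 j) (x' 0 j).
  (* The representative of x' closest to that of x, coordinate by coordinate. *)
  pose X' : 'rV[R]_d.+1 := \row_j (repr (x' 0 j) + (m j)%:~R).
  have -> : disp (map_mx repr x') z' = disp X' z'.
    by apply: disp_per => j; rewrite !mxE opprD addrA subrr add0r rpredN rpred_int.
  rewrite -mulrA; apply: (frequency_lipschitz lim shift) => //; first exact: mulr_ge0.
  move=> i k; have [K0 hKi] := hK i; apply: (@le_trans _ _ (K i * D)).
    apply: hKi => // [j|i'].
      rewrite !mxE opprD addrA hm le_max; apply/orP; left.
      exact: (le_bigmax 0 (fun j => circle_dist (x 0 j) (x' 0 j))).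
    rewrite le_max; apply/orP; right.
    by apply: le_trans (row_norm_ge (z - z') i'); rewrite !mxE.
  by rewrite ler_wpM2r //; apply: big_le_max_sum => i'; have [] := hK i'.
- by rewrite expR_gt0 expR_lt1 ltrN10.
move=> v.
have /choice[K hK] : forall i : I, exists K : R, 0 <= K /\ forall t, 1 <= t -> forall k,
    `|scaled_shift e w t (val i) 0 k -
      disp (ln t *: rotation beta phase) (frac_part beta t) i 0 k| <= K / t.
  move=> i; have [K K0 hK] := displacement_close hd he hE hj0 heps hbeta hphase (val i).
  by exists K.
have sK0 : 0 <= \sum_i K i by apply: sumr_ge0 => i _; have [] := hK i.
exists (2 * l.+1%:R * T ^+ d + C * (\sum_i K i + 1) + C).
exists T; split; first exact: num_real.
move=> t Tt; have t1 : 1 < t by apply: le_lt_trans Tt.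
have t0 : 0 < t by apply: lt_trans t1.
rewrite powR_expRN1 //.
pose vt : I -> 'rV[R]_d := fun i => scaled_shift e w t (val i).
pose v0 := disp (ln t *: rotation beta phase) (frac_part beta t).
have vt0 : vt i0 = 0.
  by rewrite /vt /scaled_shift /= mulr0; apply/rowP => k; rewrite !mxE linear0 rmorph0 mulr0.
have -> : disp (map_mx repr (torus_pi (ln t *: rotation beta phase))) (map_mx (@fract R) (ln t *: beta)) = v0.
  by apply: disp_per => j; rewrite !mxE; apply: repr_pi_int.
pose Q m := return_word s iota js l (shift_mem e A w t m) == v.
pose M := fset_set (lattice_points A t).
have cntE : pattern_count A (B v) vt t = count Q M.
  apply: (count_pattern i0) => // [|m]; first exact: fin.
  have -> : memb A vt (t^-1 *: map_mx intr m) = [ffun i => shift_mem e A w t m (val i)] by [].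
  rewrite /B reads_wordE; congr (_ && _); rewrite /shift_mem.
  by rewrite (_ : scaled_shift e w t 0 = 0) ?addr0 //; apply: vt0.
pose n := (ell A t - l - 1)%N.
pose pts := ordered_points (fun m : 'rV[int]_d => fract (dotz m (slope iota e))) M.
pose cw := count (fun i => Q (nth 0 pts i.-1)) (seq.iota 1 n).
have wpE : word_proportion A (slope iota e) (fun j => iota (s j)) (iota (w t)^-1) t v = cw%:R / n%:R.
  rewrite /word_proportion -/n; congr (_%:R / _); apply: eq_in_count => i.
  rewrite mem_iota add1n => /andP[i1 il].
  have il' : (i + l < size pts)%N.
    by rewrite size_ordered_points; apply: index_bound i1 _; rewrite -ltnS.
  have hg := gaps t l i t1 (fin t t0) i1 il'; rewrite -/pts in hg.
  apply/forallP/eqP => [h|<- k]; last by rewrite hg fmorphV invrK mulrC.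
  apply: eq_from_tnth => k; have := h k; rewrite hg fmorphV invrK mulrC => /eqP.
  by move/(mulIf (lt0r_neq0 (hw0 t)))/fmorph_inj/sinj.
have [cle cge] := count_first_points (fun m : 'rV[int]_d => fract (dotz m (slope iota e))) M Q 0 l.
rewrite -/pts -/n -/cw -cntE in cle cge.
have ellE : ell A t = total_count A i0 t := ell_total A i0 t0.
have Td0 : 0 < T ^+ d by rewrite exprn_gt0 // (lt_le_trans ltr01).
have ell_ge : t / T ^+ d <= (total_count A i0 t)%:R.
  apply: le_trans (tot t (ltW Tt)); rewrite exprVn mulrC ler_wpM2l ?invr_ge0 ?(ltW Td0) //.
  by rewrite -[X in X <= _]expr1 ler_weXn2l // ltW.
have ell0 : 0 < (total_count A i0 t)%:R :> R by apply: lt_le_trans ell_ge; rewrite divr_gt0.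
have E1 : `|ratio A i0 (B v) vt t - cw%:R / n%:R| <= 2 * l.+1%:R * T ^+ d / t.
  apply: (@le_trans _ _ (2 * l.+1%:R / (total_count A i0 t)%:R)); last first.
    rewrite -[X in _ <= X]mulrA ler_wpM2l ?mulr_ge0 //.
    by rewrite -[X in _ <= X]invf_div lef_pV2 ?posrE // divr_gt0.
  apply: ratio_diff => //.
  - by rewrite ler_nat /cw; apply: leq_trans (count_size _ _) _; rewrite size_iota.
  - rewrite ger0_norm ?subr_ge0 ?ler_nat // lerBlDl -natrD ler_nat //.
  rewrite -ellE ger0_norm ?subr_ge0 ?ler_nat; last by rewrite /n -subnDA leq_subr.
  by rewrite lerBlDl -natrD ler_nat /n -subnDA addn1 addnC -leq_subLR.
have E2 : `|ratio A i0 (B v) vt t - ratio A i0 (B v) v0 t| <= C * ((\sum_i K i) / t + t^-1).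
  apply: shift; rewrite ?(ltW Tt) ?divr_ge0 ?(ltW t0) //; first exact: disp0.
  move=> i k; have [_ hKi] := hK i; apply: le_trans (hKi t (ltW t1) k) _.
  by rewrite ler_pM2r ?invr_gt0 //; apply: big_le_max_sum => i'; have [] := hK i'.
have E3 : `|ratio A i0 (B v) v0 t - H (B v) v0| <= C / t.
  by apply: lim; [exact: gB | exact: disp0 | exact: ltW].
by rewrite wpE rate_sum; apply: dist_chain E1 E2 E3.
Qed.
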